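(* Assume that $\mu \colon \mathcal{P}^2_o \to \mathbb{R}^2$ is a measurable valuation which is $\mathrm{SL}(2)$-contravariant, i.e. $\mu(\phi P) = \phi^{-t}\,\mu(P)$ for all $P \in \mathcal{P}^2_o$ and all $\phi \in \mathrm{SL}(2)$. Then there exist $k_1,k_2 \in \mathbb{R}$ such that \[ \mu(P) = k_1\, m(P^* ) + k_2\, \rho_{\frac{\pi}{2}}\, m(P) \quad\text{for all } P \in \mathcal{P}^2_o. \]
   Context: $\mathcal{P}^2_o$ denotes the set of convex polygons in $\mathbb{R}^2$ containing the origin in their interiors, with the Hausdorff metric topology; ''measurable'' refers to Borel $\sigma$-algebras. $\phi^{-t}$ is the inverse of the transpose of $\phi$. A map $\mu$ on a family $\mathcal{S}$ of sets is a valuation if $\mu(K \cup L) + \mu(K \cap L) = \mu(K) + \mu(L)$ whenever $K, L, K\cup L, K \cap L \in \mathcal{S}$. The moment vector is $m(P) = \int_P x\,dx$; $P^* = \{y : y^t x \le 1 \ \forall x \in P\}$ is the polar body; $\rho_{\frac{\pi}{2}}$ is the counter-clockwise rotation of $\mathbb{R}^2$ by $\frac{\pi}{2}$. *)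

(* Defs.v *)
From HB Require Import structures.
From mathcomp Require Import all_boot all_order all_algebra.
From mathcomp Require Import all_classical all_reals all_analysis.
Set Implicit Arguments. Unset Strict Implicit. Unset Printing Implicit Defensive.
Import Order.TTheory GRing.Theory Num.Theory.
Local Open Scope classical_set_scope.
Local Open Scope ring_scope.

Section Defs.
Variable R : realType.
Notation pt := (R * R)%type.

Definition vadd (x y : pt) : pt := (x.1 + y.1, x.2 + y.2).
Definition vscale (k : R) (x : pt) : pt := (k * x.1, k * x.2).
Definition dot (x y : pt) : R := x.1 * y.1 + x.2 * y.2.
Definition edist (x y : pt) : R := Num.sqrt ((x.1 - y.1) ^+ 2 + (x.2 - y.2) ^+ 2).

Definition conv_hull (n : nat) (v : 'I_n -> pt) : set pt :=
  [set x | exists l : 'I_n -> R, (forall i, 0 <= l i) /\ \sum_(i < n) l i = 1 /\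
      x = (\sum_(i < n) l i * (v i).1, \sum_(i < n) l i * (v i).2)].

Definition in_interior (x : pt) (K : set pt) : Prop :=
  exists e : R, 0 < e /\ forall y, edist x y < e -> K y.

Definition polygon_o (P : set pt) : Prop :=
  (exists (n : nat) (v : 'I_n -> pt), P = conv_hull v) /\ in_interior (0, 0) P.

Definition dist_pt_set (x : pt) (L : set pt) : R := inf [set edist x y | y in L].
Definition hausdorff (K L : set pt) : R :=
  Num.max (sup [set dist_pt_set x L | x in K]) (sup [set dist_pt_set y K | y in L]).

Definition hopen (A : set (set pt)) : Prop :=
  A `<=` polygon_o /\
  forall K, A K -> exists e : R, 0 < e /\
     forall L, polygon_o L -> hausdorff K L < e -> A L.

Definition borel_Po : set (set (set pt)) := <<s polygon_o, hopen >>.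
Definition eopen (U : set pt) : Prop := forall x, U x -> in_interior x U.
Definition borel_R2 : set (set pt) := <<s setT, eopen >>.

Definition measurable_on_Po (mu : set pt -> pt) : Prop :=
  forall B, borel_R2 B -> borel_Po (polygon_o `&` mu @^-1` B).

Definition valuation_on_Po (mu : set pt -> pt) : Prop :=
  forall K L, polygon_o K -> polygon_o L -> polygon_o (K `|` L) -> polygon_o (K `&` L) ->
    vadd (mu (K `|` L)) (mu (K `&` L)) = vadd (mu K) (mu L).

Definition mx_app (A : 'M[R]_2) (x : pt) : pt :=
  (A 0 0 * x.1 + A 0 1 * x.2, A 1 0 * x.1 + A 1 1 * x.2).

Definition SL2_contravariant (mu : set pt -> pt) : Prop :=
  forall (phi : 'M[R]_2) P, \det phi = 1 -> polygon_o P ->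
    mu (mx_app phi @` P) = mx_app (invmx phi)^T (mu P).

Definition polar (P : set pt) : set pt := [set y | forall x, P x -> dot y x <= 1].

Definition leb2 := (@lebesgue_measure R \x @lebesgue_measure R)%E.
Definition moment (P : set pt) : pt :=
  (Rintegral leb2 P (fun x => x.1), Rintegral leb2 P (fun x => x.2)).

Definition rot90 (x : pt) : pt := (- x.2, x.1).

End Defs.

(* Main.v *)
Require Import Defs.
From HB Require Import structures.
From mathcomp Require Import all_boot all_order all_algebra.
From mathcomp Require Import all_classical all_reals all_analysis.
From mathcomp Require Import measurable_realfun.
From mathcomp Require Import ring lra.
Set Implicit Arguments. Unset Strict Implicit. Unset Printing Implicit Defensive.
Import Order.TTheory GRing.Theory Num.Theory.
Local Open Scope classical_set_scope.
Local Open Scope ring_scope.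

(** The valuation z := rho^-1 mu, where rho is the rotation by a right angle, is
    SL(2)-covariant: z (phi P) = phi (z P). The moment vector of P and rho^-1
    applied to that of the polar of P are two linearly independent such
    valuations, bounded along segments of polygons, so it suffices that the
    solution space is at most two-dimensional.

    On quadrilaterals whose diagonals meet at a point of the first axis, cutting
    along a diagonal and the invariance under shears and diagonal matrices yield
    Cauchy functional equations. Their solutions leave one free constant f, with
    f = 0 exactly when z is a sum over the edges [p, q] of gtail (det (p, q)) p +
    ghead (det (p, q)) q. A triangle is a degenerate quadrilateral in three ways;
    comparing the three expressions forces such an edge sum to be a multiple of
    the moment vector. So two linear conditions make z vanish on quadrilaterals.

    A valuation vanishing on quadrilaterals vanishes: a polygon is cut along two
    lines through the origin, and in each sector the vertices are removed one at
    a time by cutting along the line through the origin and a vertex.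

    Measurability only enters through a Steinhaus argument: along a segment of
    polygons there are, for every h < 1/3, two parameters at distance h at which
    z is bounded by a constant independent of h. *)

(** * Planar convex hulls *)

(** A line through the origin cuts a polygon into two pieces with the origin on their boundary,
    outside the domain of z. So every cut is made between overlapping polygons: each piece keeps
    something beyond the line, and [mix] exchanges what lies on the two sides of a common diagonal.
    Quadrilaterals with a diagonal through the origin are the pieces on which this exchange can be
    exploited, and in the sector argument arbitrarily small opposite points, the caps - e x and - e'
    y, keep the origin in the interior. An exchange separates the variables of the two sides. The
    shears tie them together again, because the upper and the lower vertex act jointly on the point
    where the second diagonal meets the first; this is where the Cauchy equations come from. There
    an increment depends only on the length of the step, so one position with both end values
    bounded is enough to bound it. The moments of general polygons are never computed. Of the two
    model valuations only independence is needed beyond their formal properties, and crude bounds on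
    one rectangle and on a kite with that rectangle as polar provide it. *)

Lemma mem_tail (T : eqType) (x y : T) (s : seq T) : x \in s -> x \in y :: s.
Proof. by rewrite inE => ->; rewrite orbT. Qed.

Lemma mem_catl (T : eqType) (x : T) (s s' : seq T) : x \in s -> x \in s ++ s'.
Proof. by rewrite mem_cat => ->. Qed.

Lemma mem_catr (T : eqType) (x : T) (s s' : seq T) : x \in s' -> x \in s ++ s'.
Proof. by rewrite mem_cat => ->; rewrite orbT. Qed.

Section Convexity.
Variable R : realType.
Notation pt := (R * R)%type.
Implicit Types (p q u v x y : pt) (s : seq pt) (C D : set pt).

Definition det2 (x y : pt) : R := x.1 * y.2 - x.2 * y.1.

Definition lin (t : R) (x y : pt) : pt :=
  ((1 - t) * x.1 + t * y.1, (1 - t) * x.2 + t * y.2).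

Definition cvx (C : set pt) := forall x y t, C x -> C y -> 0 <= t -> t <= 1 ->
  C (lin t x y).

(** As the smallest convex set, the hull comes with an induction principle: an inclusion is checked
    on the listed points, with no coefficients to carry. *)
Definition hull (s : seq pt) : set pt :=
  [set x | forall C, cvx C -> (forall p, p \in s -> C p) -> C x].

Lemma pt_eq x y : x.1 = y.1 -> x.2 = y.2 -> x = y.
Proof. by case: x y => [a b] [c d] /= -> ->. Qed.

Lemma hull_in s p : p \in s -> hull s p.
Proof. by move=> ps C _; apply. Qed.

Lemma hull_cvx s : cvx (hull s).
Proof.
by move=> x y t hx hy t0 t1 C cC sC; apply: (cC) => //; [exact: (hx _ cC sC) | exact: (hy _ cC sC)].
Qed.

Lemma hull_min s C : cvx C -> (forall p, p \in s -> C p) -> hull s `<=` C.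
Proof. by move=> cC sC x; apply. Qed.

Lemma hull_sub s s' : (forall p, p \in s -> hull s' p) -> hull s `<=` hull s'.
Proof. by move=> h; apply: hull_min h; exact: hull_cvx. Qed.

Lemma hull_subset s s' : {subset s <= s'} -> hull s `<=` hull s'.
Proof. by move=> ss'; apply: hull_sub => p /ss'; exact: hull_in. Qed.

Lemma hull_eq s s' : (forall p, p \in s -> hull s' p) ->
  (forall p, p \in s' -> hull s p) -> hull s = hull s'.
Proof. by move=> h1 h2; apply/seteqP; split; exact: hull_sub. Qed.

Lemma eq_hull s s' : s =i s' -> hull s = hull s'.
Proof. by move=> e; apply: hull_eq => p; [rewrite e|rewrite -e]; exact: hull_in. Qed.

Lemma lin0 x y : lin 0 x y = x.
Proof. by apply: pt_eq => /=; ring. Qed.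

Lemma lin1 x y : lin 1 x y = y.
Proof. by apply: pt_eq => /=; ring. Qed.

Lemma cvx3 C x y w (a b c : R) : cvx C -> C x -> C y -> C w ->
  0 <= a -> 0 <= b -> 0 <= c -> a + b + c = 1 ->
  C (a * x.1 + b * y.1 + c * w.1, a * x.2 + b * y.2 + c * w.2).
Proof.
move=> cC Cx Cy Cw a0 b0 c0 e.
have [bc0|bcN0] := eqVneq (b + c) 0.
  have -> : (a * x.1 + b * y.1 + c * w.1, a * x.2 + b * y.2 + c * w.2) = x.
    have -> : b = 0 by lra.
    have -> : c = 0 by lra.
    have -> : a = 1 by lra.
    by apply: pt_eq => /=; ring.
  by [].
have bc : 0 < b + c by rewrite lt_neqAle eq_sym bcN0 addr_ge0.
have C' : C (lin (c / (b + c)) y w).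
  apply: cC => //; first by rewrite divr_ge0// ltW.
  by rewrite ler_pdivrMr// mul1r lerDr.
have -> : (a * x.1 + b * y.1 + c * w.1, a * x.2 + b * y.2 + c * w.2) =
   lin (b + c) x (lin (c / (b + c)) y w).
  have -> : a = 1 - (b + c) by lra.
  by apply: pt_eq => /=; field.
by apply: cC => //; lra.
Qed.

Lemma cvx_cone C p : cvx C ->
  cvx [set x | exists t y, [/\ 0 <= t, t <= 1, C y & x = lin t p y]].
Proof.
move=> cC x x' r [t [y [t0 t1 Cy ->]]] [t' [y' [t'0 t'1 Cy' ->]]] r0 r1.
set T := (1 - r) * t + r * t'.
have T0 : 0 <= T by rewrite /T; nra.
have T1 : T <= 1 by rewrite /T; nra.
(* [T] is the total weight away from [p]. If it vanishes the combination is [p] itself and any point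
   of [C] serves as second end. *)
have [Tz|TN0] := eqVneq T 0.
  exists 0, y; split => //; rewrite lin0.
  have h1 : (1 - r) * t = 0.
    apply/eqP; rewrite eq_le; apply/andP; split; last by nra.
    by rewrite -Tz /T lerDl; nra.
  have h2 : r * t' = 0 by rewrite -Tz /T h1; ring.
  apply: pt_eq => /=.
    transitivity (p.1 + (1 - r) * t * (y.1 - p.1) + r * t' * (y'.1 - p.1)); first by ring.
    by rewrite h1 h2; ring.
  transitivity (p.2 + (1 - r) * t * (y.2 - p.2) + r * t' * (y'.2 - p.2)); first by ring.
  by rewrite h1 h2; ring.
have Tp : 0 < T by rewrite lt_neqAle eq_sym TN0.
exists T, (lin (r * t' / T) y y'); split => //.
  apply: cC => //; first by rewrite divr_ge0// mulr_ge0.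
  by rewrite ler_pdivrMr// mul1r /T lerDr mulr_ge0// subr_ge0.
have Tk : T * (r * t' / T) = r * t' by field.
move: (r * t' / T) Tk => k Tk.
apply: pt_eq => /=.
  transitivity ((1 - T) * p.1 + T * y.1 - (T * k) * y.1 + (T * k) * y'.1); last by ring.
  by rewrite Tk /T; ring.
transitivity ((1 - T) * p.2 + T * y.2 - (T * k) * y.2 + (T * k) * y'.2); last by ring.
by rewrite Tk /T; ring.
Qed.

Lemma hull_cons p s x : s != [::] -> hull (p :: s) x ->
  exists t y, [/\ 0 <= t, t <= 1, hull s y & x = lin t p y].
Proof.
move=> s0 hx; apply: (hx _ (@cvx_cone _ p (@hull_cvx s))) => q.
rewrite inE => /predU1P[->|qs].
  case: s s0 {hx} => // r s _; exists 0, r; rewrite lin0; split => //.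
  by apply: hull_in; rewrite mem_head.
by exists 1, q; rewrite lin1; split => //; exact: hull_in.
Qed.

(** Dividing by the total weight inside the statement lets the induction drop one point without
    renormalising the others. *)
Lemma cvx_sum C : cvx C -> forall n (v : 'I_n -> pt) (l : 'I_n -> R),
  (forall i, C (v i)) -> (forall i, 0 <= l i) -> 0 < \sum_(i < n) l i ->
  C ((\sum_(i < n) l i * (v i).1) / \sum_(i < n) l i,
     (\sum_(i < n) l i * (v i).2) / \sum_(i < n) l i).
Proof.
move=> cC; elim=> [|n IH] v l Cv l0; first by rewrite big_ord0 ltxx.
rewrite !big_ord_recl.
set S := \sum_(i < n) l _; set S1 := \sum_(i < n) _ * _.1.
set S2 := \sum_(i < n) _ * _.2 => S_gt0.
have S0 : 0 <= S by apply: sumr_ge0.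
have [Sz|SN0] := eqVneq S 0.
  have z i : l (lift ord0 i) = 0 by exact: (psumr_eq0P _ Sz).
  rewrite Sz addr0 in S_gt0 *.
  have -> : S1 = 0 by apply: big1 => i _; rewrite z mul0r.
  have -> : S2 = 0 by apply: big1 => i _; rewrite z mul0r.
  have n0 : l ord0 != 0 by rewrite gt_eqF.
  by rewrite !addr0 !(mulrC (l _)) !mulfK// -surjective_pairing.
have Sp : 0 < S by rewrite lt_neqAle eq_sym SN0.
have CS : C (S1 / S, S2 / S).
  by apply: (IH (fun i => v (lift ord0 i)) (fun i => l (lift ord0 i))).
have := cC _ _ (S / (l ord0 + S)) (Cv ord0) CS.
have D0 : l ord0 + S != 0 by rewrite gt_eqF.
have -> : lin (S / (l ord0 + S)) (v ord0) (S1 / S, S2 / S) =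
  ((l ord0 * (v ord0).1 + S1) / (l ord0 + S), (l ord0 * (v ord0).2 + S2) / (l ord0 + S)).
  by apply: pt_eq => /=; field; rewrite SN0 D0.
apply; first by rewrite divr_ge0// ltW.
by rewrite ler_pdivrMr// mul1r lerDr.
Qed.

Lemma cvx_conv_hull n (v : 'I_n -> pt) : cvx (conv_hull v).
Proof.
move=> x y t [l [l0 [l1 ->]]] [m [m0 [m1 ->]]] t0 t1.
exists (fun i => (1 - t) * l i + t * m i); split.
  by move=> i; rewrite addr_ge0// mulr_ge0// subr_ge0.
split.
  by rewrite big_split /= -!mulr_sumr l1 m1; ring.
apply: pt_eq => /=; rewrite !mulr_sumr -big_split /=; apply: eq_bigr => i _; ring.
Qed.

Lemma conv_hullE n (v : 'I_n -> pt) : conv_hull v = hull (map v (enum 'I_n)).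
Proof.
apply/seteqP; split.
  move=> x [l [l0 [l1 ->]]] C cC sC.
  have := @cvx_sum C cC n v l; rewrite l1 !divr1; apply => // i.
  by apply: sC; apply: map_f; rewrite mem_enum.
apply: hull_min; first exact: cvx_conv_hull.
move=> p /mapP[i _ ->]; exists (fun j => (j == i)%:R); split => //.
split.
  by rewrite (bigD1 i)//= eqxx big1 ?addr0// => j /negPf ->.
have e (w : pt -> R) : w (v i) = \sum_(j < n) (j == i)%:R * w (v j).
  by rewrite (bigD1 i)//= eqxx mul1r big1 ?addr0// => j /negPf ->; rewrite mul0r.
by apply: pt_eq; [exact: (e fst) | exact: (e snd)].
Qed.

Definition inn (s : seq pt) := in_interior (0, 0) (hull s).

Lemma inn_polygon s : inn s -> polygon_o (hull s).
Proof.
move=> i; split => //; exists (size s), (fun i => nth (0, 0) s i).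
rewrite conv_hullE; congr hull.
apply: (@eq_from_nth _ (0, 0)); first by rewrite size_map size_enum_ord.
by move=> j js; rewrite (nth_map (Ordinal js)) ?size_enum_ord// nth_enum_ord.
Qed.

Lemma polygonP P : polygon_o P -> exists2 s, P = hull s & inn s.
Proof.
move=> [[n [v ->]] i]; exists (map v (enum 'I_n)); first exact: conv_hullE.
by rewrite /inn -conv_hullE.
Qed.

Lemma in_interior_sub C D x : C `<=` D -> in_interior x C -> in_interior x D.
Proof. by move=> CD [e [e0 h]]; exists e; split => // y /h /CD. Qed.

Lemma inn_in s : inn s -> hull s (0, 0).
Proof.
move=> [e [e0 h]]; apply: h; rewrite /Defs.edist /=.
by rewrite subrr expr0n addr0 sqrtr0.
Qed.

Lemma inn_neq0 s : inn s -> s != [::].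
Proof.
move=> /inn_in; case: s => // /(_ set0); case => //.
Qed.

Lemma edist0_lt y e : Defs.edist (0, 0) y < e -> `|y.1| < e /\ `|y.2| < e.
Proof.
rewrite /Defs.edist /= !sub0r !sqrrN => h.
by split; apply: le_lt_trans h; rewrite -sqrtr_sqr ler_wsqrtr// ?lerDl ?lerDr sqr_ge0.
Qed.

Lemma det2_basis x u v : det2 u v != 0 ->
  x = (det2 x v / det2 u v * u.1 + det2 u x / det2 u v * v.1,
       det2 x v / det2 u v * u.2 + det2 u x / det2 u v * v.2).
Proof. by rewrite /det2 => d0; apply: pt_eq => /=; field. Qed.

Lemma cvx_axes_in_interior C u v (a b c d : R) : cvx C -> det2 u v != 0 ->
  0 < a -> 0 < b -> 0 < c -> 0 < d ->
  C (a * u.1, a * u.2) -> C (- b * u.1, - b * u.2) ->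
  C (c * v.1, c * v.2) -> C (- d * v.1, - d * v.2) -> in_interior (0, 0) C.
Proof.
move=> cC D0 a0 b0 c0 d0 Ca Cb Cc Cd.
have seg w (r r' : R) : 0 < r -> 0 < r' -> C (r * w.1, r * w.2) ->
    C (- r' * w.1, - r' * w.2) ->
    forall t, - r' <= t -> t <= r -> C (t * w.1, t * w.2).
  move=> r0 r'0 C1 C2 t t1 t2.
  have rr : 0 < r + r' by lra.
  have -> : (t * w.1, t * w.2) = lin ((r - t) / (r + r')) (r * w.1, r * w.2) (- r' * w.1, - r' * w.2).
    by apply: pt_eq => /=; field; lra.
  apply: cC => //; first by rewrite divr_ge0//; lra.
  by rewrite ler_pdivrMr//; lra.
pose m := Num.min (Num.min a b) (Num.min c d).
have m0 : 0 < m by rewrite /m !lt_min a0 b0 c0 d0.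
have [ma mb mc md] : [/\ m <= a, m <= b, m <= c & m <= d].
  by rewrite /m !ge_min !lexx ?orbT.
pose N := `|u.1| + `|u.2| + `|v.1| + `|v.2| + 1.
have N0 : 0 < N by rewrite /N ltr_wpDl// !addr_ge0.
have D'0 : 0 < `|det2 u v| by rewrite normr_gt0.
(* With this radius the Cramer coordinates of a point in the basis [u], [v] are at most m / 2 in
   absolute value. Their doubles stay on the two axis segments inside [C], and the point is the
   midpoint of the two axis points so obtained. *)
exists (m * `|det2 u v| / (N * 2)); split.
  by rewrite divr_gt0// mulr_gt0.
move=> y /edist0_lt[y1 y2].
have bnd (s t : R) : `|s| <= N -> `|t| <= N -> `|s| + `|t| <= N ->
    `|y.1 * s - y.2 * t| / `|det2 u v| <= m / 2.
  move=> s0 t0 st; rewrite ler_pdivrMr//.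
  apply: (le_trans (ler_normB _ _)); rewrite !normrM.
  set e := m * _ / _ in y1 y2.
  have eE : m / 2 * `|det2 u v| = e * N by rewrite /e; field; rewrite gt_eqF.
  have e0 : 0 <= e by rewrite /e divr_ge0// mulr_ge0// ltW.
  rewrite eE; apply: (@le_trans _ _ (e * `|s| + e * `|t|)).
    by apply: lerD; apply: ler_wpM2r => //; exact: ltW.
  by rewrite -mulrDr ler_wpM2l.
have B1 : `|det2 y v / det2 u v| <= m / 2.
  rewrite normrM normfV; have -> : det2 y v = y.1 * v.2 - y.2 * v.1 by [].
  have := (normr_ge0 u.1, normr_ge0 u.2, normr_ge0 v.1, normr_ge0 v.2).
  by move=> h; apply: bnd; move: h => [[[n1 n2] n3] n4]; rewrite /N; clear -n1 n2 n3 n4; lra.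
have B2 : `|det2 u y / det2 u v| <= m / 2.
  rewrite normrM normfV; have -> : det2 u y = - (y.1 * u.2 - y.2 * u.1) by rewrite /det2; ring.
  have := (normr_ge0 u.1, normr_ge0 u.2, normr_ge0 v.1, normr_ge0 v.2).
  by move=> h; rewrite normrN; apply: bnd; move: h => [[[n1 n2] n3] n4]; rewrite /N; clear -n1 n2 n3 n4; lra.
move: B1 B2; rewrite !ler_norml => /andP[p1 p2] /andP[q1 q2].
rewrite [y](@det2_basis y u v D0).
set al := det2 y v / _ in p1 p2 *; set be := det2 u y / _ in q1 q2 *.
have C1 : C (2 * al * u.1, 2 * al * u.2) by apply: (seg u a b) => //; clear -p1 p2 ma mb; lra.
have C2 : C (2 * be * v.1, 2 * be * v.2) by apply: (seg v c d) => //; clear -q1 q2 mc md; lra.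
have -> : (al * u.1 + be * v.1, al * u.2 + be * v.2) =
   lin (1 / 2) (2 * al * u.1, 2 * al * u.2) (2 * be * v.1, 2 * be * v.2).
  by apply: pt_eq => /=; field.
by apply: cC => //; clear; lra.
Qed.

End Convexity.

Ltac in_list := solve [repeat first [exact: mem_head | assumption | apply: mem_tail |
  solve [apply: mem_catl; in_list] | apply: mem_catr]].
Ltac in_hull := apply: hull_in; in_list.

(** * Cutting polygons *)

Section Valuation.
Variable R : realType.
Notation pt := (R * R)%type.
Implicit Types (p q u v x y : pt) (s A B : seq pt) (C D : set pt) (z : set pt -> pt).

(** Only the intersection must be known to surround the origin, since the two pieces and the union
    contain it. *)
Lemma val_hull z s1 s2 s3 s4 : valuation_on_Po z -> inn s3 ->
  hull s1 `|` hull s2 = hull s4 -> hull s1 `&` hull s2 = hull s3 ->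
  vadd (z (hull s4)) (z (hull s3)) = vadd (z (hull s1)) (z (hull s2)).
Proof.
move=> val i3 e4 e3.
have i1 : inn s1 by apply: in_interior_sub i3; rewrite -e3; exact: subIsetl.
have i2 : inn s2 by apply: in_interior_sub i3; rewrite -e3; exact: subIsetr.
have i4 : inn s4 by apply: in_interior_sub i1; rewrite -e4; exact: subsetUl.
have := val _ _ (inn_polygon i1) (inn_polygon i2).
by rewrite e4 e3; apply; exact: inn_polygon.
Qed.

Lemma hull_lin s p q t : hull s p -> hull s q -> 0 <= t -> t <= 1 ->
  hull s (lin t p q).
Proof. exact: hull_cvx. Qed.

Lemma star_union u v s (t : R) : s != [::] -> 0 <= t -> t <= 1 ->
  hull (lin t u v :: u :: s) `|` hull (lin t u v :: v :: s) = hull (u :: v :: s).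
Proof.
move=> s0 t0 t1; apply/seteqP; split.
  move=> x [] ; apply: hull_sub => p; rewrite !inE => /or3P[/eqP->|/eqP->|ps].
  - by apply: hull_lin => //; in_hull.
  - by in_hull.
  - by in_hull.
  - by apply: hull_lin => //; in_hull.
  - by in_hull.
  - by in_hull.
move=> x /hull_cons[]// a [y [a0 a1 /hull_cons[]// b [y' [b0 b1 hy' ->]] ->]].
have W : 0 <= (1 - a) by lra.
have W' : 0 <= a * (1 - b) by rewrite mulr_ge0//; lra.
have W'' : 0 <= a * b by rewrite mulr_ge0.
(* The point has weight 1 - a on [u] and a (1 - b) on [v]. Comparing their ratio with 1 - t : t
   tells which of the two is used up first when they are merged into [lin t u v]; the other one
   keeps the surplus. *)
have [le|lt] := lerP ((1 - a) * t) (a * (1 - b) * (1 - t)).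
  right; have [t1'|t1N] := eqVneq t 1.
    have W0 : 1 - a = 0.
      by apply/eqP; rewrite eq_le W andbT; move: le; rewrite t1'; lra.
    have -> : a = 1 by lra.
    rewrite lin1; apply: hull_lin => //; first by in_hull.
    by apply: hull_subset hy' => r rs; rewrite !inE rs !orbT.
  have t1p : 0 < 1 - t by rewrite subr_gt0 lt_neqAle t1N.
  set c1 := (1 - a) / (1 - t); set c2 := a * (1 - b) - (1 - a) * t / (1 - t).
  have c10 : 0 <= c1 by rewrite divr_ge0// ltW.
  have c20 : 0 <= c2 by rewrite subr_ge0 ler_pdivrMr.
  have c12 : c1 + c2 + a * b = 1 by rewrite /c1 /c2; field; lra.
  have -> : lin a u (lin b v y') = (c1 * (lin t u v).1 + c2 * v.1 + (a * b) * y'.1,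
     c1 * (lin t u v).2 + c2 * v.2 + (a * b) * y'.2).
    by apply: pt_eq => /=; rewrite /c1 /c2; field; lra.
  apply: cvx3 => //; first exact: hull_cvx.
  - by in_hull.
  - by in_hull.
  - by apply: hull_subset hy' => r rs; rewrite !inE rs !orbT.
left.
have tp : 0 < t.
  rewrite lt_neqAle t0 andbT; apply/eqP => tz; rewrite -tz in lt; move: lt; lra.
set c1 := a * (1 - b) / t; set c2 := (1 - a) - a * (1 - b) * (1 - t) / t.
have c10 : 0 <= c1 by rewrite divr_ge0.
have c20 : 0 <= c2 by rewrite subr_ge0 ler_pdivrMr// ltW.
have c12 : c1 + c2 + a * b = 1 by rewrite /c1 /c2; field; lra.
have -> : lin a u (lin b v y') = (c1 * (lin t u v).1 + c2 * u.1 + (a * b) * y'.1,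
   c1 * (lin t u v).2 + c2 * u.2 + (a * b) * y'.2).
  by apply: pt_eq => /=; rewrite /c1 /c2; field; lra.
apply: cvx3 => //; first exact: hull_cvx.
- by in_hull.
- by in_hull.
- by apply: hull_subset hy' => r rs; rewrite !inE rs !orbT.
Qed.

(** The point has one representation through [u] and one through [v]. Averaging them with the
    weights [e] and 1 - e makes [u] and [v] occur in the ratio 1 - t : t, so that they merge into
    [lin t u v]. *)
Lemma star_inter0 u v s (t : R) x : s != [::] -> 0 <= t -> t <= 1 ->
  hull (u :: s) x -> hull (v :: s) x -> hull (lin t u v :: s) x.
Proof.
move=> s0 t0 t1 /hull_cons[]// a [y [a0 a1 hy xy]] /hull_cons[]// b [y' [b0 b1 hy' xy']].
have sub : hull s `<=` hull (lin t u v :: s).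
  by apply: hull_subset => r rs; rewrite inE rs orbT.
set m := 1 - a; set n := 1 - b.
have m0 : 0 <= m by rewrite /m; lra.
have n0 : 0 <= n by rewrite /n; lra.
have d0 : 0 <= (1 - t) * n + t * m by nra.
have [mz|mN] := eqVneq m 0.
  have a1' : a = 1 by move: mz; rewrite /m; lra.
  by rewrite xy a1' lin1; exact: sub.
have [nz|nN] := eqVneq n 0.
  have b1' : b = 1 by move: nz; rewrite /n; lra.
  by rewrite xy' b1' lin1; exact: sub.
have mp : 0 < m by rewrite lt_neqAle eq_sym mN.
have np : 0 < n by rewrite lt_neqAle eq_sym nN.
have d : 0 < (1 - t) * n + t * m by nra.
set c1 := m * n / ((1 - t) * n + t * m).
set c2 := (1 - t) * n * a / ((1 - t) * n + t * m).
set c3 := t * m * b / ((1 - t) * n + t * m).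
have c10 : 0 <= c1 by rewrite divr_ge0// mulr_ge0.
have c20 : 0 <= c2 by rewrite divr_ge0// !mulr_ge0//; lra.
have c30 : 0 <= c3 by rewrite divr_ge0// !mulr_ge0//.
have c123 : c1 + c2 + c3 = 1.
  rewrite /c1 /c2 /c3; move: d; rewrite /m /n => d; field; lra.
set e := (1 - t) * n / ((1 - t) * n + t * m).
have ee : 1 - e = t * m / ((1 - t) * n + t * m) by rewrite /e; field; lra.
have -> : x = (c1 * (lin t u v).1 + c2 * y.1 + c3 * y'.1, c1 * (lin t u v).2 + c2 * y.2 + c3 * y'.2).
  have X1 : x.1 = (1 - e) * x.1 + e * x.1 by ring.
  have X2 : x.2 = (1 - e) * x.2 + e * x.2 by ring.
  apply: pt_eq => /=.
    rewrite X1 {1}xy' xy ee /e /= -/m -/n /c1 /c2 /c3.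
    by move: d; rewrite /m /n => d; field; lra.
  rewrite X2 {1}xy' xy ee /e /= -/m -/n /c1 /c2 /c3.
  by move: d; rewrite /m /n => d; field; lra.
apply: cvx3 => //; first exact: hull_cvx.
- by apply: hull_in; rewrite mem_head.
- exact: sub.
- exact: sub.
Qed.

Lemma star_inter u v s (t : R) : 0 <= t -> t <= 1 ->
  hull (lin t u v :: u :: s) `&` hull (lin t u v :: v :: s) = hull (lin t u v :: s).
Proof.
move=> t0 t1; apply/seteqP; split; last first.
  move=> x hx; split; apply: hull_subset hx => r; rewrite !inE => /orP[] ->;
    by rewrite ?orbT.
move=> x [h1 h2].
have := @star_inter0 u v (lin t u v :: s) t x isT t0 t1.
have e w : hull (w :: lin t u v :: s) = hull (lin t u v :: w :: s).
  by apply: eq_hull => r; rewrite !inE orbCA.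
rewrite !e => /(_ h1 h2); apply: hull_subset => r; rewrite !inE => /or3P[] ->;
  by rewrite ?orbT.
Qed.

Lemma star z u v s (t : R) : valuation_on_Po z -> s != [::] -> 0 <= t -> t <= 1 ->
  inn (lin t u v :: s) ->
  vadd (z (hull (u :: v :: s))) (z (hull (lin t u v :: s))) =
  vadd (z (hull (lin t u v :: u :: s))) (z (hull (lin t u v :: v :: s))).
Proof.
move=> val s0 t0 t1 i; apply: val_hull => //; first exact: star_union.
exact: star_inter.
Qed.

(* The segment from [b] to [a] crosses the line of [x] between [- k x] and [x]. *)
Definition compat x (k : R) (a b : pt) :=
  - (det2 x a - det2 x b) <= det2 a b /\ det2 a b <= k * (det2 x a - det2 x b).

Lemma cvx_compatl x k b : cvx [set a | compat x k a b].
Proof.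
move=> p q t [p1 p2] [q1 q2] t0 t1; rewrite /mkset /compat.
have t1' : 0 <= 1 - t by lra.
have -> : det2 (lin t p q) b = (1 - t) * det2 p b + t * det2 q b by rewrite /det2 /=; ring.
have -> : det2 x (lin t p q) = (1 - t) * det2 x p + t * det2 x q by rewrite /det2 /=; ring.
have := (ler_wpM2l t1' p1, ler_wpM2l t1' p2, ler_wpM2l t0 q1, ler_wpM2l t0 q2).
by move=> [[[h1 h2] h3] h4]; split; lra.
Qed.

Lemma cvx_compatr x k a : cvx [set b | compat x k a b].
Proof.
move=> p q t [p1 p2] [q1 q2] t0 t1; rewrite /mkset /compat.
have t1' : 0 <= 1 - t by lra.
have -> : det2 a (lin t p q) = (1 - t) * det2 a p + t * det2 a q by rewrite /det2 /=; ring.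
have -> : det2 x (lin t p q) = (1 - t) * det2 x p + t * det2 x q by rewrite /det2 /=; ring.
have := (ler_wpM2l t1' p1, ler_wpM2l t1' p2, ler_wpM2l t0 q1, ler_wpM2l t0 q2).
by move=> [[[h1 h2] h3] h4]; split; lra.
Qed.

Lemma det2Zl (k : R) x y : det2 (vscale k x) y = k * det2 x y.
Proof. by rewrite /det2 /=; ring. Qed.

Lemma det2Zr (k : R) x y : det2 x (vscale k y) = k * det2 x y.
Proof. by rewrite /det2 /=; ring. Qed.

Lemma det2xx x : det2 x x = 0.
Proof. by rewrite /det2; ring. Qed.

Lemma det2C x y : det2 x y = - det2 y x.
Proof. by rewrite /det2; ring. Qed.

Lemma det2_linr t x y w : det2 w (lin t x y) = (1 - t) * det2 w x + t * det2 w y.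
Proof. by rewrite /det2 /=; ring. Qed.

Lemma cvx_det_ge0 x : cvx [set a | 0 <= det2 x a].
Proof.
move=> p q t; rewrite /mkset => p0 q0 t0 t1; rewrite det2_linr addr_ge0// mulr_ge0//; lra.
Qed.

Lemma cvx_det_le0 x : cvx [set a | det2 x a <= 0].
Proof.
move=> p q t; rewrite /mkset => p0 q0 t0 t1; rewrite det2_linr; nra.
Qed.

Section Diagonal.
Variables (x : pt) (k : R) (A B : seq pt).
Hypotheses (k_gt0 : 0 < k) (A0 : A != [::]) (B0 : B != [::]).
Hypotheses (hA : forall a, a \in A -> 0 < det2 x a).
Hypotheses (hB : forall b, b \in B -> det2 x b < 0).
Hypotheses (hAB : forall a b, a \in A -> b \in B -> compat x k a b).
Let x' := vscale (- k) x.
Let Up := hull (x :: x' :: A).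
Let Lo := hull (x :: x' :: B).

Lemma Up_ge0 u : Up u -> 0 <= det2 x u.
Proof.
apply: (hull_min (@cvx_det_ge0 x)) => p; rewrite !inE => /or3P[/eqP->|/eqP->|/hA/ltW//].
  by rewrite /mkset det2xx.
by rewrite /mkset det2Zr det2xx mulr0.
Qed.

Lemma Lo_le0 u : Lo u -> det2 x u <= 0.
Proof.
apply: (hull_min (@cvx_det_le0 x)) => p; rewrite !inE => /or3P[/eqP->|/eqP->|/hB/ltW//].
  by rewrite /mkset det2xx.
by rewrite /mkset det2Zr det2xx mulr0.
Qed.

(** Compatibility is a pair of inequalities affine in each argument, so it passes from the
    generators to both hulls, one argument at a time. *)
Lemma Up_Lo_compat u l : Up u -> Lo l -> compat x k u l.
Proof.
move=> hu hl; move: u hu; apply: hull_min; first exact: cvx_compatl.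
move=> a ha; move: l hl; apply: (hull_min (C := [set b | compat x k a b])).
  exact: cvx_compatr.
move=> b hb; rewrite /mkset; have := k_gt0.
move: ha hb; rewrite !inE.
move=> /or3P[/eqP->|/eqP->|ha] /or3P[/eqP->|/eqP->|hb] => kp; rewrite /compat.
- by rewrite !det2xx; split; lra.
- by rewrite !det2Zr !det2xx; split; lra.
- by have hb' := hB hb; rewrite det2xx; split; nra.
- by rewrite !det2Zr !det2Zl !det2xx; split; lra.
- by rewrite !det2Zr !det2Zl ?det2Zr !det2xx; split; lra.
- by have hb' := hB hb; rewrite !det2Zr !det2Zl det2xx; split; nra.
- by have ha' := hA ha; rewrite det2xx (det2C a); split; nra.
- by have ha' := hA ha; rewrite !det2Zr det2xx (det2C a); split; nra.
- exact: hAB.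
Qed.

Lemma diag_pt (m : R) : - k <= m -> m <= 1 -> hull [:: x; x'] (vscale m x).
Proof.
move=> m1 m2; have -> : vscale m x = lin ((1 - m) / (1 + k)) x x'.
  by have k1 := k_gt0; apply: pt_eq => /=; field; lra.
have k1 := k_gt0.
apply: hull_cvx.
- by in_hull.
- by in_hull.
- by rewrite divr_ge0//; lra.
- by rewrite ler_pdivrMr//; lra.
Qed.

Lemma cross_pt u l : Up u -> Lo l -> 0 < det2 x u - det2 x l ->
  hull [:: x; x'] (lin (det2 x u / (det2 x u - det2 x l)) u l).
Proof.
move=> hu hl w0; have [c1 c2] := Up_Lo_compat hu hl.
have -> : lin (det2 x u / (det2 x u - det2 x l)) u l =
    vscale (- det2 u l / (det2 x u - det2 x l)) x.
  move: w0; rewrite /det2 => w0; apply: pt_eq => /=; field; lra.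
apply: diag_pt; first by rewrite ler_pdivlMr//; lra.
by rewrite ler_pdivrMr//; lra.
Qed.

Lemma x_colinear u w : det2 x u = 0 -> det2 x w != 0 ->
  u = vscale (det2 u w / det2 x w) x.
Proof.
move=> xu0 xw; have := xw; rewrite {1}/det2 => xw'.
have e1 : det2 u w * x.1 = det2 x w * u.1.
  by rewrite -[LHS]addr0 -(mulr0 w.1) -xu0 /det2; ring.
have e2 : det2 u w * x.2 = det2 x w * u.2.
  by rewrite -[LHS]addr0 -(mulr0 w.2) -xu0 /det2; ring.
by apply: pt_eq => /=; rewrite mulrAC ?e1 ?e2 mulrAC mulfV// mul1r.
Qed.

(** For a point on the line of [x], compatibility with any single point of [B] says exactly that it
    lies between [x'] and [x]. *)
Lemma Up_axis u : Up u -> det2 x u = 0 -> hull [:: x; x'] u.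
Proof.
move=> hu xu0; have [b hb] : exists b, b \in B.
  by case: B B0 => // b B' _; exists b; rewrite mem_head.
have xb := hB hb; have xb0 : det2 x b != 0 by rewrite lt_eqF.
have lb : Lo b by in_hull.
have [] := Up_Lo_compat hu lb; rewrite xu0 => c1 c2.
rewrite (x_colinear xu0 xb0); apply: diag_pt.
  by rewrite ler_ndivlMr//; lra.
by rewrite ler_ndivrMr//; lra.
Qed.

Lemma Lo_axis u : Lo u -> det2 x u = 0 -> hull [:: x; x'] u.
Proof.
move=> hu xu0; have [b hb] : exists b, b \in A.
  by case: A A0 => // b B' _; exists b; rewrite mem_head.
have xb := hA hb; have xb0 : det2 x b != 0 by rewrite gt_eqF.
have lb : Up b by in_hull.
have [] := Up_Lo_compat lb hu; rewrite xu0 (det2C b) => c1 c2.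
rewrite (x_colinear xu0 xb0); apply: diag_pt.
  by rewrite ler_pdivlMr//; lra.
by rewrite ler_pdivrMr//; lra.
Qed.

Lemma diag_Up : hull [:: x; x'] `<=` Up.
Proof. by apply: hull_subset => r; rewrite !inE => /orP[] ->; rewrite ?orbT. Qed.

Lemma diag_Lo : hull [:: x; x'] `<=` Lo.
Proof. by apply: hull_subset => r; rewrite !inE => /orP[] ->; rewrite ?orbT. Qed.

Lemma Up_Lo_lin u l t : Up u -> Lo l -> 0 <= t -> t <= 1 -> (Up `|` Lo) (lin t u l).
Proof.
move=> hu hl t0 t1; have du := Up_ge0 hu; have dl := Lo_le0 hl.
have [w0|wN] := eqVneq (det2 x u - det2 x l) 0.
  left; apply: diag_Up; apply: hull_cvx => //.
    by apply: Up_axis => //; lra.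
  by apply: Lo_axis => //; lra.
have w : 0 < det2 x u - det2 x l by rewrite lt_neqAle eq_sym wN; lra.
have := cross_pt hu hl w; set r := det2 x u / _ => hr.
have r0 : 0 <= r by rewrite divr_ge0// ltW.
have r1 : r <= 1 by rewrite ler_pdivrMr// mul1r; lra.
have [tr|rt] := leP t r.
  left; have [rz|rN] := eqVneq r 0.
    have -> : t = 0 by apply/eqP; rewrite eq_le t0 andbT -rz.
    by rewrite lin0.
  have rp : 0 < r by rewrite lt_neqAle eq_sym rN.
  have -> : lin t u l = lin (t / r) u (lin r u l).
    by apply: pt_eq => /=; field.
  apply: hull_cvx => //; first exact: diag_Up.
    by rewrite divr_ge0.
  by rewrite ler_pdivrMr// mul1r.
right; have rp : 0 < 1 - r by lra.
have -> : lin t u l = lin ((t - r) / (1 - r)) (lin r u l) l.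
  by apply: pt_eq => /=; field; lra.
apply: hull_cvx => //; first exact: diag_Lo.
  by rewrite divr_ge0// ltW// subr_gt0.
by rewrite ler_pdivrMr// mul1r; lra.
Qed.

Lemma linC t u v : lin t u v = lin (1 - t) v u.
Proof. by apply: pt_eq => /=; ring. Qed.

Lemma hull_diagonal : hull (x :: x' :: A ++ B) = Up `|` Lo.
Proof.
apply/seteqP; split.
  apply: hull_min.
    move=> p q t [hp|hp] [hq|hq] t0 t1.
    - by left; apply: hull_cvx.
    - exact: Up_Lo_lin.
    - by rewrite linC; apply: Up_Lo_lin => //; lra.
    - by right; apply: hull_cvx.
  move=> p; rewrite !inE mem_cat => /or4P[/eqP->|/eqP->|hp|hp].
  - by left; in_hull.
  - by left; in_hull.
  - by left; in_hull.
  - by right; in_hull.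
by move=> p []; apply: hull_subset => r; rewrite !inE mem_cat => /or3P[] ->;
  rewrite ?orbT.
Qed.

End Diagonal.

(** By [hull_diagonal] each of the four hulls is an upper part glued to a lower part along the
    diagonal. The two hulls on the right therefore have the larger parts as union and the smaller
    parts as intersection. *)
Lemma mix_sub z x (k : R) A B A' B' : valuation_on_Po z -> 0 < k ->
  A' != [::] -> B' != [::] -> {subset A' <= A} -> {subset B' <= B} ->
  (forall a, a \in A -> 0 < det2 x a) -> (forall b, b \in B -> det2 x b < 0) ->
  (forall a b, a \in A -> b \in B -> compat x k a b) ->
  inn (x :: vscale (- k) x :: A' ++ B') ->
  vadd (z (hull (x :: vscale (- k) x :: A ++ B))) (z (hull (x :: vscale (- k) x :: A' ++ B'))) =
  vadd (z (hull (x :: vscale (- k) x :: A ++ B'))) (z (hull (x :: vscale (- k) x :: A' ++ B))).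
Proof.
move=> val k0 A'0 B'0 AA BB hA hB hAB i.
have A0 : A != [::].
  by case: A' A'0 AA {i} => // a A1 _ /(_ a); rewrite mem_head => /(_ isT); case: A {hA hAB}.
have B0 : B != [::].
  by case: B' B'0 BB {i} => // a A1 _ /(_ a); rewrite mem_head => /(_ isT); case: B {hB hAB}.
have hA' a : a \in A' -> 0 < det2 x a by move/AA/hA.
have hB' a : a \in B' -> det2 x a < 0 by move/BB/hB.
have hAB' a b : a \in A -> b \in B' -> compat x k a b by move=> ? /BB; exact: hAB.
have hA'B a b : a \in A' -> b \in B -> compat x k a b by move/AA; exact: hAB.
have hA'B' a b : a \in A' -> b \in B' -> compat x k a b by move=> /AA ? /BB; exact: hAB.
have sA : hull (x :: vscale (- k) x :: A') `<=` hull (x :: vscale (- k) x :: A).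
  by apply: hull_subset => r; rewrite !inE => /or3P[->|->|/AA ->]; rewrite ?orbT.
have sB : hull (x :: vscale (- k) x :: B') `<=` hull (x :: vscale (- k) x :: B).
  by apply: hull_subset => r; rewrite !inE => /or3P[->|->|/BB ->]; rewrite ?orbT.
apply: val_hull => //.
  rewrite !hull_diagonal//; apply/seteqP; split.
    by move=> p [[]|[]] hp; [left|right; exact: sB|left; exact: sA|right].
  by move=> p [] hp; [left; left|right; right].
rewrite !hull_diagonal//; apply/seteqP; split; last first.
  by move=> p [] hp; split; [left; exact: sA|left|right|right; exact: sB].
(* A point both above and below is on the line of [x], hence on the common diagonal. *)
move=> p [[h1|h1] [h2|h2]]; [by left| | by left|by right].
left; apply: (@diag_Up x k A'); apply: (@Up_axis x k A B) => //.
apply/eqP; rewrite eq_le; apply/andP; split; first exact: (@Lo_le0 x k B).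
exact: (@Up_ge0 x k A).
Qed.

(** [mix_sub] is applied to each of the four pairs inside the common enlargement A ++ A', B ++ B';
    in the alternating sum all enlarged terms cancel. *)
Lemma mix z x (k : R) A B A' B' : valuation_on_Po z -> 0 < k ->
  A != [::] -> B != [::] -> A' != [::] -> B' != [::] ->
  (forall a, a \in A ++ A' -> 0 < det2 x a) ->
  (forall b, b \in B ++ B' -> det2 x b < 0) ->
  (forall a b, a \in A ++ A' -> b \in B ++ B' -> compat x k a b) ->
  inn (x :: vscale (- k) x :: A ++ B) -> inn (x :: vscale (- k) x :: A ++ B') ->
  inn (x :: vscale (- k) x :: A' ++ B) -> inn (x :: vscale (- k) x :: A' ++ B') ->
  vadd (z (hull (x :: vscale (- k) x :: A ++ B))) (z (hull (x :: vscale (- k) x :: A' ++ B'))) =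
  vadd (z (hull (x :: vscale (- k) x :: A ++ B'))) (z (hull (x :: vscale (- k) x :: A' ++ B))).
Proof.
move=> val k0 A0 B0 A'0 B'0 hA hB hAB i1 i2 i3 i4.
have sAl : {subset A <= A ++ A'} by move=> r; rewrite mem_cat => ->.
have sAr : {subset A' <= A ++ A'} by move=> r; rewrite mem_cat => ->; rewrite orbT.
have sBl : {subset B <= B ++ B'} by move=> r; rewrite mem_cat => ->.
have sBr : {subset B' <= B ++ B'} by move=> r; rewrite mem_cat => ->; rewrite orbT.
have h1 := @mix_sub z x k (A ++ A') (B ++ B') A B val k0 A0 B0 sAl sBl hA hB hAB i1.
have h2 := @mix_sub z x k (A ++ A') (B ++ B') A' B' val k0 A'0 B'0 sAr sBr hA hB hAB i4.
have h3 := @mix_sub z x k (A ++ A') (B ++ B') A B' val k0 A0 B'0 sAl sBr hA hB hAB i2.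
have h4 := @mix_sub z x k (A ++ A') (B ++ B') A' B val k0 A'0 B0 sAr sBl hA hB hAB i3.
move: h1 h2 h3 h4 => [h1 h1'] [h2 h2'] [h3 h3'] [h4 h4'].
by apply: pt_eq; rewrite /vadd /=; move: h1 h1' h2 h2' h3 h3' h4 h4'; clear; lra.
Qed.

Lemma inn_diag x (k : R) a b : 0 < k -> 0 < det2 x a -> det2 x b < 0 ->
  inn [:: x; vscale (- k) x; a; b].
Proof.
move=> k0 xa xb.
have D0 : det2 x a != 0 by rewrite gt_eqF.
set S := [:: _; _; _; _].
have [hx hx' ha hb] : [/\ hull S x, hull S (vscale (- k) x), hull S a & hull S b].
  by split; in_hull.
have e1 : det2 x a * b.1 = det2 b a * x.1 + det2 x b * a.1 by rewrite /det2; ring.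
have e2 : det2 x a * b.2 = det2 b a * x.2 + det2 x b * a.2 by rewrite /det2; ring.
set g := det2 b a in e1 e2; set p := det2 x a in xa D0 e1 e2.
set q := det2 x b in xb e1 e2.
(* The ray opposite to [a] meets the segment from [b] to [x] or the one from [b] to the opposite end
   of the diagonal, according to the sign of [g]. *)
have [d d0 hd] : exists2 d, 0 < d & hull S (- d * a.1, - d * a.2).
  have [g0|g0] := lerP g 0.
    have w : 0 < p - g by lra.
    exists (- q / (p - g)); first by rewrite divr_gt0//; lra.
    have -> : (- (- q / (p - g)) * a.1, - (- q / (p - g)) * a.2) = lin (p / (p - g)) x b.
      have E (x1 b1 a1 : R) : p * b1 = g * x1 + q * a1 ->
          - (- q / (p - g)) * a1 = (1 - p / (p - g)) * x1 + p / (p - g) * b1.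
        move=> E; have -> : p / (p - g) * b1 = (g * x1 + q * a1) / (p - g) by rewrite -E; field; lra.
        by field; lra.
      by apply: pt_eq => /=; exact: E.
    apply: hull_cvx => //; first by rewrite divr_ge0//; lra.
    by rewrite ler_pdivrMr//; lra.
  have gk : 0 < g / k by rewrite divr_gt0.
  have w : 0 < p + g / k by lra.
  exists (- q / (p + g / k)); first by rewrite divr_gt0//; lra.
  have -> : (- (- q / (p + g / k)) * a.1, - (- q / (p + g / k)) * a.2) =
      lin (p / (p + g / k)) (vscale (- k) x) b.
    have w' : 0 < p * k + g by rewrite addr_gt0// mulr_gt0.
    have E (x1 b1 a1 : R) : p * b1 = g * x1 + q * a1 ->
        - (- q / (p + g / k)) * a1 = (1 - p / (p + g / k)) * (- k * x1) + p / (p + g / k) * b1.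
      move=> E; have -> : p / (p + g / k) * b1 = (g * x1 + q * a1) / (p + g / k).
        by rewrite -E; field; lra.
      by field; lra.
    by apply: pt_eq => /=; exact: E.
  apply: hull_cvx => //; first by rewrite divr_ge0//; lra.
  by rewrite ler_pdivrMr//; lra.
apply: (@cvx_axes_in_interior _ _ x a 1 k 1 d) => //; first exact: hull_cvx.
- by rewrite !mul1r -surjective_pairing.
- by rewrite !mul1r -surjective_pairing.
Qed.

End Valuation.

(** * Covariant valuations on quadrilaterals *)

Section Covariant.
Variable R : realType.
Notation pt := (R * R)%type.
Implicit Types (p q : pt) (s : seq pt) (z : set pt -> pt) (x a b h l : R).

Definition lmap (a b c d : R) (x : pt) : pt := (a * x.1 + b * x.2, c * x.1 + d * x.2).

Definition covariant z := forall (a b c d : R) P, a * d - b * c = 1 -> polygon_o P ->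
  z (lmap a b c d @` P) = lmap a b c d (z P).

(* The only trace of measurability that is used: it turns additive functions into linear ones. *)
Definition regular z := forall s (p q : pt), inn (p :: s) -> inn (q :: s) ->
  exists M : R, forall h, 0 < h -> h < 1 / 3 -> exists t, [/\ 0 <= t, t + h <= 1,
    `|(z (hull (lin t p q :: s))).1| <= M /\ `|(z (hull (lin t p q :: s))).2| <= M &
    `|(z (hull (lin (t + h) p q :: s))).1| <= M /\ `|(z (hull (lin (t + h) p q :: s))).2| <= M].

Lemma lmap_lin a b c d t p q :
  lmap a b c d (lin t p q) = lin t (lmap a b c d p) (lmap a b c d q).
Proof. by apply: pt_eq => /=; ring. Qed.

Lemma hull_lmap a b c d s : lmap a b c d @` hull s = hull (map (lmap a b c d) s).
Proof.
apply/seteqP; split.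
  move=> _ [x hx <-]; move: x hx.
  apply: (hull_min (C := [set x | hull (map (lmap a b c d) s) (lmap a b c d x)])).
    by move=> x y t hx hy t0 t1; rewrite /mkset lmap_lin; apply: hull_cvx.
  by move=> p ps; apply: hull_in; apply: map_f.
apply: hull_min.
  move=> _ _ t [x hx <-] [y hy <-] t0 t1; exists (lin t x y); last exact: lmap_lin.
  exact: hull_cvx.
by move=> _ /mapP[p ps ->]; exists p => //; exact: hull_in.
Qed.

Lemma covZ z a b c d s : covariant z -> a * d - b * c = 1 -> inn s ->
  z (hull (map (lmap a b c d) s)) = lmap a b c d (z (hull s)).
Proof. by move=> cov D i; rewrite -hull_lmap cov//; exact: inn_polygon. Qed.

Section Quad.
Variable z : set pt -> pt.
Hypotheses (val : valuation_on_Po z) (cov : covariant z) (reg : regular z).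

Definition quadval (x x' a h b l : R) : pt := z (hull [:: (x, 0); (- x', 0); (a, h); (b, - l)]).

Notation V := quadval.

Lemma V_inn x x' a h b l : 0 < x -> 0 < x' -> 0 < h -> 0 < l ->
  inn [:: (x, 0); (- x', 0); (a, h); (b, - l)].
Proof.
move=> x0 x'0 h0 l0.
have := @inn_diag _ (x, 0) (x' / x) (a, h) (b, - l).
have -> : vscale (- (x' / x)) (x, 0) = (- x', 0) by apply: pt_eq => /=; field; lra.
by apply; rewrite /det2 /= ?divr_gt0//; nra.
Qed.

Lemma V_shear x x' a h b l (s : R) : 0 < x -> 0 < x' -> 0 < h -> 0 < l ->
  V x x' (a + s * h) h (b - s * l) l = ((V x x' a h b l).1 + s * (V x x' a h b l).2, (V x x' a h b l).2).
Proof.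
move=> x0 x'0 h0 l0; have i := V_inn a b x0 x'0 h0 l0.
have D : (1 : R) * 1 - s * 0 = 1 by ring.
transitivity (lmap 1 s 0 1 (V x x' a h b l)); last by apply: pt_eq => /=; ring.
rewrite /V -(covZ cov D i) /= /lmap /=; congr (z (hull _)).
by congr [:: _; _; _; _]; apply: pt_eq => /=; ring.
Qed.

Lemma V_torus x x' a h b l t : 0 < x -> 0 < x' -> 0 < h -> 0 < l -> 0 < t ->
  V (t * x) (t * x') (t * a) (h / t) (t * b) (l / t) = (t * (V x x' a h b l).1, (V x x' a h b l).2 / t).
Proof.
move=> x0 x'0 h0 l0 t0; have i := V_inn a b x0 x'0 h0 l0.
have D : t * t^-1 - 0 * 0 = 1 by field; lra.
transitivity (lmap t 0 0 t^-1 (V x x' a h b l)); last by apply: pt_eq => /=; ring.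
rewrite /V -(covZ cov D i) /= /lmap /=; congr (z (hull _)).
by congr [:: _; _; _; _]; apply: pt_eq => /=; ring.
Qed.

Lemma V_opp x x' a h b l : 0 < x -> 0 < x' -> 0 < h -> 0 < l ->
  V x' x (- b) l (- a) h = (- (V x x' a h b l).1, - (V x x' a h b l).2).
Proof.
move=> x0 x'0 h0 l0; have i := V_inn a b x0 x'0 h0 l0.
have D : (-1 : R) * -1 - 0 * 0 = 1 by ring.
transitivity (lmap (-1) 0 0 (-1) (V x x' a h b l)); last by apply: pt_eq => /=; ring.
rewrite /V -(covZ cov D i) /= /lmap /=; congr z.
apply: eq_hull => r; rewrite !inE.
have e w w' : w = w' -> (r == w) = (r == w') by move->.
rewrite (e (-1 * x + 0 * 0, _) (- x, 0)); last by apply: pt_eq => /=; ring.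
rewrite (e (-1 * - x' + 0 * 0, _) (x', 0)); last by apply: pt_eq => /=; ring.
rewrite (e (-1 * a + 0 * h, _) (- a, - h)); last by apply: pt_eq => /=; ring.
rewrite (e (-1 * b + 0 * - l, _) (- b, l)); last by apply: pt_eq => /=; ring.
by case: (r == (- x, 0)); case: (r == (x', 0)); case: (r == (- a, - h)); case: (r == (- b, l)).
Qed.

(** When both diagonals lie on the axes the quarter turn exchanges them, which later expresses a
    first coordinate through a second one. *)
Lemma V_rot x x' h l : 0 < x -> 0 < x' -> 0 < h -> 0 < l ->
  V l h 0 x 0 x' = (- (V x x' 0 h 0 l).2, (V x x' 0 h 0 l).1).
Proof.
move=> x0 x'0 h0 l0; have i := V_inn 0 0 x0 x'0 h0 l0.
have D : (0 : R) * 0 - (-1) * 1 = 1 by ring.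
transitivity (lmap 0 (-1) 1 0 (V x x' 0 h 0 l)); last by apply: pt_eq => /=; ring.
rewrite /V -(covZ cov D i) /= /lmap /=; congr z.
apply: eq_hull => r; rewrite !inE.
have e w w' : w = w' -> (r == w) = (r == w') by move->.
rewrite (e (0 * x + -1 * 0, _) (0, x)); last by apply: pt_eq => /=; ring.
rewrite (e (0 * - x' + -1 * 0, _) (0, - x')); last by apply: pt_eq => /=; ring.
rewrite (e (0 * 0 + -1 * h, _) (- h, 0)); last by apply: pt_eq => /=; ring.
rewrite (e (0 * 0 + -1 * - l, _) (l, 0)); last by apply: pt_eq => /=; ring.
by case: (r == (0, x)); case: (r == (0, - x')); case: (r == (- h, 0)); case: (r == (l, 0)).
Qed.

(** [star] is applied to the segment from (x1, 0) to (- x1', 0), subdivided at (x, 0), with (- x',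
    0) among the other points. Dropping the redundant axis points leaves four quadrilaterals and
    separates the two ends of the diagonal. *)
Lemma V_sep_le x x1 x' x1' a h b l : 0 < x -> 0 < x' -> 0 < h -> 0 < l ->
  x <= x1 -> x' <= x1' ->
  vadd (V x x' a h b l) (V x1 x1' a h b l) = vadd (V x x1' a h b l) (V x1 x' a h b l).
Proof.
move=> x0 x'0 h0 l0 xx1 xx1'.
pose t := (x1 - x) / (x1 + x1').
have t0 : 0 <= t by rewrite divr_ge0//; lra.
have t1 : t <= 1 by rewrite ler_pdivrMr; lra.
have lE : lin t (x1, 0) (- x1', 0) = (x, 0) by apply: pt_eq => /=; rewrite /t; field; lra.
have seg (s : seq pt) (y y1 : R) : (y1, 0) \in s -> (- x1', 0) \in s -> 0 < y1 -> - x1' <= y -> y <= y1 ->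
    hull s (y, 0).
  move=> s1 s2 y10 yy1 yy2.
  have -> : (y, 0) = lin ((y1 - y) / (y1 + x1')) (y1, 0) (- x1', 0).
    by apply: pt_eq => /=; field; lra.
  apply: hull_cvx; [exact: hull_in|exact: hull_in| |].
    by rewrite divr_ge0//; lra.
  by rewrite ler_pdivrMr; lra.
have seg' (s : seq pt) (y y1 : R) : (x1, 0) \in s -> (- y1, 0) \in s -> 0 < y1 -> - y1 <= y -> y <= x1 ->
    hull s (y, 0).
  move=> s1 s2 y10 yy1 yy2.
  have -> : (y, 0) = lin ((x1 - y) / (y1 + x1)) (x1, 0) (- y1, 0).
    by apply: pt_eq => /=; field; lra.
  apply: hull_cvx; [exact: hull_in|exact: hull_in| |].
    by rewrite divr_ge0//; lra.
  by rewrite ler_pdivrMr; lra.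
have := @star _ z (x1, 0) (- x1', 0) [:: (- x', 0); (a, h); (b, - l)] t val isT t0 t1.
rewrite lE => /(_ (V_inn a b x0 x'0 h0 l0)).
have -> : hull [:: (x1, 0); (- x1', 0); (- x', 0); (a, h); (b, - l)] =
          hull [:: (x1, 0); (- x1', 0); (a, h); (b, - l)].
  apply: hull_eq => p; rewrite !inE.
    move=> /or4P[/eqP->|/eqP->|/eqP->|/orP[]/eqP->]; try by in_hull.
    by apply: (seg _ _ x1); [in_list|in_list|lra..].
  by case/or4P => /eqP->; in_hull.
have -> : hull [:: (x, 0); (x1, 0); (- x', 0); (a, h); (b, - l)] =
          hull [:: (x1, 0); (- x', 0); (a, h); (b, - l)].
  apply: hull_eq => p; rewrite !inE.
    move=> /or4P[/eqP->|/eqP->|/eqP->|/orP[]/eqP->]; try by in_hull.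
    by apply: (seg' _ _ x'); [in_list|in_list|lra..].
  by case/or4P => /eqP->; in_hull.
have -> : hull [:: (x, 0); (- x1', 0); (- x', 0); (a, h); (b, - l)] =
          hull [:: (x, 0); (- x1', 0); (a, h); (b, - l)].
  apply: hull_eq => p; rewrite !inE.
    move=> /or4P[/eqP->|/eqP->|/eqP->|/orP[]/eqP->]; try by in_hull.
    by apply: (seg _ _ x); [in_list|in_list|lra..].
  by case/or4P => /eqP->; in_hull.
rewrite -/(V x1 x1' a h b l) -/(V x x' a h b l) -/(V x1 x' a h b l) -/(V x x1' a h b l).
by move=> [e1 e2]; apply: pt_eq; rewrite /vadd /=; lra.
Qed.

Lemma V_sep x x1 x' x1' a h b l : 0 < x -> 0 < x' -> 0 < x1 -> 0 < x1' -> 0 < h -> 0 < l ->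
  vadd (V x x' a h b l) (V x1 x1' a h b l) = vadd (V x x1' a h b l) (V x1 x' a h b l).
Proof.
move=> x0 x'0 x10 x1'0 h0 l0.
have [l1|/ltW l1] := leP x x1; have [l2|/ltW l2] := leP x' x1'.
- exact: V_sep_le.
- have [e1 e2] := @V_sep_le x x1 x1' x' a h b l x0 x1'0 h0 l0 l1 l2.
  by apply: pt_eq; rewrite /vadd /=; lra.
- have [e1 e2] := @V_sep_le x1 x x' x1' a h b l x10 x'0 h0 l0 l1 l2.
  by apply: pt_eq; rewrite /vadd /=; lra.
- have [e1 e2] := @V_sep_le x1 x x1' x' a h b l x10 x1'0 h0 l0 l1 l2.
  by apply: pt_eq; rewrite /vadd /=; lra.
Qed.

(** The second diagonal meets the axis at abscissa (a l + b h) / (h + l); the condition places it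
    between - x' and x, cleared of the denominator. *)
Definition crosses (x x' a h b l : R) := - x' * (h + l) <= a * l + b * h /\ a * l + b * h <= x * (h + l).

Lemma crossesP (x x' a h b l : R) : 0 < x ->
  compat (x, 0) (x' / x) (a, h) (b, - l) <-> crosses x x' a h b l.
Proof.
move=> x0; rewrite /compat /crosses /det2 /=.
have -> : x' / x * (x * h - 0 * a - (x * - l - 0 * b)) = x' * (h + l) by field; lra.
by split=> -[h1 h2]; split; lra.
Qed.

Lemma V_mix x x' a h b l a1 h1 b1 l1 : 0 < x -> 0 < x' -> 0 < h -> 0 < l -> 0 < h1 -> 0 < l1 ->
  crosses x x' a h b l -> crosses x x' a h b1 l1 -> crosses x x' a1 h1 b l -> crosses x x' a1 h1 b1 l1 ->
  vadd (V x x' a h b l) (V x x' a1 h1 b1 l1) = vadd (V x x' a h b1 l1) (V x x' a1 h1 b l).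
Proof.
move=> x0 x'0 h0 l0 h10 l10 c1 c2 c3 c4.
have k0 : 0 < x' / x by rewrite divr_gt0.
have e : vscale (- (x' / x)) (x, 0) = (- x', 0) by apply: pt_eq => /=; field; lra.
have := @mix _ z (x, 0) (x' / x) [:: (a, h)] [:: (b, - l)] [:: (a1, h1)] [:: (b1, - l1)] val k0 isT isT isT isT.
rewrite e /=; apply; try exact: V_inn.
- by move=> p; rewrite !inE => /orP[] /eqP ->; rewrite /det2 /=; nra.
- by move=> p; rewrite !inE => /orP[] /eqP ->; rewrite /det2 /=; nra.
- by move=> p q; rewrite !inE => /orP[] /eqP -> /orP[] /eqP ->; exact/crossesP.
Qed.

End Quad.
End Covariant.

(** * Additive functions *)

Section Cauchy.
Variable R : realType.
Implicit Types (D F : R -> R).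

Lemma bounded_additive D (B : R) :
  (forall h k, 0 <= h -> 0 <= k -> h + k <= 1 -> D (h + k) = D h + D k) ->
  (forall h, 0 < h -> h < 1 / 3 -> `|D h| <= B) ->
  forall h, 0 <= h -> h <= 1 -> D h = h * D 1.
Proof.
move=> add bnd.
have D0 : D 0 = 0.
  by have := add 0 0; rewrite addr0 => /(_ (lexx _) (lexx _) ler01) e; lra.
pose g h := D h - h * D 1.
have gadd h k : 0 <= h -> 0 <= k -> h + k <= 1 -> g (h + k) = g h + g k.
  by move=> h0 k0 hk; rewrite /g add//; ring.
have g1 : g 1 = 0 by rewrite /g; ring.
have g0 : g 0 = 0 by rewrite /g D0; ring.
have B0 : 0 <= B.
  by apply: (le_trans (normr_ge0 (D (1 / 4)))); apply: bnd; lra.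
(* For h at most 1 the quarter h / 4 falls in the range below 1 / 3 where a bound is given. *)
have gb h : 0 <= h -> h <= 1 -> `|g h| <= 4 * B + `|D 1|.
  move=> h0 h1; have [->|hN] := eqVneq h 0.
    by rewrite g0 normr0; have := normr_ge0 (D 1); lra.
  have e : D h = 4 * D (h / 4).
    have e1 : D (h / 4 + h / 4) = D (h / 4) + D (h / 4) by apply: add; lra.
    have e2 : D ((h / 4 + h / 4) + (h / 4 + h / 4)) = D (h / 4 + h / 4) + D (h / 4 + h / 4).
      by apply: add; lra.
    have e3 : (h / 4 + h / 4) + (h / 4 + h / 4) = h by field.
    by move: e2; rewrite e3 e1 => ->; ring.
  have h4 : 0 < h / 4 by rewrite divr_gt0// lt_neqAle eq_sym hN.
  have h4' : h / 4 < 1 / 3 by lra.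
  have := bnd _ h4 h4'; rewrite /g => b4.
  apply: (le_trans (ler_normB _ _)); rewrite e !normrM (ger0_norm h0) ger0_norm//.
  have := normr_ge0 (D 1); nra.
(* [g] vanishes at 1 / 2, so a point beyond 1 / 2 may be moved below it, and there [g k] is half of
   [g (k + k)]. Hence every bound on [g] can be halved, again and again. *)
have half (C : R) : (forall h, 0 <= h -> h <= 1 -> `|g h| <= C) ->
    forall h, 0 <= h -> h <= 1 -> `|g h| <= C / 2.
  move=> gC h h0 h1; have g12 : g (1 / 2) = 0.
    have : g (1 / 2 + 1 / 2) = g (1 / 2) + g (1 / 2) by apply: gadd; lra.
    have -> : 1 / 2 + 1 / 2 = 1 :> R by field.
    by rewrite g1 => ?; lra.
  have small k : 0 <= k -> k <= 1 / 2 -> `|g k| <= C / 2.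
    move=> k0 k1; have e' : g (k + k) = g k + g k by apply: gadd; lra.
    have e : g k = g (k + k) / 2 by rewrite e'; field.
    rewrite e normrM (ger0_norm (x := 2^-1))//; have := gC (k + k); lra.
  have [hh|hh] := leP h (1 / 2); first exact: small.
  have -> : h = 1 / 2 + (h - 1 / 2) by ring.
  have -> : g (1 / 2 + (h - 1 / 2)) = g (1 / 2) + g (h - 1 / 2) by apply: gadd; lra.
  by rewrite g12 add0r; apply: small; lra.
have gpow n h : 0 <= h -> h <= 1 -> `|g h| <= (4 * B + `|D 1|) / 2 ^+ n.
  elim: n h => [|n IH] h h0 h1; first by rewrite expr0 divr1; exact: gb.
  by rewrite exprSr invfM mulrA; apply: half.
move=> h h0 h1; apply/eqP; rewrite -subr_eq0 -/(g h) -normr_eq0 eq_le normr_ge0 andbT.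
rewrite leNgt; apply/negP => gp.
set C := 4 * B + `|D 1| in gpow.
have C0 : 0 <= C by rewrite addr_ge0// mulr_ge0.
have := archi_boundP (divr_ge0 C0 (ltW gp)); set n := Num.bound _ => nC.
have := gpow n h h0 h1; rewrite leNgt => /negP; apply.
have n2 : n%:R <= 2 ^+ n :> R by rewrite -natrX ler_nat ltnW// ltn_expl.
rewrite ltr_pdivrMr ?exprn_gt0//.
move: nC; rewrite ltr_pdivrMr// => nC; apply: (lt_le_trans nC).
by rewrite mulrC ler_wpM2l// ltW.
Qed.

(** The increment of F depends only on the length of the step, hence is additive in it. A single
    position at which both end values are bounded therefore bounds the increment of that length,
    which is what the last hypothesis offers. *)
Lemma affine_translation F (m0 m1 : R) : m0 < m1 ->
  (forall c c' d, 0 <= d -> m0 <= c -> c + d <= m1 -> m0 <= c' -> c' + d <= m1 ->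
     F (c + d) - F c = F (c' + d) - F c') ->
  (exists M : R, forall h, 0 < h -> h < 1 / 3 -> exists t, [/\ 0 <= t, t + h <= 1,
     `|F (m0 + t * (m1 - m0))| <= M & `|F (m0 + (t + h) * (m1 - m0))| <= M]) ->
  forall c, m0 <= c -> c <= m1 -> F c = F m0 + (c - m0) / (m1 - m0) * (F m1 - F m0).
Proof.
move=> m01 T [M good]; set w := m1 - m0.
have w0 : 0 < w by rewrite subr_gt0.
pose D h := F (m0 + h * w) - F m0.
have Dt t h : 0 <= t -> 0 <= h -> t + h <= 1 -> F (m0 + (t + h) * w) - F (m0 + t * w) = D h.
  move=> t0 h0 th; have := T (m0 + t * w) m0 (h * w).
  have -> : m0 + t * w + h * w = m0 + (t + h) * w by ring.
  by apply; rewrite /w; nra.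
have e := @bounded_additive D (2 * M).
have {}e : forall h, 0 <= h -> h <= 1 -> D h = h * D 1.
  apply: e.
    move=> h k h0 k0 hk; rewrite -(Dt h k)// /D; ring.
  move=> h h0 h1; have [t [t0 th b1 b2]] := good h h0 h1.
  rewrite -(Dt t h)//; last exact: ltW.
  have -> : 2 * M = M + M by ring.
  by apply: (le_trans (ler_normB _ _)); apply: lerD.
move=> c c0 c1; have h0 : 0 <= (c - m0) / w by rewrite divr_ge0 ?subr_ge0// ltW.
have h1 : (c - m0) / w <= 1 by rewrite ler_pdivrMr// mul1r lerD2r.
have := e _ h0 h1; rewrite /D divfK ?gt_eqF//.
have -> : m0 + (c - m0) = c by ring.
have -> : m0 + 1 * w = m1 by rewrite /w; ring.
by move=> E; lra.
Qed.

End Cauchy.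

(** * The edge functions of a quadrilateral *)

Section Core.
Variable R : realType.
Notation pt := (R * R)%type.
Implicit Types (p q : pt) (s : seq pt) (x a b h l c : R).

(** G sees the upper and the lower vertex only through the crossing point, which both of them shift.
    Exchanging vertices thus says that the increments of F do not depend on the starting point. *)
Lemma strip_affine (G : R -> R -> R) (F : R -> R) x x' h l :
  0 < x -> 0 < x' -> 0 < h -> 0 < l ->
  (forall a b, G a b = F ((a * l + b * h) / (h + l))) ->
  (forall a b a1 b1, crosses x x' a h b l -> crosses x x' a h b1 l -> crosses x x' a1 h b l ->
     crosses x x' a1 h b1 l -> G a b + G a1 b1 = G a b1 + G a1 b) ->
  (forall a0 a1, exists M : R, forall e, 0 < e -> e < 1 / 3 -> exists t, [/\ 0 <= t, t + e <= 1,
     `|G (a0 + t * (a1 - a0)) 0| <= M & `|G (a0 + (t + e) * (a1 - a0)) 0| <= M]) ->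
  forall c, - x' <= c -> c <= x -> F c = F 0 + c / x * (F x - F 0).
Proof.
move=> x0 x'0 h0 l0 GF mixG good.
have hl0 : 0 < h + l by lra.
have GE a b c : a * l + b * h = c * (h + l) -> G a b = F c.
  by move=> e; rewrite GF e mulfK// gt_eqF.
have A := @affine_translation R F (- x') x.
have {}A : forall c, - x' <= c -> c <= x ->
    F c = F (- x') + (c - - x') / (x - - x') * (F x - F (- x')).
  apply: A; first by lra.
    move=> c c' d d0 c1 c2 c'1 c'2.
    (* With b = 0 the two values of [a] put the crossing point at c and at c'; the nonzero value of
       [b] shifts it by d. *)
    have := mixG (c * (h + l) / l) (d * (h + l) / h) (c' * (h + l) / l) 0.
    rewrite (GE _ _ (c + d)); last by field; lra.
    rewrite (GE _ _ c'); last by field; lra.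
    rewrite (GE _ _ c); last by field; lra.
    rewrite (GE _ _ (c' + d)); last by field; lra.
    have E c0 d1 : - x' <= c0 + d1 -> c0 + d1 <= x ->
        crosses x x' (c0 * (h + l) / l) h (d1 * (h + l) / h) l.
      move=> h1 h2; rewrite /crosses.
      have -> : c0 * (h + l) / l * l + d1 * (h + l) / h * h = (c0 + d1) * (h + l) by field; lra.
      by split; apply: ler_wpM2r => //; exact: ltW.
    have E0 c0 : - x' <= c0 -> c0 <= x -> crosses x x' (c0 * (h + l) / l) h 0 l.
      by move=> h1 h2; have := @E c0 0; rewrite !mul0r addr0; apply.
    have -> : F (c + d) - F c = F (c' + d) - F c' <-> F (c + d) + F c' = F c + F (c' + d).
      by split=> ?; lra.
    by apply; [apply: E|apply: E0|apply: E|apply: E0]; lra.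
  have [M gM] := good (- x' * (h + l) / l) (x * (h + l) / l).
  exists M => e e0 e1; have [t [t0 te b1 b2]] := gM e e0 e1.
  exists t; split => //.
    by move: b1; rewrite (GE _ _ (- x' + t * (x - - x')))//; field; lra.
  by move: b2; rewrite (GE _ _ (- x' + (t + e) * (x - - x')))//; field; lra.
move=> c c0 c1; have A0 := A 0; rewrite (A c)// A0; [|lra|lra].
by field; lra.
Qed.

Variable z : set pt -> pt.
Hypotheses (val : valuation_on_Po z) (cov : covariant z) (reg : regular z).
Notation V := (quadval z).
Definition Vx x x' a h b l := (V x x' a h b l).1.
Definition Vy x x' a h b l := (V x x' a h b l).2.

Lemma quad_regular x x' h l a0 a1 : 0 < x -> 0 < x' -> 0 < h -> 0 < l ->
  exists M : R, forall e, 0 < e -> e < 1 / 3 -> exists t, [/\ 0 <= t, t + e <= 1,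
   `|Vx x x' (a0 + t * (a1 - a0)) h 0 l| <= M /\ `|Vy x x' (a0 + t * (a1 - a0)) h 0 l| <= M &
   `|Vx x x' (a0 + (t + e) * (a1 - a0)) h 0 l| <= M /\ `|Vy x x' (a0 + (t + e) * (a1 - a0)) h 0 l| <= M].
Proof.
move=> x0 x'0 h0 l0.
have E a : hull ((a, h) :: [:: (x, 0); (- x', 0); (0, - l)]) = hull [:: (x, 0); (- x', 0); (a, h); (0, - l)].
  apply: eq_hull => r; rewrite !inE.
  by case: (r == (a, h)); case: (r == (x, 0)); case: (r == (- x', 0)).
have i a : inn ((a, h) :: [:: (x, 0); (- x', 0); (0, - l)]).
  by rewrite /inn E; exact: V_inn.
have [M gM] := reg (i a0) (i a1); exists M => e e0 e1.
have [t [t0 te b1 b2]] := gM e e0 e1; exists t; split => //.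
  rewrite /Vx /Vy /quadval -E; have -> : (a0 + t * (a1 - a0), h) = lin t (a0, h) (a1, h).
    by apply: pt_eq => /=; ring.
  exact: b1.
rewrite /Vx /Vy /quadval -E; have -> : (a0 + (t + e) * (a1 - a0), h) = lin (t + e) (a0, h) (a1, h).
  by apply: pt_eq => /=; ring.
exact: b2.
Qed.

Section Vy.

(** The shear of slope (a - b) / (h + l) fixes the axis, hence the crossing point [c], and carries
    the vertical diagonal through [c] to the given one. *)
Lemma Vy_shear x x' a h b l : 0 < x -> 0 < x' -> 0 < h -> 0 < l ->
  let c := (a * l + b * h) / (h + l) in
  Vy x x' a h b l = Vy x x' c h c l /\
  Vx x x' a h b l = Vx x x' c h c l + (a - b) / (h + l) * Vy x x' c h c l.
Proof.
move=> x0 x'0 h0 l0 c.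
have := V_shear cov c c ((a - b) / (h + l)) x0 x'0 h0 l0.
have -> : c + (a - b) / (h + l) * h = a by rewrite /c; field; lra.
have -> : c - (a - b) / (h + l) * l = b by rewrite /c; field; lra.
by rewrite /Vy /Vx => ->.
Qed.

(* By [Vy_shear], [Vy] depends on [a] and [b] only through the point [c] where the
   second diagonal meets the axis; it turns out to be [Vy0 + Vy1 * c]. *)
Definition Vy0 x x' h l := Vy x x' 0 h 0 l.
Definition Vy1 x x' h l := (Vy x x' x h x l - Vy x x' 0 h 0 l) / x.

Lemma Vy_affine x x' a h b l : 0 < x -> 0 < x' -> 0 < h -> 0 < l ->
  crosses x x' a h b l ->
  Vy x x' a h b l = Vy0 x x' h l + Vy1 x x' h l * ((a * l + b * h) / (h + l)).
Proof.
move=> x0 x'0 h0 l0 [c1 c2].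
have [-> _] := Vy_shear a b x0 x'0 h0 l0.
have hl : 0 < h + l by lra.
have := @strip_affine (fun a b => Vy x x' a h b l) (fun c => Vy x x' c h c l) x x' h l x0 x'0 h0 l0.
move=> ->.
- by rewrite /Vy0 /Vy1; field; lra.
- by move=> a' b'; have [] := Vy_shear a' b' x0 x'0 h0 l0.
- move=> a' b' a1 b1 h1 h2 h3 h4.
  by have [] := V_mix val x0 x'0 h0 l0 h0 l0 h1 h2 h3 h4.
- move=> a0 a1; have [M gM] := quad_regular a0 a1 x0 x'0 h0 l0.
  exists M => e e0 e1; have [t [t0 te [_ b1] [_ b2]]] := gM e e0 e1.
  by exists t.
- by rewrite ler_pdivlMr.
- by rewrite ler_pdivrMr.
Qed.

Lemma crosses0 x x' h l : 0 < x -> 0 < x' -> 0 < h -> 0 < l -> crosses x x' 0 h 0 l.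
Proof. by move=> x0 x'0 h0 l0; rewrite /crosses !mul0r addr0; split; nra. Qed.

Lemma crossesx x x' h l : 0 < x -> 0 < x' -> 0 < h -> 0 < l -> crosses x x' x h 0 l.
Proof. by move=> x0 x'0 h0 l0; rewrite /crosses mul0r addr0; split; nra. Qed.

Lemma crossescc x x' h l c : 0 < h -> 0 < l -> - x' <= c -> c <= x -> crosses x x' c h c l.
Proof. by move=> h0 l0 c0 c1; rewrite /crosses -mulrDr (addrC l) ; split; nra. Qed.

(** Moving the upper vertex from (0, h) to (x, h) has the same effect over either lower vertex, by
    exchange. Over (0, - l) this moves the crossing point by x l / (h + l), whence the factor. *)
Lemma Vy1_l x x' h l l' : 0 < x -> 0 < x' -> 0 < h -> 0 < l -> 0 < l' ->
  Vy1 x x' h l * (l / (h + l)) = Vy1 x x' h l' * (l' / (h + l')).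
Proof.
move=> x0 x'0 h0 l0 l'0.
have [_] := V_mix val x0 x'0 h0 l0 h0 l'0 (crosses0 x0 x'0 h0 l0) (crosses0 x0 x'0 h0 l'0)
  (crossesx x0 x'0 h0 l0) (crossesx x0 x'0 h0 l'0).
rewrite -/(Vy x x' 0 h 0 l) -/(Vy x x' x h 0 l') -/(Vy x x' x h 0 l) -/(Vy x x' 0 h 0 l').
rewrite (Vy_affine x0 x'0 h0 l0 (crossesx x0 x'0 h0 l0)).
rewrite (Vy_affine x0 x'0 h0 l'0 (crossesx x0 x'0 h0 l'0)).
rewrite /Vy0 !mul0r !addr0 => e.
apply: (mulfI (lt0r_neq0 x0)).
have -> : x * (Vy1 x x' h l * (l / (h + l))) = Vy1 x x' h l * (x * l / (h + l)) by ring.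
have -> : x * (Vy1 x x' h l' * (l' / (h + l'))) = Vy1 x x' h l' * (x * l' / (h + l')) by ring.
lra.
Qed.

Lemma Vy_cc x x' h l c : 0 < x -> 0 < x' -> 0 < h -> 0 < l -> - x' <= c -> c <= x ->
  Vy x x' c h c l = Vy0 x x' h l + Vy1 x x' h l * c.
Proof.
move=> x0 x'0 h0 l0 c0 c1; rewrite (Vy_affine x0 x'0 h0 l0 (crossescc h0 l0 c0 c1)).
by have -> : (c * l + c * h) / (h + l) = c by field; lra.
Qed.

Lemma Vy0_opp x x' h l : 0 < x -> 0 < x' -> 0 < h -> 0 < l -> Vy0 x' x l h = - Vy0 x x' h l.
Proof.
move=> x0 x'0 h0 l0; rewrite /Vy0 /Vy.
by have := V_opp cov 0 0 x0 x'0 h0 l0; rewrite oppr0 => ->.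
Qed.

Lemma Vy1_opp x x' h l : 0 < x -> 0 < x' -> 0 < h -> 0 < l -> Vy1 x' x l h = Vy1 x x' h l.
Proof.
move=> x0 x'0 h0 l0.
have e : Vy x' x (- x) l (- x) h = - Vy x x' x h x l.
  by rewrite /Vy (V_opp cov x x x0 x'0 h0 l0).
move: e; rewrite Vy_cc//; [|lra]; rewrite (Vy_cc x0)//; [|lra].
rewrite Vy0_opp// => e.
have E : Vy1 x' x l h * x = Vy1 x x' h l * x by lra.
exact: (mulIf (lt0r_neq0 x0)).
Qed.

Lemma Vy1_h x x' h h' l : 0 < x -> 0 < x' -> 0 < h -> 0 < h' -> 0 < l ->
  Vy1 x x' h l * (h / (h + l)) = Vy1 x x' h' l * (h' / (h' + l)).
Proof.
move=> x0 x'0 h0 h'0 l0; rewrite -(Vy1_opp x0)// -(Vy1_opp x0 x'0 h'0)//.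
by rewrite (addrC h) (addrC h'); exact: Vy1_l.
Qed.

Lemma Vy1_sep x x' x1 x1' h l : 0 < x -> 0 < x' -> 0 < x1 -> 0 < x1' -> 0 < h -> 0 < l ->
  Vy1 x x' h l + Vy1 x1 x1' h l = Vy1 x x1' h l + Vy1 x1 x' h l.
Proof.
move=> x0 x'0 x10 x1'0 h0 l0.
have [c c0 [cx cx1]] : exists2 c, 0 < c & c <= x /\ c <= x1.
  by exists (Num.min x x1); rewrite ?lt_min ?x0// !ge_min !lexx orbT.
have [_] := V_sep val c c x0 x'0 x10 x1'0 h0 l0.
have [_] := V_sep val 0 0 x0 x'0 x10 x1'0 h0 l0.
rewrite -!/(Vy _ _ _ _ _ _) -!/(Vy0 _ _ _ _) => e0.
rewrite !Vy_cc//; try lra.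
move=> e; apply: (mulIf (lt0r_neq0 c0)).
by rewrite !mulrDl; lra.
Qed.

Lemma Vy1_torus x x' h l t : 0 < x -> 0 < x' -> 0 < h -> 0 < l -> 0 < t ->
  Vy1 (t * x) (t * x') (h / t) (l / t) = Vy1 x x' h l / t ^+ 2.
Proof.
move=> x0 x'0 h0 l0 t0; rewrite /Vy1 /Vy.
have := V_torus cov 0 0 x0 x'0 h0 l0 t0; rewrite mulr0 => ->.
by rewrite (V_torus cov x x x0 x'0 h0 l0 t0) /=; field; lra.
Qed.

(** In h and l, [Vy1] is proportional to (h + l) / (h l). The diagonal matrices then carry the
    vanishing to x = x'. Finally [Vy1_sep] with the symmetry [Vy1_opp] expresses the value at (x,
    x') through those at (x, x) and (x', x'). *)
Lemma Vy1_eq0 : Vy1 1 1 1 1 = 0 -> forall x x' h l, 0 < x -> 0 < x' -> 0 < h -> 0 < l ->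
  Vy1 x x' h l = 0.
Proof.
move=> f11.
have chi x x' h l : 0 < x -> 0 < x' -> 0 < h -> 0 < l ->
    Vy1 x x' h l * (h * l) * 2 = Vy1 x x' 1 1 * (h + l).
  move=> x0 x'0 h0 l0; have e1 := Vy1_l x0 x'0 h0 l0 ltr01.
  have e2 := Vy1_h x0 x'0 h0 ltr01 ltr01.
  have h1 : 0 < h + 1 by lra.
  have hl : 0 < h + l by lra.
  have -> : Vy1 x x' h l * (h * l) * 2 = Vy1 x x' h l * (l / (h + l)) * (2 * h * (h + l)) by field; lra.
  rewrite e1.
  have -> : Vy1 x x' h 1 * (1 / (h + 1)) * (2 * h * (h + l)) = Vy1 x x' h 1 * (h / (h + 1)) * (2 * (h + l)) by field; lra.
  by rewrite e2; field.
have diag x : 0 < x -> Vy1 x x 1 1 = 0.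
  move=> x0; have := Vy1_torus ltr01 ltr01 ltr01 ltr01 x0; rewrite f11 mul0r mulr1 => e.
  have := chi x x (1 / x) (1 / x) x0 x0 (divr_gt0 ltr01 x0) (divr_gt0 ltr01 x0).
  rewrite e !mul0r => /esym/eqP; rewrite mulf_eq0 => /orP[/eqP//|].
  have ix : 0 < 1 / x by exact: divr_gt0.
  by rewrite gt_eqF//; exact: addr_gt0.
have f1z x x' : 0 < x -> 0 < x' -> Vy1 x x' 1 1 = 0.
  move=> x0 x'0; have := Vy1_sep x0 x0 x'0 x'0 ltr01 ltr01.
  by rewrite !diag// (Vy1_opp x0)//; lra.
move=> x x' h l x0 x'0 h0 l0; have := chi x x' h l x0 x'0 h0 l0.
rewrite f1z// mul0r => e; have hl : 0 < h * l by exact: mulr_gt0.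
by apply: (mulIf (lt0r_neq0 hl)); lra.
Qed.

End Vy.
End Core.

(** * First coordinates and the splitting into edges *)

Section Edge.
Variable R : realType.
Notation pt := (R * R)%type.
Implicit Types (p q : pt) (x a b h l c s : R).
Variable z : set pt -> pt.
Hypotheses (val : valuation_on_Po z) (cov : covariant z) (reg : regular z).
Hypothesis f1z : Vy1 z 1 1 1 1 = 0.
Notation V := (quadval z).
Notation Vx := (Vx z).
Notation Vy := (Vy z).
Notation Vy0 := (Vy0 z).

Lemma VyE x x' a h b l : 0 < x -> 0 < x' -> 0 < h -> 0 < l -> crosses x x' a h b l ->
  Vy x x' a h b l = Vy0 x x' h l.
Proof.
move=> x0 x'0 h0 l0 c; rewrite (Vy_affine val cov reg)// (Vy1_eq0 val cov reg f1z)//.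
by rewrite mul0r addr0.
Qed.

Definition Vx0 x x' h l := Vx x x' 0 h 0 l.
Definition Vx1 x x' h l := (Vx x x' x h x l - Vx x x' 0 h 0 l) / x.

(** By [VyE] the shear correction is a function of [a] plus a function of [b], so subtracting it
    preserves the exchange relation. What remains depends on the crossing point alone and
    [strip_affine] applies. *)
Lemma Vx_affine x x' a h b l : 0 < x -> 0 < x' -> 0 < h -> 0 < l -> crosses x x' a h b l ->
  Vx x x' a h b l = (a - b) / (h + l) * Vy0 x x' h l + Vx0 x x' h l +
    Vx1 x x' h l * ((a * l + b * h) / (h + l)).
Proof.
move=> x0 x'0 h0 l0 cm; have [c1 c2] := cm.
have hl : 0 < h + l by lra.
have := @strip_affine R (fun a b => Vx x x' a h b l - (a - b) / (h + l) * Vy x x' a h b l)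
  (fun c => Vx x x' c h c l) x x' h l x0 x'0 h0 l0.
move=> /(_ _ _ _ ((a * l + b * h) / (h + l))) H.
have [e2 e1] := Vy_shear cov a b x0 x'0 h0 l0.
rewrite e1 -e2 (VyE x0)// H.
- by rewrite /Vx0 /Vx1; field; lra.
- by move=> a' b'; have [e2' e1'] := Vy_shear cov a' b' x0 x'0 h0 l0; rewrite e1' -e2'; ring.
- move=> a' b' a1 b1 h1 h2 h3 h4; rewrite !VyE//.
  have [+ _] := V_mix val x0 x'0 h0 l0 h0 l0 h1 h2 h3 h4.
  rewrite -!/(Vx _ _ _ _ _ _) => e.
  have -> : (a' - b') / (h + l) * Vy0 x x' h l = (a' / (h + l)) * Vy0 x x' h l - b' / (h + l) * Vy0 x x' h l by ring.
  have -> : (a1 - b1) / (h + l) * Vy0 x x' h l = (a1 / (h + l)) * Vy0 x x' h l - b1 / (h + l) * Vy0 x x' h l by ring.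
  have -> : (a' - b1) / (h + l) * Vy0 x x' h l = (a' / (h + l)) * Vy0 x x' h l - b1 / (h + l) * Vy0 x x' h l by ring.
  have -> : (a1 - b') / (h + l) * Vy0 x x' h l = (a1 / (h + l)) * Vy0 x x' h l - b' / (h + l) * Vy0 x x' h l by ring.
  lra.
- move=> a0 a1; have [M gM] := quad_regular reg a0 a1 x0 x'0 h0 l0.
  pose N := (`|a0| + `|a1 - a0|) / (h + l).
  have bnd t (u w : R) : 0 <= t -> t <= 1 -> `|u| <= M -> `|w| <= M ->
      `|u - (a0 + t * (a1 - a0) - 0) / (h + l) * w| <= M + N * M.
    move=> t0 t1 hu hw; apply: (le_trans (ler_normB _ _)); apply: lerD => //.
    rewrite normrM; apply: ler_pM => //.
    rewrite normrM normfV (ger0_norm (ltW hl)) /N; apply: ler_wpM2r.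
      by rewrite invr_ge0 ltW.
    rewrite subr0; apply: (le_trans (ler_normD _ _)); apply: lerD => //.
    by rewrite normrM (ger0_norm t0); apply: ler_piMl.
  exists (M + N * M) => e e0 e1'; have [t [t0 te [b1 b2] [b3 b4]]] := gM e e0 e1'.
  have t1 : t <= 1 by apply: le_trans te; rewrite lerDl ltW.
  by exists t; split => //; apply: bnd => //; rewrite addr_ge0// ltW.
- by rewrite ler_pdivlMr.
- by rewrite ler_pdivrMr.
Qed.

(* The coefficient of [a] in [Vx]. *)
Definition acoef x x' h l := (Vy0 x x' h l + l * Vx1 x x' h l) / (h + l).

Lemma acoef_l x x' h l l' : 0 < x -> 0 < x' -> 0 < h -> 0 < l -> 0 < l' ->
  acoef x x' h l = acoef x x' h l'.
Proof.
move=> x0 x'0 h0 l0 l'0.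
have [+ _] := V_mix val x0 x'0 h0 l0 h0 l'0 (crosses0 x0 x'0 h0 l0) (crosses0 x0 x'0 h0 l'0)
  (crossesx x0 x'0 h0 l0) (crossesx x0 x'0 h0 l'0).
rewrite -!/(Vx _ _ _ _ _ _).
rewrite (Vx_affine x0 x'0 h0 l0 (crossesx x0 x'0 h0 l0)).
rewrite (Vx_affine x0 x'0 h0 l'0 (crossesx x0 x'0 h0 l'0)).
rewrite -!/(Vx0 _ _ _ _) => e.
apply: (mulfI (lt0r_neq0 x0)).
have -> : x * acoef x x' h l = (x - 0) / (h + l) * Vy0 x x' h l + Vx1 x x' h l * ((x * l + 0 * h) / (h + l)).
  by rewrite /acoef; ring.
have -> : x * acoef x x' h l' = (x - 0) / (h + l') * Vy0 x x' h l' + Vx1 x x' h l' * ((x * l' + 0 * h) / (h + l')).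
  by rewrite /acoef; ring.
lra.
Qed.

Lemma Vx_cc x x' h l c : 0 < x -> 0 < x' -> 0 < h -> 0 < l -> - x' <= c -> c <= x ->
  Vx x x' c h c l = Vx0 x x' h l + Vx1 x x' h l * c.
Proof.
move=> x0 x'0 h0 l0 c0 c1; rewrite (Vx_affine x0 x'0 h0 l0 (crossescc h0 l0 c0 c1)).
have -> : (c * l + c * h) / (h + l) = c by field; lra.
by rewrite subrr !mul0r add0r.
Qed.

Lemma Vx0_opp x x' h l : 0 < x -> 0 < x' -> 0 < h -> 0 < l -> Vx0 x' x l h = - Vx0 x x' h l.
Proof.
move=> x0 x'0 h0 l0; rewrite /Vx0 /Vx.
by have := V_opp cov 0 0 x0 x'0 h0 l0; rewrite oppr0 => ->.
Qed.

Lemma Vx1_opp x x' h l : 0 < x -> 0 < x' -> 0 < h -> 0 < l -> Vx1 x' x l h = Vx1 x x' h l.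
Proof.
move=> x0 x'0 h0 l0.
have e : Vx x' x (- x) l (- x) h = - Vx x x' x h x l.
  by rewrite /Vx (V_opp cov x x x0 x'0 h0 l0).
move: e; rewrite Vx_cc//; [|lra]; rewrite (Vx_cc x0)//; [|lra].
rewrite Vx0_opp// => e.
have E : Vx1 x' x l h * x = Vx1 x x' h l * x by lra.
exact: (mulIf (lt0r_neq0 x0)).
Qed.

Lemma Vx1_sep x x' x1 x1' h l : 0 < x -> 0 < x' -> 0 < x1 -> 0 < x1' -> 0 < h -> 0 < l ->
  Vx1 x x' h l + Vx1 x1 x1' h l = Vx1 x x1' h l + Vx1 x1 x' h l.
Proof.
move=> x0 x'0 x10 x1'0 h0 l0.
have [c c0 [cx cx1]] : exists2 c, 0 < c & c <= x /\ c <= x1.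
  by exists (Num.min x x1); rewrite ?lt_min ?x0// !ge_min !lexx orbT.
have [+ _] := V_sep val c c x0 x'0 x10 x1'0 h0 l0.
have [+ _] := V_sep val 0 0 x0 x'0 x10 x1'0 h0 l0.
rewrite -!/(Vx _ _ _ _ _ _) -!/(Vx0 _ _ _ _) => e0.
rewrite !Vx_cc//; try lra.
move=> e; apply: (mulIf (lt0r_neq0 c0)).
by rewrite !mulrDl; lra.
Qed.

Lemma Vy0_sep x x' x1 x1' h l : 0 < x -> 0 < x' -> 0 < x1 -> 0 < x1' -> 0 < h -> 0 < l ->
  Vy0 x x' h l + Vy0 x1 x1' h l = Vy0 x x1' h l + Vy0 x1 x' h l.
Proof.
by move=> x0 x'0 x10 x1'0 h0 l0; have [] := V_sep val 0 0 x0 x'0 x10 x1'0 h0 l0.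
Qed.

Lemma Vx1_torus x x' h l t : 0 < x -> 0 < x' -> 0 < h -> 0 < l -> 0 < t ->
  Vx1 (t * x) (t * x') (h / t) (l / t) = Vx1 x x' h l.
Proof.
move=> x0 x'0 h0 l0 t0; rewrite /Vx1 /Vx.
have := V_torus cov 0 0 x0 x'0 h0 l0 t0; rewrite mulr0 => ->.
by rewrite (V_torus cov x x x0 x'0 h0 l0 t0) /=; field; lra.
Qed.

Lemma Vy0_torus x x' h l t : 0 < x -> 0 < x' -> 0 < h -> 0 < l -> 0 < t ->
  Vy0 (t * x) (t * x') (h / t) (l / t) = Vy0 x x' h l / t.
Proof.
move=> x0 x'0 h0 l0 t0; rewrite /Vy0 /Vy.
by have := V_torus cov 0 0 x0 x'0 h0 l0 t0; rewrite mulr0 => ->.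
Qed.

Lemma acoef_sep x x' x1 x1' h l : 0 < x -> 0 < x' -> 0 < x1 -> 0 < x1' -> 0 < h -> 0 < l ->
  acoef x x' h l + acoef x1 x1' h l = acoef x x1' h l + acoef x1 x' h l.
Proof.
move=> x0 x'0 x10 x1'0 h0 l0; rewrite /acoef -!mulrDl; congr (_ / _).
have := Vy0_sep x0 x'0 x10 x1'0 h0 l0; have := Vx1_sep x0 x'0 x10 x1'0 h0 l0.
by move=> e1 e2; rewrite addrACA e2 -mulrDr e1; ring.
Qed.

Definition acoef1 (s s' : R) := acoef s s' 1 1.

(** By [acoef_l] the lower vertex may be given the depth h, and a diagonal matrix then makes both
    heights 1. The arguments x h and x' h that survive are the determinants of the two upper
    edges. *)
Lemma acoefE x x' h l : 0 < x -> 0 < x' -> 0 < h -> 0 < l -> acoef x x' h l = acoef1 (x * h) (x' * h).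
Proof.
move=> x0 x'0 h0 l0; rewrite (acoef_l x0 x'0 h0 l0 h0) /acoef1 /acoef.
have := Vy0_torus x0 x'0 h0 h0 h0; have := Vx1_torus x0 x'0 h0 h0 h0.
by rewrite divff ?gt_eqF// !(mulrC h) => -> ->; field; lra.
Qed.

(** The left side is the coefficient of [b] in [Vx_affine]; the half turn makes it a coefficient of
    [a]. *)
Lemma acoef_opp x x' h l : 0 < x -> 0 < x' -> 0 < h -> 0 < l ->
  (- Vy0 x x' h l + h * Vx1 x x' h l) / (h + l) = acoef1 (x' * l) (x * l).
Proof.
move=> x0 x'0 h0 l0; rewrite -(acoefE x'0 x0 l0 h0) /acoef (Vy0_opp cov x0)// (Vx1_opp x0)//.
by rewrite (addrC l).
Qed.

(** The upper vertex is the head of the edge of determinant x h and the tail of the one of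
    determinant x' h; its coefficient splits accordingly by [acoef1E]. Subtracting the value at (1,
    1) in one summand only makes the sum come out right. *)
Definition ghead s := acoef1 s 1.
Definition gtail s := acoef1 1 s - acoef1 1 1.

Lemma acoef1E s s' : 0 < s -> 0 < s' -> acoef1 s s' = ghead s + gtail s'.
Proof.
move=> s0 s'0; have := acoef_sep s0 s'0 ltr01 ltr01 ltr01 ltr01.
by rewrite /gtail /ghead /acoef1 => e; lra.
Qed.

Lemma quad_edges x x' a h b l : 0 < x -> 0 < x' -> 0 < h -> 0 < l -> crosses x x' a h b l ->
  V x x' a h b l =
  (a * (ghead (x * h) + gtail (x' * h)) + b * (ghead (x' * l) + gtail (x * l)) +
     x * (gtail (x * h) + ghead (x * l)) - x' * (ghead (x' * h) + gtail (x' * l)),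
   h * (ghead (x * h) + gtail (x' * h)) - l * (ghead (x' * l) + gtail (x * l))).
Proof.
move=> x0 x'0 h0 l0 cm.
(* In h times the coefficient of [a] minus l times that of [b] the terms with [Vx1] cancel and [Vy0]
   remains. *)
have f0E y y' k m : 0 < y -> 0 < y' -> 0 < k -> 0 < m ->
    Vy0 y y' k m = k * (ghead (y * k) + gtail (y' * k)) - m * (ghead (y' * m) + gtail (y * m)).
  move=> y0 y'0 k0 m0; rewrite -!acoef1E ?mulr_gt0//.
  rewrite -(acoefE y0 y'0 k0 m0) -(acoef_opp y0 y'0 k0 m0) /acoef; field; lra.
(* After a quarter turn the vertices on the axis become the upper and lower ones, so their
   coefficients are also given by [f0E]. *)
have w0E : Vx0 x x' h l = Vy0 l h x x'.
  by rewrite /Vx0 /Vy0 /Vx /Vy (V_rot cov x0).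
apply: pt_eq; last first.
  by rewrite -/(Vy _ _ _ _ _ _) VyE// f0E.
rewrite -/(Vx _ _ _ _ _ _) Vx_affine// w0E (f0E l h)//=.
rewrite -(acoef1E (mulr_gt0 x0 h0) (mulr_gt0 x'0 h0)) -(acoef1E (mulr_gt0 x'0 l0) (mulr_gt0 x0 l0)).
rewrite -(acoefE x0 x'0 h0 l0) -(acoef_opp x0 x'0 h0 l0) /acoef (mulrC l x) (mulrC h x) (mulrC h x') (mulrC l x') /=.
by field; lra.
Qed.

End Edge.

(** * Triangles *)

Section Triangle.
Variable R : realType.
Notation pt := (R * R)%type.
Implicit Types (p q n : pt) (s : R).
Variable z : set pt -> pt.
Hypotheses (val : valuation_on_Po z) (cov : covariant z) (reg : regular z).
Hypothesis f1z : Vy1 z 1 1 1 1 = 0.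
Notation gtail := (gtail z).
Notation ghead := (ghead z).

Definition edge_term (u1 u2 : R -> R) p q : pt :=
  (u1 (det2 p q) * p.1 + u2 (det2 p q) * q.1, u1 (det2 p q) * p.2 + u2 (det2 p q) * q.2).

Notation G := (edge_term gtail ghead).

Lemma sqr_sum_gt0 x p : 0 < det2 x p -> 0 < x.1 ^+ 2 + x.2 ^+ 2 :> R.
Proof.
move=> xp; rewrite lt_neqAle addr_ge0 ?sqr_ge0// andbT eq_sym.
apply/eqP => /eqP; rewrite paddr_eq0 ?sqr_ge0// !sqrf_eq0 => /andP[/eqP x1 /eqP x2].
by move: xp; rewrite /det2 x1 x2 !mul0r subrr ltxx.
Qed.

Lemma diag_edges x (k : R) p n : 0 < k -> 0 < det2 x p -> det2 x n < 0 -> compat x k p n ->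
  let x' := vscale (- k) x in
  z (hull [:: x; x'; p; n]) = vadd (vadd (G x p) (G p x')) (vadd (G x' n) (G n x)).
Proof.
move=> k0 xp xn [c1 c2] x'.
have N0 := sqr_sum_gt0 xp; set N := x.1 ^+ 2 + x.2 ^+ 2 in N0.
have NE : N = x.1 * x.1 + x.2 * x.2 by rewrite /N !expr2.
pose h := det2 x p; pose l := - det2 x n.
have h0 : 0 < h by [].
have l0 : 0 < l by rewrite /l oppr_gt0.
(* First coordinates of [p] and [n] in the basis formed by [x] and (- x.2, x.1) / N, whose matrix
   has determinant 1 and sends (1, 0) to [x]. *)
pose a := (x.1 * p.1 + x.2 * p.2) / N; pose b := (x.1 * n.1 + x.2 * n.2) / N.
have D : x.1 * (x.1 / N) - (- x.2 / N) * x.2 = 1 by rewrite NE; field; rewrite -NE; lra.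
have i := V_inn a b ltr01 k0 h0 l0.
have cr : crosses 1 k a h b l.
  have pn : det2 p n = - (a * l + b * h).
    by rewrite /a /b /h /l /det2 NE; field; rewrite -NE; lra.
  have xnl : det2 x n = - l by rewrite /l opprK.
  by move: c1 c2; rewrite pn xnl -/h /crosses; split; lra.
have := covZ cov D i; rewrite -/(quadval z 1 k a h b l) (quad_edges val cov reg f1z ltr01 k0 h0 l0 cr).
have -> : map (lmap x.1 (- x.2 / N) x.2 (x.1 / N)) [:: (1, 0); (- k, 0); (a, h); (b, - l)] =
   [:: x; x'; p; n].
  rewrite /= /lmap /=; congr [:: _; _; _; _]; apply: pt_eq => /=.
  - ring.
  - ring.
  - ring.
  - ring.
  - by rewrite /a /h /det2 NE; field; rewrite -NE; lra.
  - by rewrite /a /h /det2 NE; field; rewrite -NE; lra.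
  - by rewrite /b /l /det2 NE; field; rewrite -NE; lra.
  - by rewrite /b /l /det2 NE; field; rewrite -NE; lra.
move=> ->.
have px' : det2 p x' = k * h by rewrite /h /det2 /=; ring.
have x'n : det2 x' n = k * l by rewrite /l /det2 /=; ring.
have nx : det2 n x = l by rewrite /l det2C.
rewrite /edge_term px' x'n nx -/h !mul1r.
have p1 : p.1 = a * x.1 - h * x.2 / N by rewrite /a /h /det2 NE; field; rewrite -NE; lra.
have p2 : p.2 = a * x.2 + h * x.1 / N by rewrite /a /h /det2 NE; field; rewrite -NE; lra.
have n1 : n.1 = b * x.1 + l * x.2 / N by rewrite /b /l /det2 NE; field; rewrite -NE; lra.
have n2 : n.2 = b * x.2 - l * x.1 / N by rewrite /b /l /det2 NE; field; rewrite -NE; lra.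
by apply: pt_eq => /=; rewrite ?p1 ?p2 ?n1 ?n2; ring.
Qed.

(* The point where the ray opposite to [q] leaves the triangle [n p q]. *)
Definition opp_pt n p q : pt := vscale (- (det2 n p / (det2 p q + det2 q n))) q.

Lemma triangle_edges n p q : 0 < det2 n p -> 0 < det2 p q -> 0 < det2 q n ->
  let X := opp_pt n p q in
  z (hull [:: n; p; q]) = vadd (vadd (G X p) (G p q)) (vadd (G q n) (G n X)).
Proof.
move=> e1 e2 e3 X; set d1 := det2 n p in e1; set d2 := det2 p q in e2; set d3 := det2 q n in e3.
have d23 : 0 < d2 + d3 by lra.
(* The relation d2 n + d3 p + d1 q = 0 turns this negative multiple of [q] into a convex combination
   of [n] and [p]: the triangle is a quadrilateral with a flat vertex at [X]. *)
have X1 : X = ((d2 * n.1 + d3 * p.1) / (d2 + d3), (d2 * n.2 + d3 * p.2) / (d2 + d3)).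
  apply: pt_eq => /=; rewrite -/d1 -/d2 -/d3.
    have -> : d2 * n.1 + d3 * p.1 = - d1 * q.1 by rewrite /d1 /d2 /d3 /det2; ring.
    by field; lra.
  have -> : d2 * n.2 + d3 * p.2 = - d1 * q.2 by rewrite /d1 /d2 /d3 /det2; ring.
  by field; lra.
pose k := (d2 + d3) / d1.
have k0 : 0 < k by rewrite divr_gt0.
have qX : vscale (- k) X = q.
  by apply: pt_eq => /=; rewrite -/d1 -/d2 -/d3 /k; field; lra.
have Xp : det2 X p = d1 * d2 / (d2 + d3).
  by rewrite /X /opp_pt det2Zl (det2C q p) -/d1 -/d2 -/d3; field; lra.
have Xn : det2 X n = - (d1 * d3 / (d2 + d3)).
  by rewrite /X /opp_pt det2Zl -/d1 -/d2 -/d3; field; lra.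
have XpXn : det2 X p - det2 X n = d1 by rewrite Xp Xn; field; lra.
have := @diag_edges X k p n k0; rewrite qX => <-.
- congr z; apply: hull_eq => r; rewrite !inE.
    by move=> h1; apply: hull_in; rewrite !inE; case/or3P: h1 => ->; rewrite ?orbT.
  move=> /or4P[/eqP->|/eqP->|/eqP->|/eqP->]; try by in_hull.
  have -> : X = lin (d3 / (d2 + d3)) n p by rewrite X1; apply: pt_eq => /=; field; lra.
  apply: hull_cvx.
  - by in_hull.
  - by in_hull.
  - by rewrite divr_ge0//; lra.
  - by rewrite ler_pdivrMr; lra.
- by rewrite Xp divr_gt0// mulr_gt0.
- by rewrite Xn oppr_lt0 divr_gt0// mulr_gt0.
- rewrite /compat XpXn det2C -/d1; split; first by lra.
  have : 0 < k * d1 by rewrite mulr_gt0.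
  lra.
Qed.

(* The failure of additivity of the edge sum when [n, p] is subdivided at [opp_pt n p q];
   by [defect_rot] it is the same for the three edges of a triangle. *)
Definition defect n p q : pt :=
  let X := opp_pt n p q in
  ((G n X).1 + (G X p).1 - (G n p).1, (G n X).2 + (G X p).2 - (G n p).2).

(** By [triangle_edges] the value of the triangle is the sum over its three edges plus the defect of
    one of them; value and sum are invariant under rotation. *)
Lemma defect_rot n p q : 0 < det2 n p -> 0 < det2 p q -> 0 < det2 q n ->
  defect n p q = defect p q n.
Proof.
move=> e1 e2 e3; have := triangle_edges e1 e2 e3.
have -> : hull [:: n; p; q] = hull [:: p; q; n].
  by apply: eq_hull => r; rewrite !inE; case: (r == n); case: (r == p); case: (r == q).
rewrite (triangle_edges e2 e3 e1) => -[h1 h2].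
by apply: pt_eq; rewrite /=; lra.
Qed.

(** [defectl] and [defectr] are the determinants of the defect against the two ends of the edge, as
    functions of the determinants a and b of the two parts of the edge. *)
Definition defectl (a b : R) := a * ghead a + a * gtail b + (a + b) * ghead b - (a + b) * ghead (a + b).
Definition defectr (a b : R) := (a + b) * gtail a + b * ghead a + b * gtail b - (a + b) * gtail (a + b).

Lemma defect_det n p q : 0 < det2 n p -> 0 < det2 p q -> 0 < det2 q n ->
  let a := det2 n p * det2 q n / (det2 p q + det2 q n) in
  let b := det2 n p * det2 p q / (det2 p q + det2 q n) in
  det2 n (defect n p q) = defectl a b /\ det2 (defect n p q) p = defectr a b.
Proof.
move=> e1 e2 e3 a b.
have d23 : 0 < det2 p q + det2 q n by lra.
have nX : det2 n (opp_pt n p q) = a.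
  by rewrite /opp_pt det2Zr (det2C n q) /a; ring.
have Xp : det2 (opp_pt n p q) p = b.
  by rewrite /opp_pt det2Zl (det2C q p) /b; ring.
have np : det2 n p = a + b by rewrite /a /b; field; lra.
have E : defect n p q = let X := opp_pt n p q in
    (gtail a * n.1 + ghead a * X.1 + (gtail b * X.1 + ghead b * p.1) - (gtail (a + b) * n.1 + ghead (a + b) * p.1),
     gtail a * n.2 + ghead a * X.2 + (gtail b * X.2 + ghead b * p.2) - (gtail (a + b) * n.2 + ghead (a + b) * p.2)).
  by rewrite /defect /edge_term nX Xp np.
rewrite E; move: (opp_pt n p q) nX Xp => X nX Xp; rewrite /defectl /defectr.
split.
  transitivity (ghead a * det2 n X + gtail b * det2 n X + ghead b * det2 n p - ghead (a + b) * det2 n p).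
    by rewrite /det2 /=; ring.
  by rewrite nX np; ring.
transitivity (gtail a * det2 n p + ghead a * det2 X p + gtail b * det2 X p - gtail (a + b) * det2 n p).
  by rewrite /det2 /=; ring.
by rewrite Xp np; ring.
Qed.

Lemma triangle_dets (e1 e2 e3 : R) : 0 < e1 -> exists n p q,
  [/\ det2 n p = e1, det2 p q = e2, det2 q n = e3 &
    e2 * n.1 + e3 * p.1 + e1 * q.1 = 0 /\ e2 * n.2 + e3 * p.2 + e1 * q.2 = 0].
Proof.
move=> e10; exists (1, 0), (0, e1), (- e2 / e1, - e3); rewrite /det2 /=.
by split; [ring|field; lra|ring|split; [field; lra|ring]].
Qed.

(** Both sides measure the same vector against the vertex [n], once as the start of the edge from
    [n] to [p] and once as the end of the edge from [q] to [n]. *)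
Lemma defect_swap (e1 e2 e3 : R) : 0 < e1 -> 0 < e2 -> 0 < e3 ->
  defectl (e1 * e3 / (e2 + e3)) (e1 * e2 / (e2 + e3)) =
  - defectr (e3 * e2 / (e1 + e2)) (e3 * e1 / (e1 + e2)).
Proof.
move=> e10 e20 e30; have [n [p [q [np pq qn _]]]] := triangle_dets e2 e3 e10.
have np0 : 0 < det2 n p by rewrite np.
have pq0 : 0 < det2 p q by rewrite pq.
have qn0 : 0 < det2 q n by rewrite qn.
have [+ _] := defect_det np0 pq0 qn0; have [_ +] := defect_det qn0 np0 pq0.
rewrite -(defect_rot pq0 qn0 np0) -(defect_rot np0 pq0 qn0) np pq qn => <- <-.
by rewrite det2C.
Qed.

(** In a triangle with equal determinants the vertices sum to zero, so the determinants of the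
    common defect against them sum to zero as well; by symmetry these are all equal to the left
    side. *)
Lemma defectl_half (e : R) : 0 < e -> defectl (e / 2) (e / 2) = 0.
Proof.
move=> e0; have [n [p [q [np pq qn [s1 s2]]]]] := triangle_dets e e e0.
have np0 : 0 < det2 n p by rewrite np.
have pq0 : 0 < det2 p q by rewrite pq.
have qn0 : 0 < det2 q n by rewrite qn.
have [h1 _] := defect_det np0 pq0 qn0; have [h2 _] := defect_det pq0 qn0 np0.
have [h3 _] := defect_det qn0 np0 pq0.
move: h1 h2 h3; rewrite -(defect_rot pq0 qn0 np0) -(defect_rot np0 pq0 qn0) np pq qn.
have -> : e * e / (e + e) = e / 2 by field; lra.
move: (defect n p q) => d h1 h2 h3.
have : e * (det2 n d + det2 p d + det2 q d) = 0.
  transitivity ((e * n.1 + e * p.1 + e * q.1) * d.2 - (e * n.2 + e * p.2 + e * q.2) * d.1).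
    by rewrite /det2; ring.
  by rewrite s1 s2; ring.
rewrite h1 h2 h3 => /eqP; rewrite mulf_eq0 gt_eqF//= => /eqP E; lra.
Qed.

(* The defect depends only on the ratio of the last two determinants in one
   description and on that of the first two in the other, so every triangle can
   be rescaled to one with equal determinants. *)
Lemma defectl0 (a b : R) : 0 < a -> 0 < b -> defectl a b = 0.
Proof.
move=> a0 b0; pose N (e1 e2 e3 : R) := defectl (e1 * e3 / (e2 + e3)) (e1 * e2 / (e2 + e3)).
have Nr (t e1 e2 e3 : R) : 0 < t -> 0 < e1 -> 0 < e2 -> 0 < e3 -> N e1 (t * e2) (t * e3) = N e1 e2 e3.
  move=> t0 e10 e20 e30; have te : 0 < t * e2 + t * e3 by rewrite addr_gt0// mulr_gt0.
  by congr defectl; field; lra.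
have Nl (t e1 e2 e3 : R) : 0 < t -> 0 < e1 -> 0 < e2 -> 0 < e3 -> N (t * e1) (t * e2) e3 = N e1 e2 e3.
  move=> t0 e10 e20 e30; rewrite /N !defect_swap ?mulr_gt0//.
  have te : 0 < t * e1 + t * e2 by rewrite addr_gt0// mulr_gt0.
  by congr (- defectr _ _); field; lra.
have -> : defectl a b = N (a + b) b a.
  by congr defectl; field; lra.
have ab : 0 < a + b by lra.
(* Scaling the first two determinants by a / b makes the last two both equal to a; scaling these by
   (a + b) / b makes all three equal to [m]. *)
pose m := (a + b) * a / b.
have m0 : 0 < m by rewrite divr_gt0// mulr_gt0.
have ab' : 0 < a / b by exact: divr_gt0.
have abb : 0 < (a + b) / b by exact: divr_gt0.
rewrite -(@Nl (a / b))// -(@Nr ((a + b) / b))//; last 2 first.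
- exact: mulr_gt0.
- exact: mulr_gt0.
have -> : a / b * (a + b) = m by rewrite /m; field; lra.
have -> : (a + b) / b * (a / b * b) = m by rewrite /m; field; lra.
have -> : (a + b) / b * a = m by rewrite /m; field; lra.
have -> : N m m m = defectl (m / 2) (m / 2) by congr defectl; field; lra.
exact: defectl_half.
Qed.

Lemma Vy0_regular (x0 x1 : R) : 0 < x0 -> 0 < x1 ->
  exists M : R, forall e, 0 < e -> e < 1 / 3 -> exists t, [/\ 0 <= t, t + e <= 1,
   `|Vy0 z (x0 + t * (x1 - x0)) 1 1 1| <= M & `|Vy0 z (x0 + (t + e) * (x1 - x0)) 1 1 1| <= M].
Proof.
move=> x00 x10; pose S : seq pt := [:: (- 1, 0); (0, 1); (0, - 1)].
have i y : 0 < y -> inn ((y, 0) :: S).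
  by move=> y0; apply: (V_inn 0 0 y0 ltr01 ltr01 ltr01).
have [M gM] := reg (i _ x00) (i _ x10); exists M => e e0 e1.
have [t [t0 te [_ b1] [_ b2]]] := gM e e0 e1; exists t; split => //.
  have E : lin t (x0, 0) (x1, 0) = (x0 + t * (x1 - x0), 0) by apply: pt_eq => /=; ring.
  by move: b1; rewrite E.
have E : lin (t + e) (x0, 0) (x1, 0) = (x0 + (t + e) * (x1 - x0), 0) by apply: pt_eq => /=; ring.
by move: b2; rewrite E.
Qed.

Lemma edge_functions : exists k c : R, forall s, 0 < s ->
  gtail s = k * s / 2 - c /\ ghead s = k * s / 2 + c.
Proof.
pose a s := gtail s + ghead s.
have cocycle u v : 0 < u -> 0 < v -> (u + v) * ghead (u + v) = u * ghead u + u * a v + v * ghead v.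
  by move=> u0 v0; have := defectl0 u0 v0; rewrite /defectl /a => e; lra.
(* The cocycle is symmetric in u and v except for its middle term, which must then be symmetric
   too. *)
have asym u v : 0 < u -> 0 < v -> u * a v = v * a u.
  move=> u0 v0; have := cocycle u v u0 v0; have := cocycle v u v0 u0.
  by rewrite (addrC v u) => -> e; lra.
pose k := a 1; have aE s : 0 < s -> a s = k * s.
  by move=> s0; have := asym 1 s ltr01 s0; rewrite mul1r mulrC.
(* As [a] is linear, the middle term k u v is the coboundary of k s ^ 2 / 2; without that part the
   cocycle becomes additive. *)
pose c s := s * ghead s - k * s ^+ 2 / 2.
have cadd u v : 0 < u -> 0 < v -> c (u + v) = c u + c v.
  by move=> u0 v0; rewrite /c cocycle// aE//; field.
(* This ties [c] to values of z along a segment of polygons, whose regularity excludes wild additive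
   solutions. *)
have f0E s : 0 < s -> c s = s / 2 * (Vy0 z s 1 1 1 - (gtail 1 - ghead 1)).
  move=> s0; have E : Vy0 z s 1 1 1 = 1 * (ghead (s * 1) + gtail (1 * 1)) - 1 * (ghead (1 * 1) + gtail (s * 1)).
    exact: (congr1 snd (quad_edges val cov reg f1z s0 ltr01 ltr01 ltr01 (crosses0 s0 ltr01 ltr01 ltr01))).
  rewrite E.
  have : gtail s = k * s - ghead s by rewrite -aE// /a; ring.
  by rewrite /c !mulr1 !mul1r => ->; field.
exists k, (c 1) => s s0.
have c1E : c s = s * c 1.
  (* Large enough for both 2 and 1 + s to lie in [1, m]; comparing the affine formula at these two
     points gives the value at s. The interval stays away from 0, where the polygons degenerate. *)
  pose m := s + 2; have m1 : 1 < m by rewrite /m; lra.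
  have A := @affine_translation R c 1 m m1.
  have {}A : forall u, 1 <= u -> u <= m -> c u = c 1 + (u - 1) / (m - 1) * (c m - c 1).
    apply: A.
      move=> u v d; rewrite le_eqVlt => /predU1P[<-|d0] u1 _ v1 _; first by rewrite !addr0 !subrr.
      by rewrite !cadd//; [ring|lra|lra].
    have [M gM] := Vy0_regular ltr01 (lt_trans ltr01 m1).
    exists (m / 2 * (M + `|gtail 1 - ghead 1|)) => e e0 e1.
    have [t [t0 te b1 b2]] := gM e e0 e1; exists t.
    have bnd r : 0 <= r -> r <= 1 -> `|Vy0 z (1 + r * (m - 1)) 1 1 1| <= M ->
        `|c (1 + r * (m - 1))| <= m / 2 * (M + `|gtail 1 - ghead 1|).
      move=> r0 r1 b; have p0 : 0 < 1 + r * (m - 1) by nra.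
      rewrite f0E// normrM ger0_norm; last by rewrite divr_ge0// ltW.
      apply: ler_pM => //; first by rewrite divr_ge0// ltW.
        by apply: ler_wpM2r => //; nra.
      by apply: (le_trans (ler_normB _ _)); rewrite lerD2r.
    by split => //; apply: bnd => //; lra.
  have c2 : c 2 = 2 * c 1 by have -> : 2 = 1 + 1 :> R; [ring|rewrite cadd//; ring].
  have A2 := A 2; have As := A (1 + s); move: A2 As.
  rewrite (cadd 1 s)// c2 => A2 As.
  have m10 : 0 < m - 1 by lra.
  have {}A2 : (2 - 1) / (m - 1) * (c m - c 1) = c 1.
    by have := A2 ltac:(lra) ltac:(rewrite /m; lra); lra.
  have {}As : c s = (1 + s - 1) / (m - 1) * (c m - c 1).
    by have := As ltac:(lra) ltac:(rewrite /m; lra); lra.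
  by rewrite As -[in RHS]A2; ring.
have g2E : ghead s = k * s / 2 + c 1.
  apply: (mulfI (lt0r_neq0 s0)); have : s * ghead s = c s + k * s ^+ 2 / 2 by rewrite /c; ring.
  by rewrite c1E => ->; field.
split => //; have : gtail s = k * s - ghead s by rewrite -aE// /a; ring.
by rewrite g2E => ->; field.
Qed.

(** Under [compat], three times the moment vector of the quadrilateral: each edge spans with the
    origin a triangle of area det / 2 and centroid (p + q) / 3. *)
Definition quad_moment x (k : R) p n : pt :=
  let x' := vscale (- k) x in
  let E p q := (det2 p q / 2 * (p.1 + q.1), det2 p q / 2 * (p.2 + q.2)) in
  vadd (vadd (E x p) (E p x')) (vadd (E x' n) (E n x)).

(** The additive constant of the edge functions contributes a multiple of q - p for each edge
    [p, q], and these cancel around the quadrilateral. *)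
Lemma diag_quad : exists c : R, forall x (k : R) p n, 0 < k -> 0 < det2 x p ->
  det2 x n < 0 -> compat x k p n ->
  z (hull [:: x; vscale (- k) x; p; n]) = vscale c (quad_moment x k p n).
Proof.
have [c [d cd]] := edge_functions; exists c => x k p n k0 xp xn cm.
rewrite (diag_edges k0 xp xn cm).
have px' : det2 p (vscale (- k) x) = k * det2 x p by rewrite /det2 /=; ring.
have x'n : det2 (vscale (- k) x) n = k * det2 n x by rewrite /det2 /=; ring.
have nx : 0 < det2 n x by rewrite det2C oppr_gt0.
rewrite /quad_moment /edge_term px' x'n.
have [-> ->] := cd _ xp; have [-> ->] := cd _ nx.
have [-> ->] := cd _ (mulr_gt0 k0 xp); have [-> ->] := cd _ (mulr_gt0 k0 nx).
by apply: pt_eq => /=; field.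
Qed.

End Triangle.

(** * Valuations vanishing on quadrilaterals *)

Section Sector.
Variable R : realType.
Notation pt := (R * R)%type.
Implicit Types (x y p q a b : pt) (s L : seq pt) (k e : R).
Variable w : set pt -> pt.
Hypothesis val : valuation_on_Po w.
Hypothesis quad0 : forall x k p q, 0 < k -> 0 < det2 x p -> det2 x q < 0 ->
  compat x k p q -> w (hull [:: x; vscale (- k) x; p; q]) = (0, 0).

Lemma inn_subset s s' : {subset s <= s'} -> inn s -> inn s'.
Proof. by move=> ss; apply: in_interior_sub; exact: hull_subset. Qed.

Lemma inn_mem s x k a b : 0 < k -> 0 < det2 x a -> det2 x b < 0 ->
  x \in s -> vscale (- k) x \in s -> a \in s -> b \in s -> inn s.
Proof.
move=> k0 xa xb xs x's as_ bs; apply: inn_subset (inn_diag k0 xa xb) => r.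
by rewrite !inE => /or4P[] /eqP->.
Qed.

(** Exchanging against a single lower vertex from [B] produces two quadrilaterals, both annihilated
    by [w]. A lone vertex on one side of the diagonal can thus be replaced freely. *)
Lemma swap_up x k a a' B : 0 < k -> 0 < det2 x a -> 0 < det2 x a' -> B != [::] ->
  (forall b, b \in B -> det2 x b < 0) ->
  (forall b, b \in B -> compat x k a b) -> (forall b, b \in B -> compat x k a' b) ->
  w (hull (x :: vscale (- k) x :: a :: B)) = w (hull (x :: vscale (- k) x :: a' :: B)).
Proof.
move=> k0 xa xa' B0 hB ca ca'; have [b bB] : exists b, b \in B.
  by case: B B0 {hB ca ca'} => // b B' _; exists b; rewrite mem_head.
have i c (cs : seq pt) : 0 < det2 x c -> b \in cs -> inn (x :: vscale (- k) x :: [:: c] ++ cs).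
  by move=> xc bc; apply: (inn_mem k0 xc (hB _ bB)); rewrite !inE ?eqxx ?orbT// bc !orbT.
have := @mix _ w x k [:: a] B [:: a'] [:: b] val k0 isT B0 isT isT.
rewrite /= (quad0 k0 xa (hB _ bB) (ca _ bB)) (quad0 k0 xa' (hB _ bB) (ca' _ bB)).
move=> H; have {H} [] : vadd (w (hull (x :: vscale (- k) x :: a :: B))) (0, 0) =
   vadd (0, 0) (w (hull (x :: vscale (- k) x :: a' :: B))).
  apply: H.
  - by move=> r; rewrite !inE => /orP[]/eqP->.
  - by move=> r; rewrite mem_cat !inE => /orP[/hB//|/eqP->]; exact: hB.
  - move=> r r'; rewrite mem_cat !inE => /orP[]/eqP-> /orP[|/eqP->];
      by [apply: ca|exact: ca|apply: ca'|exact: ca'].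
  - exact: i.
  - by apply: i; rewrite ?mem_head.
  - exact: i.
  - by apply: i; rewrite ?mem_head.
by rewrite !addr0 !add0r => e1 e2; exact: pt_eq.
Qed.

Lemma swap_low x k b b' A : 0 < k -> det2 x b < 0 -> det2 x b' < 0 -> A != [::] ->
  (forall a, a \in A -> 0 < det2 x a) ->
  (forall a, a \in A -> compat x k a b) -> (forall a, a \in A -> compat x k a b') ->
  w (hull (x :: vscale (- k) x :: b :: A)) = w (hull (x :: vscale (- k) x :: b' :: A)).
Proof.
move=> k0 xb xb' A0 hA cb cb'; have [a aA] : exists a, a \in A.
  by case: A A0 {hA cb cb'} => // b0 B' _; exists b0; rewrite mem_head.
have i c (cs : seq pt) : det2 x c < 0 -> a \in cs -> inn (x :: vscale (- k) x :: cs ++ [:: c]).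
  move=> xc bc; apply: (inn_mem k0 (hA _ aA) xc);
    by rewrite !inE ?eqxx ?orbT// mem_cat ?bc ?mem_head ?orbT.
have := @mix _ w x k A [:: b] [:: a] [:: b'] val k0 A0 isT isT isT.
rewrite /= (quad0 k0 (hA _ aA) xb (cb _ aA)) (quad0 k0 (hA _ aA) xb' (cb' _ aA)).
have perm c : hull (x :: vscale (- k) x :: A ++ [:: c]) = hull (x :: vscale (- k) x :: c :: A).
  by apply: eq_hull => r; rewrite !(inE, mem_cat) [_ || (r == c)]orbC.
rewrite !perm => H; have {H} [] : vadd (w (hull (x :: vscale (- k) x :: b :: A))) (0, 0) =
   vadd (w (hull (x :: vscale (- k) x :: b' :: A))) (0, 0).
  apply: H.
  - by move=> r; rewrite mem_cat !inE => /orP[/hA//|/eqP->]; exact: hA.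
  - by move=> r; rewrite !inE => /orP[]/eqP->.
  - move=> r r'; rewrite mem_cat !inE => /orP[rA|/eqP->] /orP[]/eqP->;
      by [exact: cb|exact: cb'].
  - exact: i.
  - exact: i.
  - by apply: (i b [:: a]); rewrite ?mem_head.
  - by apply: (i b' [:: a]); rewrite ?mem_head.
by rewrite !addr0 => e1 e2; exact: pt_eq.
Qed.

Lemma small_pos s (f g : pt -> R) : (forall q, q \in s -> 0 < f q) ->
  exists2 e, 0 < e & forall t, 0 < t -> t < e -> forall q, q \in s -> t * g q <= f q.
Proof.
elim: s => [|p s IH] fpos; first by exists 1.
have [|e e0 he] := IH; first by move=> q qs; apply: fpos; rewrite inE qs orbT.
have fp : 0 < f p by apply: fpos; rewrite mem_head.
have g0 : 0 < `|g p| + 1 by rewrite ltr_wpDl.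
exists (Num.min e (f p / (`|g p| + 1))); first by rewrite lt_min e0 divr_gt0.
move=> t t0; rewrite lt_min => /andP[te]; rewrite ltr_pdivlMr// => tf q.
rewrite inE => /predU1P[->|]; last exact: he.
have := ler_norm (g p); nra.
Qed.

(** The segment from [a] to [b] stays in [C], so it cannot cross the line of [p] beyond the extreme
    point [p]. *)
Lemma radial_compat (C : set pt) p a b : cvx C -> C a -> C b ->
  0 <= det2 p a -> det2 p b <= 0 -> 0 < det2 p a - det2 p b ->
  (forall m : R, 1 < m -> ~ C (vscale m p)) ->
  - (det2 p a - det2 p b) <= det2 a b.
Proof.
move=> cC Ca Cb pa pb w0 maxp; rewrite leNgt; apply/negP => lt.
apply: (maxp (- det2 a b / (det2 p a - det2 p b))).
  by rewrite ltr_pdivlMr//; lra.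
have -> : vscale (- det2 a b / (det2 p a - det2 p b)) p =
    lin (det2 p a / (det2 p a - det2 p b)) a b.
  by move: w0; rewrite /det2 => w0; apply: pt_eq => /=; field; lra.
apply: cC => //; first by rewrite divr_ge0// ltW.
by rewrite ler_pdivrMr//; lra.
Qed.

(** If a longer multiple of [p] lay on a segment from [p] to a point y of the smaller hull, then [p]
    itself would lie between the origin and y. *)
Lemma not_redundant p s : s != [::] -> hull s (0, 0) -> ~ hull s p ->
  forall m : R, 1 < m -> ~ hull (p :: s) (vscale m p).
Proof.
move=> s0 s00 sp m m1 /hull_cons[]// t [y [t0 t1 hy e]]; apply: sp.
have d0 : 0 < m - 1 + t by lra.
have [tz|tN] := eqVneq t 0.
  have pz : p = (0, 0).
    have m10 : m - 1 != 0 by rewrite gt_eqF// subr_gt0.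
    have e' : vscale m p = p by rewrite e tz lin0.
    have e1 : m * p.1 = p.1 := congr1 fst e'.
    have e2 : m * p.2 = p.2 := congr1 snd e'.
    by apply: pt_eq => /=; apply: (mulfI m10); lra.
  by rewrite pz.
have -> : p = lin (t / (m - 1 + t)) (0, 0) y.
  have [e1 e2] : m * p.1 = (1 - t) * p.1 + t * y.1 /\ m * p.2 = (1 - t) * p.2 + t * y.2.
    by split; [exact: (congr1 fst e) | exact: (congr1 snd e)].
  apply: pt_eq => /=; apply: (mulfI (lt0r_neq0 d0)).
    by transitivity (t * y.1); [lra|field; lra].
  by transitivity (t * y.2); [lra|field; lra].
apply: hull_cvx => //; first by rewrite divr_ge0// ltW.
by rewrite ler_pdivrMr//; lra.
Qed.

Lemma hull_drop p s s' : hull s p -> s =i s' -> hull (p :: s) = hull s'.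
Proof.
move=> hp e; apply: hull_eq => q.
  rewrite inE => /predU1P[->|]; last by rewrite e; exact: hull_in.
  by rewrite -(eq_hull e).
by rewrite -e => qs; in_hull.
Qed.

Section Split.
Variables (x y p : pt) (L1 L2 : seq pt) (e e' : R).
Hypotheses (xy : 0 < det2 x y) (xp : 0 < det2 x p) (py : 0 < det2 p y).
Hypothesis h1 : forall q, q \in L1 -> [/\ 0 < det2 x q, 0 < det2 q p & 0 < det2 q y].
Hypothesis h2 : forall q, q \in L2 -> [/\ 0 < det2 x q, 0 < det2 p q & 0 < det2 q y].
Hypotheses (e0 : 0 < e) (e'0 : 0 < e').
Hypothesis pmax : forall m : R, 1 < m -> ~ hull ([:: (0, 0); x; y; p] ++ L1 ++ L2) (vscale m p).
Let k := e * e' * det2 x y / (e * det2 x p + e' * det2 p y).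
Hypothesis s1 : forall b, b \in L1 -> e * det2 x b <= det2 b p.
Hypothesis s2 : forall b, b \in p :: L2 -> e * det2 x b <= det2 b y.
Hypothesis s3 : forall a, a \in L2 -> e' * det2 a y <= det2 p a.
Hypothesis s4 : forall a, a \in p :: L1 -> e' * det2 a y <= det2 x a.
Hypothesis s5 : forall b, b \in L2 -> k * det2 p b <= det2 b y.
Hypothesis s6 : forall a, a \in L1 -> k * det2 a p <= det2 x a.
Hypothesis IH1 : w (hull (x :: p :: vscale (- e) x :: vscale (- k) p :: L1)) = (0, 0).
Hypothesis IH2 : w (hull (p :: y :: vscale (- k) p :: vscale (- e') y :: L2)) = (0, 0).

Let x' := vscale (- e) x.
Let y' := vscale (- e') y.
Let p' := vscale (- k) p.

Let d_gt0 : 0 < e * det2 x p + e' * det2 p y.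
Proof. by rewrite addr_gt0// mulr_gt0. Qed.

Let k_gt0 : 0 < k.
Proof. by rewrite divr_gt0// !mulr_gt0. Qed.

Let kE : k * (e * det2 x p + e' * det2 p y) = e * e' * det2 x y.
Proof. by rewrite divfK// gt_eqF. Qed.

Let pp' s : x' \in s -> y' \in s -> hull s p'.
Proof.
move=> hx hy; pose r := e * det2 x p / (e * det2 x p + e' * det2 p y).
have -> : p' = lin r x' y'.
  rewrite /p' /x' /y' /r /k; move: d_gt0; rewrite /det2 => d0.
  by apply: pt_eq => /=; field; lra.
have ep : 0 < e * det2 x p by rewrite mulr_gt0.
have e'p : 0 < e' * det2 p y by rewrite mulr_gt0.
apply: hull_cvx; [exact: hull_in|exact: hull_in| |].
  by rewrite divr_ge0// ltW.
by rewrite ler_pdivrMr// mul1r lerDl ltW.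
Qed.

Let pN (t : R) q : det2 p (vscale (- t) q) = t * det2 q p.
Proof. by rewrite det2Zr (det2C p q); ring. Qed.

Let right_left a b : a \in y :: L2 -> b \in x :: L1 -> det2 a b <= 0.
Proof.
move=> ha hb.
have [pa ay] : 0 < det2 p a /\ 0 <= det2 a y.
  move: ha; rewrite inE => /predU1P[->|/h2[_ ? /ltW//]]; by rewrite det2xx.
have [bp by_] : 0 < det2 b p /\ 0 < det2 b y.
  by move: hb; rewrite inE => /predU1P[->//|/h1[]].
have E : det2 a b * det2 p y = - (det2 b p * det2 a y + det2 b y * det2 p a).
  by rewrite /det2; ring.
rewrite leNgt; apply/negP => ab; have := mulr_gt0 ab py; rewrite E oppr_gt0 ltNge.
by rewrite addr_ge0// mulr_ge0// ltW.
Qed.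

(** The segment between the two caps crosses the line of [p] exactly at [p'], where one bound is an
    equality. Segments between vertices cross it no further than [p] because [p] is extreme on its
    ray. *)
Let split_compat a b : a \in x' :: y :: L2 -> b \in y' :: x :: L1 -> compat p k a b.
Proof.
have yx : det2 y x = - det2 x y by rewrite det2C.
have k0 := k_gt0.
rewrite inE => /predU1P[->|ha]; rewrite inE => /predU1P[->|hb].
- rewrite /compat !pN// det2Zl det2Zr (det2C y p).
  have -> : e * det2 x p - e' * - det2 p y = e * det2 x p + e' * det2 p y by ring.
  by rewrite kE; have := mulr_gt0 (mulr_gt0 e0 e'0) xy; have := d_gt0; split; lra.
- have [xb bp sb] : [/\ 0 <= det2 x b, 0 < det2 b p & e * det2 x b <= e * det2 x p + det2 b p].
    move: hb; rewrite inE => /predU1P[->|hb].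
      by rewrite det2xx; split => //; have := mulr_gt0 e0 xp; have := xp; lra.
    by have [xb bp _] := h1 hb; have := s1 hb; have := mulr_gt0 e0 xp; split => //; lra.
  rewrite /compat pN// det2Zl (det2C p b); split; first by lra.
  have := mulr_ge0 (ltW e0) xb; have := mulr_gt0 k0 (addr_gt0 (mulr_gt0 e0 xp) bp); lra.
- have [ay pa sa] : [/\ 0 <= det2 a y, 0 < det2 p a & e' * det2 a y <= e' * det2 p y + det2 p a].
    move: ha; rewrite inE => /predU1P[->|ha].
      by rewrite det2xx; split => //; have := mulr_gt0 e'0 py; have := py; lra.
    by have [_ pa ay] := h2 ha; have := s3 ha; have := mulr_gt0 e'0 py; split => //; lra.
  rewrite /compat pN// det2Zr (det2C y p); split; first by lra.
  have := mulr_ge0 (ltW e'0) ay; have := mulr_gt0 k0 (addr_gt0 (mulr_gt0 e'0 py) pa); lra.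
- have pa : 0 < det2 p a by move: ha; rewrite inE => /predU1P[->//|/h2[]].
  have pb : det2 p b < 0.
    by rewrite det2C oppr_lt0; move: hb; rewrite inE => /predU1P[->//|/h1[]].
  split.
    apply: (@radial_compat (hull ([:: (0, 0); x; y; p] ++ L1 ++ L2))) => //.
    + exact: hull_cvx.
    + by apply: hull_in; move: ha; rewrite !(inE, mem_cat) => /orP[] ->; rewrite ?orbT.
    + by apply: hull_in; move: hb; rewrite !(inE, mem_cat) => /orP[] ->; rewrite ?orbT.
    + exact: ltW.
    + exact: ltW.
    + lra.
  have ab := right_left ha hb; have d : 0 < det2 p a - det2 p b by lra.
  by apply: (le_trans ab); rewrite mulr_ge0// ltW.
Qed.

(** The cut along the line of [p] leaves two parts, each with a cap belonging to the other one. With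
    respect to the outer ray of its part this cap is alone on its side, so it may be swapped for
    [p'], which yields a smaller sector. *)
Lemma split_sector : w (hull (x :: y :: x' :: y' :: p :: L1 ++ L2)) = (0, 0).
Proof.
have k0 := k_gt0.
have px' : 0 < det2 p x' by rewrite pN// mulr_gt0.
have py' : det2 p y' < 0 by rewrite pN// (det2C y) mulrN oppr_lt0 mulr_gt0.
have hA a : a \in x' :: y :: L2 -> 0 < det2 p a.
  by rewrite !inE => /or3P[/eqP->//|/eqP->//|/h2[]].
have hB b : b \in y' :: x :: L1 -> det2 p b < 0.
  rewrite !inE => /or3P[/eqP->//|/eqP->|/h1[_ + _]]; by rewrite (det2C p) oppr_lt0.
have H := @mix_sub _ w p k (x' :: y :: L2) (y' :: x :: L1) [:: x'] [:: y'] val k0 isT isT.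
have {}H : vadd (w (hull (p :: p' :: (x' :: y :: L2) ++ y' :: x :: L1))) (w (hull (p :: p' :: [:: x'] ++ [:: y']))) =
  vadd (w (hull (p :: p' :: (x' :: y :: L2) ++ [:: y']))) (w (hull (p :: p' :: [:: x'] ++ y' :: x :: L1))).
  apply: H.
  - by move=> r; rewrite !inE => ->.
  - by move=> r; rewrite !inE => ->.
  - exact: hA.
  - exact: hB.
  - exact: split_compat.
  - exact: inn_diag.
have c0 : compat p k x' y' by apply: split_compat; rewrite mem_head.
have q0 : w (hull (p :: p' :: [:: x'] ++ [:: y'])) = (0, 0) by apply: quad0.
have a2 : w (hull (p :: p' :: (x' :: y :: L2) ++ [:: y'])) = (0, 0).
  have -> : hull (p :: p' :: (x' :: y :: L2) ++ [:: y']) = hull (y :: y' :: x' :: p :: L2).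
    have -> : hull (p :: p' :: (x' :: y :: L2) ++ [:: y']) = hull (p' :: p :: (x' :: y :: L2) ++ [:: y']).
      by apply: eq_hull => r; rewrite !inE orbCA.
    apply: hull_drop; first by apply: pp'; rewrite !(inE, mem_cat) eqxx ?orbT.
    move=> r; rewrite !(inE, mem_cat).
    by case: (r == p); case: (r == x'); case: (r == y); case: (r == y'); rewrite ?orbT ?orbF.
  rewrite (@swap_up y e' x' p' (p :: L2))//.
  - rewrite -IH2; congr w; apply: eq_hull => r; rewrite !inE -/y' -/p'.
    by case: (r == p); case: (r == p'); case: (r == y); case: (r == y').
  - by rewrite det2Zr (det2C y) mulrNN mulr_gt0.
  - by rewrite det2Zr (det2C y) mulrNN mulr_gt0.
  - by move=> b; rewrite inE (det2C y) oppr_lt0 => /predU1P[->//|/h2[]].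
  - move=> b hb; rewrite /compat det2Zr det2Zl (det2C y b) (det2C y x).
    have sb := s2 hb.
    have [xb by_] : 0 < det2 x b /\ 0 < det2 b y by move: hb; rewrite inE => /predU1P[->//|/h2[]].
    have := mulr_gt0 e0 xb; have := mulr_gt0 e0 xy.
    have := mulr_gt0 e'0 (addr_gt0 (mulr_gt0 e0 xy) by_).
    by split; lra.
  - move=> b hb; rewrite /compat det2Zr det2Zl (det2C y b) (det2C y p).
    have [pb by_ sb] : [/\ 0 <= det2 p b, 0 < det2 b y & k * det2 p b <= det2 b y].
      move: hb; rewrite inE => /predU1P[->|hb]; first by rewrite det2xx mulr0; split => //; exact: ltW.
      by have [_ /ltW ? ?] := h2 hb; have := s5 hb.
    have := mulr_ge0 (ltW k0) pb; have := mulr_gt0 k0 py.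
    have := mulr_gt0 e'0 (addr_gt0 (mulr_gt0 k0 py) by_).
    by split; lra.
have a1 : w (hull (p :: p' :: [:: x'] ++ y' :: x :: L1)) = (0, 0).
  have -> : hull (p :: p' :: [:: x'] ++ y' :: x :: L1) = hull (x :: x' :: y' :: p :: L1).
    have -> : hull (p :: p' :: [:: x'] ++ y' :: x :: L1) = hull (p' :: p :: [:: x'] ++ y' :: x :: L1).
      by apply: eq_hull => r; rewrite !inE orbCA.
    apply: hull_drop; first by apply: pp'; rewrite !(inE, mem_cat) eqxx ?orbT.
    move=> r; rewrite !(inE, mem_cat).
    by case: (r == p); case: (r == x'); case: (r == x); case: (r == y').
  rewrite (@swap_low x e y' p' (p :: L1))//.
  - rewrite -IH1; congr w; apply: eq_hull => r; rewrite !inE -/x' -/p'.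
    by case: (r == p); case: (r == p'); case: (r == x); case: (r == x').
  - by rewrite det2Zr mulNr oppr_lt0 mulr_gt0.
  - by rewrite det2Zr mulNr oppr_lt0 mulr_gt0.
  - by move=> b; rewrite inE => /predU1P[->//|/h1[]].
  - move=> a ha; rewrite /compat !det2Zr.
    have sa := s4 ha.
    have [xa ay] : 0 < det2 x a /\ 0 < det2 a y by move: ha; rewrite inE => /predU1P[->//|/h1[]].
    have := mulr_gt0 e'0 ay; have := mulr_gt0 e'0 xy.
    have := mulr_gt0 e0 (addr_gt0 (mulr_gt0 e'0 xy) xa).
    by split; lra.
  - move=> a ha; rewrite /compat !det2Zr.
    have [ap xa sa] : [/\ 0 <= det2 a p, 0 < det2 x a & k * det2 a p <= det2 x a].
      move: ha; rewrite inE => /predU1P[->|ha]; first by rewrite det2xx mulr0; split => //; exact: ltW.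
      by have [? /ltW ? _] := h1 ha; have := s6 ha.
    have := mulr_ge0 (ltW k0) ap; have := mulr_gt0 k0 xp.
    have := mulr_gt0 e0 (addr_gt0 (mulr_gt0 k0 xp) xa).
    by split; lra.
move: H; rewrite q0 a1 a2.
have -> : hull (p :: p' :: (x' :: y :: L2) ++ y' :: x :: L1) =
  hull (x :: y :: x' :: y' :: p :: L1 ++ L2).
  have -> : hull (p :: p' :: (x' :: y :: L2) ++ y' :: x :: L1) =
    hull (p' :: p :: (x' :: y :: L2) ++ y' :: x :: L1).
    by apply: eq_hull => r; rewrite !inE orbCA.
  apply: hull_drop; first by apply: pp'; rewrite !(inE, mem_cat) eqxx ?orbT.
  move=> r; rewrite !(inE, mem_cat).
  case: (r == p); case: (r == x'); case: (r == x); case: (r == y'); case: (r == y);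
    by rewrite ?orbT ?orbF //= orbC.
by rewrite /vadd /= !addr0 => -[z1 z2]; exact: pt_eq.
Qed.

End Split.
End Sector.

(** * Compactness of hulls and extreme points on rays *)

Section Compactness.
Import numFieldNormedType.Exports.
Variable R : realType.
Notation pt := (R * R)%type.
Implicit Types (p q : pt) (s : seq pt).

Lemma hull1 p : hull [:: p] = [set p].
Proof.
apply/seteqP; split; last by move=> _ ->; apply: hull_in; rewrite mem_head.
apply: hull_min => [x y t -> -> _ _|q]; last by rewrite inE => /eqP.
by apply: pt_eq => /=; ring.
Qed.

Lemma continuous_pair_fun (T : topologicalType) (f g : T -> R) :
  continuous f -> continuous g -> continuous (fun t => (f t, g t) : pt).
Proof. by move=> cf cg t; exact: (cvg_pair (cf t) (cg t)). Qed.

Lemma continuous_lin p : continuous (fun u : R * pt => lin u.1 p u.2).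
Proof.
have c1 : continuous (fun u : R * pt => u.1) by move=> u; exact: cvg_fst.
have c2 : continuous (fun u : R * pt => u.2.1).
  by move=> u; apply: (@continuous_comp _ _ _ snd fst u); [exact: cvg_snd|exact: cvg_fst].
have c3 : continuous (fun u : R * pt => u.2.2).
  by move=> u; apply: (@continuous_comp _ _ _ snd snd u); [exact: cvg_snd|exact: cvg_snd].
apply: (@continuous_pair_fun _ (fun u : R * pt => (1 - u.1) * p.1 + u.1 * u.2.1)
  (fun u : R * pt => (1 - u.1) * p.2 + u.1 * u.2.2)) => u.
  exact: (cvgD (cvgM (cvgB (cvg_cst _) (c1 u)) (cvg_cst _)) (cvgM (c1 u) (c2 u))).
exact: (cvgD (cvgM (cvgB (cvg_cst _) (c1 u)) (cvg_cst _)) (cvgM (c1 u) (c3 u))).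
Qed.

Lemma hull_compact s : s != [::] -> compact (hull s : set pt).
Proof.
elim: s => // p [|q s] IH _; first by rewrite hull1; exact: compact_set1.
have -> : hull [:: p, q & s] = (fun u : R * pt => lin u.1 p u.2) @` (`[0, 1]%classic `*` hull (q :: s)).
  apply/seteqP; split.
    move=> x /hull_cons[]// t [y [t0 t1 hy ->]]; exists (t, y) => //.
    by split => //=; rewrite in_itv /= t0.
  move=> _ [[t y] [/= /[!in_itv]/= /andP[t0 t1] hy] <-]; apply: hull_cvx => //.
    by apply: hull_in; rewrite mem_head.
  by apply: hull_subset hy => r rs; rewrite inE rs orbT.
apply: continuous_compact.
  by apply: continuous_subspaceT; exact: continuous_lin.
apply: compact_setX; first exact: segment_compact.
exact: IH.
Qed.

Lemma hull_closed s : s != [::] -> closed (hull s : set pt).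
Proof.
move=> s0; apply: compact_closed; last exact: hull_compact.
exact: norm_hausdorff.
Qed.

Lemma hull_bounded s : exists2 M : R, 0 < M & forall x, hull s x -> `|x.1| <= M /\ `|x.2| <= M.
Proof.
elim: s => [|p s [M M0 hM]].
  by exists 1 => // x /(_ set0) [].
exists (M + `|p.1| + `|p.2|); first by rewrite ltr_pwDl// ltr_wpDr.
have [->|s0] := eqVneq s [::].
  rewrite hull1 => x ->; have := normr_ge0 p.1; have := normr_ge0 p.2; split; lra.
move=> x /hull_cons[]// t [y [t0 t1 /hM[y1 y2] ->]] /=.
have t1' : 0 <= 1 - t by lra.
have E (a b : R) : `|b| <= M -> `|(1 - t) * a + t * b| <= M + `|a|.
  move=> bM; apply: (le_trans (ler_normD _ _)); rewrite !normrM (ger0_norm t0) (ger0_norm t1').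
  by have := normr_ge0 a; have := normr_ge0 b; nra.
split; first by apply: (le_trans (E _ _ y1)); rewrite lerDl.
by apply: (le_trans (E _ _ y2)); rewrite addrAC lerDl.
Qed.

Lemma radial_max s d : inn s -> d != (0, 0) ->
  exists2 m : R, 0 < m & hull s (vscale m d) /\ forall m', m < m' -> ~ hull s (vscale m' d).
Proof.
move=> i d0; pose T := [set m : R | hull s (vscale m d)].
have cvx_ray : continuous (fun m : R => vscale m d : pt).
  move=> u; exact: (cvg_pair (cvgM cvg_id (cvg_cst _)) (cvgM cvg_id (cvg_cst _))).
have cT : closed T.
  apply: (@preimage_closed _ _ (fun m : R => vscale m d) (hull s)); last by apply: hull_closed; exact: inn_neq0.
  by move=> u _; exact: cvx_ray.
have T0 : T 0.
  rewrite /T /mkset; have -> : vscale 0 d = (0, 0) by apply: pt_eq => /=; ring.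
  exact: inn_in.
have [M M0 hM] := hull_bounded s.
have nd : 0 < `|d.1| + `|d.2|.
  rewrite lt_neqAle addr_ge0// andbT eq_sym paddr_eq0// !normr_eq0.
  by apply: contraNN d0 => /andP[/eqP a /eqP b]; apply/eqP; exact: pt_eq.
have Tb m : T m -> m <= 2 * M / (`|d.1| + `|d.2|).
  move=> /hM [/= b1 b2]; rewrite ler_pdivlMr//.
  apply: (le_trans (ler_norm _)); rewrite normrM (ger0_norm (ltW nd)).
  by move: b1 b2; rewrite !normrM; lra.
have bT : has_sup T.
  by split; [exists 0|exists (2 * M / (`|d.1| + `|d.2|)) => m /Tb].
have Ts : T (sup T).
  have := closure_sup (ex_intro _ 0 T0 : T !=set0) (proj2 bT).
  by rewrite -(closure_id T).1.
have [e [e0 he]] := i.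
exists (sup T); last first.
  split => // m' lt hm; move: lt; rewrite ltNge => /negP; apply.
  by apply: ub_le_sup => //; exact: (proj2 bT).
(* A positive multiple of [d] that still lies in the ball around the origin, which makes the
   supremum positive. *)
pose r := e / (2 * (`|d.1| + `|d.2|)).
have r0 : 0 < r by rewrite divr_gt0// mulr_gt0.
apply: (lt_le_trans r0); apply: ub_le_sup; first exact: (proj2 bT).
rewrite /T /mkset; apply: he; rewrite /Defs.edist /= !sub0r !sqrrN.
apply: (@le_lt_trans _ _ (r * (`|d.1| + `|d.2|))); last first.
  by rewrite /r invfM mulrA divfK ?gt_eqF//; lra.
have a1 := normr_ge0 d.1; have a2 := normr_ge0 d.2.
have B0 : 0 <= r * (`|d.1| + `|d.2|) by rewrite mulr_ge0 ?addr_ge0// ltW.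
rewrite -[leRHS](ger0_norm B0) -sqrtr_sqr ler_wsqrtr//.
have n1 : d.1 ^+ 2 = `|d.1| ^+ 2 by rewrite real_normK ?num_real.
have n2 : d.2 ^+ 2 = `|d.2| ^+ 2 by rewrite real_normK ?num_real.
move: r r0 B0 => r r0 B0; rewrite !exprMn n1 n2 -subr_ge0.
have -> : r ^+ 2 * (`|d.1| + `|d.2|) ^+ 2 - (r ^+ 2 * `|d.1| ^+ 2 + r ^+ 2 * `|d.2| ^+ 2) =
  2 * (r ^+ 2 * (`|d.1| * `|d.2|)) by ring.
by rewrite mulr_ge0// mulr_ge0 ?sqr_ge0// mulr_ge0.
Qed.

End Compactness.

(** * From quadrilaterals to sectors, half planes and polygons *)

Section Vanishing.
Variable R : realType.
Notation pt := (R * R)%type.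
Implicit Types (x y p q a b : pt) (s L : seq pt) (k e : R).
Variable w : set pt -> pt.
Hypothesis val : valuation_on_Po w.
Hypothesis quad0 : forall x k p q, 0 < k -> 0 < det2 x p -> det2 x q < 0 ->
  compat x k p q -> w (hull [:: x; vscale (- k) x; p; q]) = (0, 0).

Lemma hull_ray s x k (m : R) : 0 < k -> x \in s -> vscale (- k) x \in s -> - k <= m -> m <= 1 ->
  hull s (vscale m x).
Proof.
move=> k0 xs x's m1 m2; have := @diag_pt _ x k k0 m m1 m2; apply: hull_subset.
by move=> r; rewrite !inE => /orP[] /eqP->.
Qed.

Lemma hull_origin s x k : 0 < k -> x \in s -> vscale (- k) x \in s -> hull s (0, 0).
Proof.
move=> k0 xs x's; have -> : (0, 0) = vscale 0 x by apply: pt_eq => /=; ring.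
by apply: (hull_ray k0) => //; lra.
Qed.

Lemma hull_segment0 s x (m : R) : hull s (0, 0) -> hull s x -> 0 <= m -> m <= 1 ->
  hull s (vscale m x).
Proof.
move=> h0 hx m0 m1; have -> : vscale m x = lin m (0, 0) x by apply: pt_eq => /=; ring.
exact: hull_cvx.
Qed.

(** The claim holds for all small caps at once because splitting at a vertex creates a cap of a new
    size, which must fit the thresholds of both subsectors. Without inner vertices the hull is a
    quadrilateral with diagonal along [x]. *)
Lemma sector_zero n x y L : (size L <= n)%N -> 0 < det2 x y ->
  (forall q, q \in L -> 0 < det2 x q /\ 0 < det2 q y) ->
  exists2 e0, 0 < e0 & forall e e', 0 < e -> e < e0 -> 0 < e' -> e' < e0 ->
    w (hull (x :: y :: vscale (- e) x :: vscale (- e') y :: L)) = (0, 0).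
Proof.
elim: n x y L => [|n IH] x y [|p L'] //= sz xy hL; try (
  exists 1 => // e e' e0 _ e'0 _; rewrite -(@quad0 x e y (vscale (- e') y));
  [by congr w; apply: eq_hull => r; rewrite !inE;
     case: (r == x); case: (r == y); case: (r == vscale (- e) x)
  |by []|by []|by rewrite det2Zr mulNr oppr_lt0 mulr_gt0
  |by rewrite /compat !det2Zr det2xx; have := mulr_gt0 e'0 xy;
     have := mulr_gt0 e0 (addr_gt0 xy (mulr_gt0 e'0 xy)); split; lra]).
have [xp py] := hL p (mem_head _ _).
have hL' q : q \in L' -> 0 < det2 x q /\ 0 < det2 q y.
  by move=> qL; apply: hL; rewrite inE qL orbT.
have [red|nred] := pselect (hull ((0, 0) :: x :: y :: L') p).
  have [e0 e00 he] := IH x y L' sz xy hL'; exists e0 => // e e' e1 e2 e'1 e'2.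
  rewrite -(he e e' e1 e2 e'1 e'2); congr w.
  have -> : hull (x :: y :: vscale (- e) x :: vscale (- e') y :: p :: L') =
     hull (p :: x :: y :: vscale (- e) x :: vscale (- e') y :: L').
    apply: eq_hull => r; rewrite !inE.
    by case: (r == x); case: (r == y); case: (r == p); case: (r == vscale (- e) x); rewrite ?orbT.
  apply: hull_drop => //; move: p red {xp py hL sz}; apply: hull_sub => p.
  rewrite !inE => /or4P[/eqP->|/eqP->|/eqP->|pL'].
  - by apply: (hull_origin e1 (x := x)); rewrite !inE eqxx ?orbT.
  - by in_hull.
  - by in_hull.
  - by in_hull.
have pmax0 : forall m : R, 1 < m -> ~ hull (p :: (0, 0) :: x :: y :: L') (vscale m p).
  by apply: not_redundant => //; apply: hull_in; rewrite mem_head.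
pose L1 := [seq q <- L' | 0 < det2 q p]; pose L2 := [seq q <- L' | 0 < det2 p q].
have h1 q : q \in L1 -> [/\ 0 < det2 x q, 0 < det2 q p & 0 < det2 q y].
  by rewrite mem_filter => /andP[? /hL'[]].
have h2 q : q \in L2 -> [/\ 0 < det2 x q, 0 < det2 p q & 0 < det2 q y].
  by rewrite mem_filter => /andP[? /hL'[]].
have pmax (m : R) : 1 < m -> ~ hull ([:: (0, 0); x; y; p] ++ L1 ++ L2) (vscale m p).
  move=> m1 hm; apply: (pmax0 m m1); apply: hull_subset hm => r.
  rewrite !(inE, mem_cat, mem_filter) => /or4P[->|->|->|]; rewrite ?orbT// => /or3P[->//||] /andP[_ ->];
    by rewrite ?orbT.
have sz1 : (size L1 <= n)%N by rewrite size_filter (leq_trans (count_size _ _)).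
have sz2 : (size L2 <= n)%N by rewrite size_filter (leq_trans (count_size _ _)).
have [e1 e10 IH1] : exists2 e0, 0 < e0 & forall e e', 0 < e -> e < e0 -> 0 < e' -> e' < e0 ->
    w (hull (x :: p :: vscale (- e) x :: vscale (- e') p :: L1)) = (0, 0).
  by apply: IH => // q /h1[].
have [e2 e20 IH2] : exists2 e0, 0 < e0 & forall e e', 0 < e -> e < e0 -> 0 < e' -> e' < e0 ->
    w (hull (p :: y :: vscale (- e) p :: vscale (- e') y :: L2)) = (0, 0).
  by apply: IH => // q /h2[].
have [a1 a10 s1] : exists2 e, 0 < e & forall t, 0 < t -> t < e -> forall q, q \in L1 -> t * det2 x q <= det2 q p.
  by apply: (@small_pos _ _ (fun q => det2 q p) (fun q => det2 x q)) => q /h1[].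
have [a2 a20 s2] : exists2 e, 0 < e & forall t, 0 < t -> t < e -> forall q, q \in p :: L2 -> t * det2 x q <= det2 q y.
  by apply: (@small_pos _ _ (fun q => det2 q y) (fun q => det2 x q)) => q; rewrite inE => /predU1P[->//|/h2[]].
have [a3 a30 s3] : exists2 e, 0 < e & forall t, 0 < t -> t < e -> forall q, q \in L2 -> t * det2 q y <= det2 p q.
  by apply: (@small_pos _ _ (fun q => det2 p q) (fun q => det2 q y)) => q /h2[].
have [a4 a40 s4] : exists2 e, 0 < e & forall t, 0 < t -> t < e -> forall q, q \in p :: L1 -> t * det2 q y <= det2 x q.
  by apply: (@small_pos _ _ (fun q => det2 x q) (fun q => det2 q y)) => q; rewrite inE => /predU1P[->//|/h1[]].
have [a5 a50 s5] : exists2 e, 0 < e & forall t, 0 < t -> t < e -> forall q, q \in L2 -> t * det2 p q <= det2 q y.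
  by apply: (@small_pos _ _ (fun q => det2 q y) (fun q => det2 p q)) => q /h2[].
have [a6 a60 s6] : exists2 e, 0 < e & forall t, 0 < t -> t < e -> forall q, q \in L1 -> t * det2 q p <= det2 x q.
  by apply: (@small_pos _ _ (fun q => det2 x q) (fun q => det2 q p)) => q /h1[].
pose c := Num.min (Num.min e1 e2) (Num.min a5 a6).
have c0 : 0 < c by rewrite !lt_min e10 e20 a50 a60.
(* The new cap has size k below e det2 x y / det2 p y, so the last bound ensures k < c. *)
pose e0 := Num.min (Num.min (Num.min e1 e2) (Num.min a1 a2)) (Num.min (Num.min a3 a4) (c * det2 p y / det2 x y)).
exists e0.
  by rewrite !lt_min e10 e20 a10 a20 a30 a40 divr_gt0// mulr_gt0.
move=> e e' eg0; rewrite !lt_min => /andP[/andP[/andP[ee1 _] /andP[ea1 ea2]] /andP[_ eb]] e'g0.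
move=> /andP[/andP[/andP[_ e'e2] _] /andP[/andP[e'a3 e'a4] _]].
pose k := e * e' * det2 x y / (e * det2 x p + e' * det2 p y).
have d0 : 0 < e * det2 x p + e' * det2 p y by rewrite addr_gt0// mulr_gt0.
have k0 : 0 < k by rewrite divr_gt0// !mulr_gt0.
have kc : k < c.
  rewrite ltr_pdivrMr//; move: eb; rewrite ltr_pdivlMr// => eb.
  have := mulr_gt0 c0 (mulr_gt0 eg0 xp); have : e * det2 x y * e' < c * det2 p y * e' by rewrite ltr_pM2r.
  lra.
move: (kc); rewrite !lt_min => /andP[/andP[ke1 ke2] /andP[ka5 ka6]].
have H := @split_sector R w val quad0 x y p L1 L2 e e' xy xp py h1 h2 eg0 e'g0 pmax.
rewrite -H //; last first.
- exact: IH2.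
- exact: IH1.
- exact: s6.
- exact: s5.
- exact: s4.
- exact: s3.
- exact: s2.
- exact: s1.
congr w; apply: hull_eq => r; rewrite !(inE, mem_cat, mem_filter).
  move=> /or4P[/eqP->|/eqP->|/eqP->|/or3P[/eqP->|/eqP->|rL]]; try by in_hull.
  have [rp|rp|rp] := ltrgtP (det2 p r) 0.
  - apply: hull_in; rewrite !(inE, mem_cat, mem_filter) rL.
    have -> : 0 < det2 r p by rewrite det2C oppr_gt0.
    by rewrite !orbT.
  - by apply: hull_in; rewrite !(inE, mem_cat, mem_filter) rL rp !orbT.
  (* A vertex on the ray of [p] belongs to neither list. Since [p] is not redundant, it lies between
     the origin and [p] and may be dropped. *)
  have [xr ry] := hL' r rL.
  have rE := @x_colinear _ p r y rp (lt0r_neq0 py).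
  have m0 : 0 < det2 r y / det2 p y by rewrite divr_gt0.
  rewrite rE; apply: hull_segment0.
  + by apply: (hull_origin eg0 (x := x)); rewrite !inE eqxx ?orbT.
  + by in_hull.
  + exact: ltW.
  + rewrite leNgt; apply/negP => m1; apply: (pmax0 _ m1); rewrite -rE.
    by in_hull.
move=> /or4P[/eqP->|/eqP->|/eqP->|/or4P[/eqP->|/eqP->|/andP[_ rL]|/andP[_ rL]]];
  by in_hull.
Qed.

(** A half plane is not a sector in the sense of [sector_zero], as the determinant of its boundary
    rays vanishes; it is therefore cut once more, along the line of the extreme point [y]. *)
Lemma half_zero x k y L : 0 < k -> 0 < det2 x y -> (forall q, q \in L -> 0 < det2 x q) ->
  (forall m : R, 1 < m -> ~ hull (x :: vscale (- k) x :: y :: L) (vscale m y)) ->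
  exists2 d0, 0 < d0 & forall d, 0 < d -> d < d0 ->
    w (hull (x :: vscale (- k) x :: y :: rcons L (vscale (- d) y))) = (0, 0).
Proof.
move=> k0 xy hL ymax; set x' := vscale (- k) x in ymax *.
have yx' : det2 y x' = k * det2 x y by rewrite det2Zr (det2C y); ring.
pose AL := [seq q <- L | 0 < det2 y q]; pose AR := [seq q <- L | det2 y q < 0].
have hAL q : q \in AL -> 0 < det2 x q /\ 0 < det2 y q.
  by rewrite mem_filter => /andP[? /hL].
have hAR q : q \in AR -> 0 < det2 x q /\ det2 y q < 0.
  by rewrite mem_filter => /andP[? /hL].
have [d1 d10 H1] : exists2 e0, 0 < e0 & forall e e', 0 < e -> e < e0 -> 0 < e' -> e' < e0 ->
    w (hull (y :: x' :: vscale (- e) y :: vscale (- e') x' :: AL)) = (0, 0).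
  apply: (@sector_zero (size AL)) => //; first by rewrite yx' mulr_gt0.
  move=> q /hAL[xq yq]; split=> //; rewrite det2Zr (det2C q) mulrNN mulr_gt0//.
have [d2 d20 H2] : exists2 e0, 0 < e0 & forall e e', 0 < e -> e < e0 -> 0 < e' -> e' < e0 ->
    w (hull (x :: y :: vscale (- e) x :: vscale (- e') y :: AR)) = (0, 0).
  apply: (@sector_zero (size AR)) => // q /hAR[xq yq]; split=> //.
  by rewrite det2C oppr_gt0.
(* The bounds by k and its inverse keep the caps [u] and [v] on the segment from [x'] to [x]. *)
pose c := Num.min (Num.min d1 d2) (Num.min k k^-1).
have ki0 : 0 < k^-1 by rewrite invr_gt0.
have c0 : 0 < c by rewrite !lt_min d10 d20 k0 ki0.
exists c => // d dg0; rewrite !lt_min => /andP[/andP[dd1 dd2] _].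
pose e := c / 2.
have eg0 : 0 < e by rewrite divr_gt0.
have ec : e < c by rewrite /e; lra.
move: (ec); rewrite !lt_min => /andP[/andP[ed1 ed2] /andP[ek eki]].
pose u := vscale (- e) x; pose v := vscale (- e) x'.
have vE : v = vscale (e * k) x by apply: pt_eq => /=; ring.
have ek1 : e * k < 1 by move: eki; rewrite -div1r ltr_pdivlMr.
have ek0 : 0 < e * k by rewrite mulr_gt0.
pose y' := vscale (- d) y.
have yu : 0 < det2 y u by rewrite det2Zr (det2C y) mulrNN mulr_gt0.
have yv : det2 y v < 0 by rewrite det2Zr yx' mulNr oppr_lt0 !mulr_gt0.
pose C := hull (x :: x' :: y :: L).
have CL q : q \in L -> C q by move=> qL; in_hull.
have Cx : C x by in_hull.
have Cx' : C x' by in_hull.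
have Cu : C u.
  by apply: (hull_ray k0); [in_list|in_list|rewrite lerN2 ltW|move: eg0; clear; lra].
have Cv : C v.
  by rewrite vE; apply: (hull_ray k0); [in_list|in_list|move: k0 ek0; clear; lra|exact: ltW].
have hA a : a \in u :: x' :: AL -> [/\ C a, 0 < det2 y a & 0 <= det2 x a].
  rewrite !inE => /or3P[/eqP->|/eqP->|aL].
  - by split => //; rewrite det2Zr det2xx mulr0.
  - by split => //; [rewrite yx' mulr_gt0|rewrite det2Zr det2xx mulr0].
  - have [? ?] := hAL a aL; split => //; last exact: ltW.
    by apply: CL; move: aL; rewrite mem_filter => /andP[].
have hB b : b \in v :: x :: AR -> [/\ C b, det2 y b < 0 & 0 <= det2 x b].
  rewrite !inE => /or3P[/eqP->|/eqP->|bL].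
  - by split => //; rewrite vE det2Zr det2xx mulr0.
  - by split => //; [rewrite det2C oppr_lt0|rewrite det2xx].
  - have [? ?] := hAR b bL; split => //; last exact: ltW.
    by apply: CL; move: bL; rewrite mem_filter => /andP[].
have cAB a b : a \in u :: x' :: AL -> b \in v :: x :: AR -> compat y d a b.
  move=> /hA[Ca ya xa] /hB[Cb yb xb].
  have W : 0 < det2 y a - det2 y b by rewrite subr_gt0 (lt_trans yb).
  split; first by apply: (radial_compat (@hull_cvx _ (x :: x' :: y :: L)) Ca Cb (ltW ya) (ltW yb) W).
  have E : det2 a b * det2 x y = - (det2 x a * - det2 y b + det2 y a * det2 x b).
    by rewrite /det2; ring.
  have ab : det2 a b <= 0.
    rewrite leNgt; apply/negP => ab; have := mulr_gt0 ab xy; rewrite E oppr_gt0 ltNge.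
    by rewrite addr_ge0// mulr_ge0// ?oppr_ge0 ltW.
  by apply: (le_trans ab); rewrite mulr_ge0// ltW.
have M := @mix_sub _ w y d (u :: x' :: AL) (v :: x :: AR) [:: u] [:: v] val dg0 isT isT.
have {}M : vadd (w (hull (y :: y' :: (u :: x' :: AL) ++ v :: x :: AR))) (w (hull (y :: y' :: [:: u] ++ [:: v]))) =
  vadd (w (hull (y :: y' :: (u :: x' :: AL) ++ [:: v]))) (w (hull (y :: y' :: [:: u] ++ v :: x :: AR))).
  apply: M.
  - by move=> r; rewrite !inE => ->.
  - by move=> r; rewrite !inE => ->.
  - by move=> a /hA[].
  - by move=> b /hB[].
  - exact: cAB.
  - exact: inn_diag.
have q0 : w (hull (y :: y' :: [:: u] ++ [:: v])) = (0, 0).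
  by apply: quad0 => //; apply: cAB; rewrite mem_head.
have z1 : w (hull (y :: y' :: (u :: x' :: AL) ++ [:: v])) = (0, 0).
  rewrite -(H1 d e)//; congr w; apply: hull_eq => r; rewrite !(inE, mem_cat) -/v -/y'.
    move=> /or4P[/eqP->|/eqP->|/eqP->|/or3P[/eqP->|rL|/eqP->]];
      try by in_hull.
    have -> : u = vscale (e / k) x' by apply: pt_eq => /=; field; rewrite gt_eqF.
    have h1 : 0 < e / k by exact: divr_gt0.
    have h2 : e / k <= 1 by rewrite ler_pdivrMr// mul1r ltW.
    by apply: (hull_ray eg0); [in_list|in_list|move: eg0 h1; clear; lra|].
  move=> /or4P[/eqP->|/eqP->|/eqP->|/orP[/eqP->|rL]];
    by in_hull.
have z2 : w (hull (y :: y' :: [:: u] ++ v :: x :: AR)) = (0, 0).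
  rewrite -(H2 e d)//; congr w; apply: hull_eq => r; rewrite !(inE, mem_cat) -/u -/y'.
    move=> /or4P[/eqP->|/eqP->|/eqP->|/or3P[/eqP->|/eqP->|rL]];
      try by in_hull.
    by rewrite vE; apply: (hull_ray eg0); [in_list|in_list|move: eg0 ek0; clear; lra|exact: ltW].
  move=> /or4P[/eqP->|/eqP->|/eqP->|/orP[/eqP->|rL]];
    by in_hull.
move: M; rewrite q0 z1 z2.
have -> : hull (y :: y' :: (u :: x' :: AL) ++ v :: x :: AR) =
    hull (x :: x' :: y :: rcons L y').
  apply: hull_eq => r; rewrite !(inE, mem_cat, mem_rcons).
    move=> /or4P[/eqP->|/eqP->|/eqP->|/orP[/eqP->|/or4P[|/eqP->|/eqP->|]]];
      rewrite ?mem_filter; try by apply: hull_in; rewrite !(inE, mem_rcons) ?eqxx ?orbT.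
    - by apply: (hull_ray k0); [in_list|in_list|rewrite lerN2 ltW|move: eg0; clear; lra].
    - by move=> /andP[_ rL]; apply: hull_in; rewrite !(inE, mem_rcons) rL !orbT.
    - by rewrite vE; apply: (hull_ray k0); [in_list|in_list|move: k0 ek0; clear; lra|exact: ltW].
    - by move=> /andP[_ rL]; apply: hull_in; rewrite !(inE, mem_rcons) rL !orbT.
  move=> /or4P[/eqP->|/eqP->|/eqP->|/orP[/eqP->|rL]];
    try by in_hull.
  have [yr|yr|yr] := ltrgtP (det2 y r) 0.
  - by apply: hull_in; rewrite !(inE, mem_cat, mem_filter) rL yr ?orbT.
  - by apply: hull_in; rewrite !(inE, mem_cat, mem_filter) rL yr ?orbT.
  have yx0 : det2 y x != 0 by rewrite det2C oppr_eq0 gt_eqF.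
  have rE := @x_colinear _ y r x yr yx0.
  have m0 : 0 < det2 r x / det2 y x.
    by rewrite (det2C r) (det2C y) invrN mulrNN divr_gt0// hL.
  rewrite rE; apply: (hull_ray dg0); [in_list|in_list|move: dg0 m0; clear; lra|].
  rewrite leNgt; apply/negP => m1; apply: (ymax _ m1); rewrite -rE; exact: CL.
by rewrite /vadd /= !addr0 => -[e1 e2]; exact: pt_eq.
Qed.

Lemma polygon_zero P : polygon_o P -> w P = (0, 0).
Proof.
move=> /polygonP[S -> iS].
have ne (a b : R) : a != 0 \/ b != 0 -> ((a, b) : pt) != (0, 0).
  by move=> h; apply/eqP => -[a0 b0]; case: h; rewrite ?a0 ?b0 eqxx.
have [cx cx0 [Sx mx]] := @radial_max R S (1, 0) iS (ne _ _ (or_introl (oner_neq0 _))).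
have m10 : (-1 : R) != 0 by rewrite oppr_eq0 oner_neq0.
have [cx' cx'0 [Sx' mx']] := @radial_max R S (-1, 0) iS (ne _ _ (or_introl m10)).
have [cy cy0 [Sy my]] := @radial_max R S (0, 1) iS (ne _ _ (or_intror (oner_neq0 _))).
have [cy' cy'0 [Sy' my']] := @radial_max R S (0, -1) iS (ne _ _ (or_intror m10)).
pose x : pt := (cx, 0); pose k := cx' / cx; pose x' := vscale (- k) x.
pose y : pt := (0, cy); pose y' : pt := (0, - cy').
have k0 : 0 < k by rewrite divr_gt0.
have xE : x = vscale cx (1, 0) by apply: pt_eq => /=; ring.
have x'E : x' = vscale cx' (-1, 0) by apply: pt_eq => /=; rewrite /k; field; lra.
have yE : y = vscale cy (0, 1) by apply: pt_eq => /=; ring.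
have y'E : y' = vscale cy' (0, -1) by apply: pt_eq => /=; ring.
have scal (c m : R) d : vscale m (vscale c d) = vscale (m * c) d by apply: pt_eq => /=; ring.
have maxP (c : R) d : 0 < c -> (forall m, c < m -> ~ hull S (vscale m d)) ->
    forall m : R, 1 < m -> ~ hull S (vscale m (vscale c d)).
  by move=> c0 h m m1; rewrite scal; apply: h; rewrite ltr_pMl.
have xmax : forall m : R, 1 < m -> ~ hull S (vscale m x) by rewrite xE; exact: maxP.
have x'max : forall m : R, 1 < m -> ~ hull S (vscale m x') by rewrite x'E; exact: maxP.
have ymax : forall m : R, 1 < m -> ~ hull S (vscale m y) by rewrite yE; exact: maxP.
have y'max : forall m : R, 1 < m -> ~ hull S (vscale m y') by rewrite y'E; exact: maxP.
rewrite -xE -?x'E in Sx Sx'; rewrite -?yE -?y'E in Sy Sy'.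
have detx q : det2 x q = cx * q.2 by rewrite /det2 /=; ring.
have detx' q : det2 x' q = - (k * det2 x q) by rewrite det2Zl mulNr.
pose A := [seq q <- S | 0 < q.2]; pose B := [seq q <- S | q.2 < 0].
have hA q : q \in A -> 0 < det2 x q /\ hull S q.
  by rewrite mem_filter detx => /andP[q2 qS]; split; [exact: mulr_gt0|exact: hull_in].
have hB q : q \in B -> det2 x q < 0 /\ hull S q.
  by rewrite mem_filter detx => /andP[q2 qS]; split; [rewrite pmulr_rlt0|exact: hull_in].
have sub (s : seq pt) : (forall r, r \in s -> hull S r) -> hull s `<=` hull S by exact: hull_sub.
have ki : 0 < k^-1 by rewrite invr_gt0.
have x'x : vscale (- k^-1) x' = x by apply: pt_eq => /=; field; rewrite gt_eqF.
have xy : 0 < det2 x y by rewrite detx mulr_gt0.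
have xy' : det2 x y' < 0 by rewrite detx pmulr_rlt0// oppr_lt0.
have [d1 d10 H1] : exists2 d0, 0 < d0 & forall d, 0 < d -> d < d0 ->
    w (hull (x :: x' :: y :: rcons A (vscale (- d) y))) = (0, 0).
  apply: half_zero => // [q /hA[]//|m m1 hm]; apply: (ymax _ m1); apply: sub hm => r.
  by rewrite !inE => /or4P[/eqP->|/eqP->|/eqP->|/hA[]].
have [d2 d20 H2] : exists2 d0, 0 < d0 & forall d, 0 < d -> d < d0 ->
    w (hull (x' :: x :: y' :: rcons B (vscale (- d) y'))) = (0, 0).
  rewrite -x'x; apply: half_zero => //; rewrite ?x'x.
  - by rewrite detx' oppr_gt0 pmulr_rlt0.
  - by move=> q /hB[xq _]; rewrite detx' oppr_gt0 pmulr_rlt0.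
  - move=> m m1 hm; apply: (y'max _ m1); apply: sub hm => r.
    by rewrite !inE => /or4P[/eqP->|/eqP->|/eqP->|/hB[]].
(* The two ratios keep the caps opposite to [y] and [y'] inside the polygon, on the segments from
   the origin to [y'] and [y]. *)
pose c := Num.min (Num.min d1 d2) (Num.min (cy' / cy) (cy / cy')).
have c0 : 0 < c by rewrite !lt_min d10 d20 !divr_gt0.
pose d := c / 2.
have d0 : 0 < d by rewrite divr_gt0.
have : d < c by rewrite /d; lra.
rewrite !lt_min => /andP[/andP[dd1 dd2] /andP[dc dc']].
have {}dc : d * cy < cy' by rewrite -ltr_pdivlMr.
have {}dc' : d * cy' < cy by rewrite -ltr_pdivlMr.
pose n := vscale (- d) y; pose u := vscale (- d) y'.
have uE : u = vscale (d * cy' / cy) y by apply: pt_eq => /=; field; rewrite gt_eqF.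
have nE : n = vscale (d * cy / cy') y' by apply: pt_eq => /=; field; rewrite gt_eqF.
have u0 : 0 < d * cy' / cy by rewrite divr_gt0// mulr_gt0.
have n0 : 0 < d * cy / cy' by rewrite divr_gt0// mulr_gt0.
have u1 : d * cy' / cy <= 1 by rewrite ler_pdivrMr// mul1r ltW.
have n1 : d * cy / cy' <= 1 by rewrite ler_pdivrMr// mul1r ltW.
have S0 := inn_in iS.
have Su : hull S u by rewrite uE; apply: hull_segment0 => //; exact: ltW.
have Sn : hull S n by rewrite nE; apply: hull_segment0 => //; exact: ltW.
have xu : 0 < det2 x u by rewrite uE det2Zr mulr_gt0.
have xn : det2 x n < 0 by rewrite nE det2Zr pmulr_rlt0.
have hA' a : a \in u :: y :: A -> 0 < det2 x a /\ hull S a.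
  by rewrite !inE => /or3P[/eqP->|/eqP->|/hA].
have hB' b : b \in n :: y' :: B -> det2 x b < 0 /\ hull S b.
  by rewrite !inE => /or3P[/eqP->|/eqP->|/hB].
have cAB a b : a \in u :: y :: A -> b \in n :: y' :: B -> compat x k a b.
  move=> /hA'[xa Sa] /hB'[xb Sb].
  have W : 0 < det2 x a - det2 x b by rewrite subr_gt0 (lt_trans xb).
  split; first by apply: (radial_compat (@hull_cvx _ S) Sa Sb (ltW xa) (ltW xb) W).
  (* The second bound is the first one for the opposite ray, with a and b exchanged and [x'] as
     extreme point. *)
  have x'b : 0 <= det2 x' b by rewrite detx' oppr_ge0 ltW// pmulr_rlt0.
  have x'a : det2 x' a <= 0 by rewrite detx' oppr_le0 ltW// mulr_gt0.
  have W' : 0 < det2 x' b - det2 x' a.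
    by rewrite !detx' opprK addrC -mulrBr mulr_gt0.
  have := radial_compat (@hull_cvx _ S) Sb Sa x'b x'a W' x'max.
  by rewrite !detx' (det2C b); clear; lra.
have M := @mix_sub _ w x k (u :: y :: A) (n :: y' :: B) [:: u] [:: n] val k0 isT isT.
have {}M : vadd (w (hull (x :: x' :: (u :: y :: A) ++ n :: y' :: B))) (w (hull (x :: x' :: [:: u] ++ [:: n]))) =
  vadd (w (hull (x :: x' :: (u :: y :: A) ++ [:: n]))) (w (hull (x :: x' :: [:: u] ++ n :: y' :: B))).
  apply: M.
  - by move=> r; rewrite !inE => ->.
  - by move=> r; rewrite !inE => ->.
  - by move=> a /hA'[].
  - by move=> b /hB'[].
  - exact: cAB.
  - exact: inn_diag.
have q0 : w (hull (x :: x' :: [:: u] ++ [:: n])) = (0, 0).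
  by apply: quad0 => //; apply: cAB; rewrite mem_head.
have z1 : w (hull (x :: x' :: (u :: y :: A) ++ [:: n])) = (0, 0).
  rewrite -(H1 d)//; congr w; apply: hull_eq => r; rewrite !(inE, mem_cat, mem_rcons) -/n.
    move=> /or4P[/eqP->|/eqP->|/eqP->|/or3P[/eqP->|rL|/eqP->]];
      try by apply: hull_in; rewrite !(inE, mem_rcons) ?eqxx ?rL ?orbT.
    by rewrite uE; apply: (hull_ray d0); rewrite ?(inE, mem_rcons) ?eqxx ?orbT//; move: d0 u0; clear; lra.
  move=> /or4P[/eqP->|/eqP->|/eqP->|/orP[/eqP->|rL]];
    by in_hull.
have z2 : w (hull (x :: x' :: [:: u] ++ n :: y' :: B)) = (0, 0).
  rewrite -(H2 d)//; congr w; apply: hull_eq => r; rewrite !(inE, mem_cat, mem_rcons) -/u.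
    move=> /or4P[/eqP->|/eqP->|/eqP->|/or3P[/eqP->|/eqP->|rL]];
      try by apply: hull_in; rewrite !(inE, mem_rcons) ?eqxx ?rL ?orbT.
    by rewrite nE; apply: (hull_ray d0); rewrite ?(inE, mem_rcons) ?eqxx ?orbT//; move: d0 n0; clear; lra.
  move=> /or4P[/eqP->|/eqP->|/eqP->|/orP[/eqP->|rL]];
    by in_hull.
move: M; rewrite q0 z1 z2.
have -> : hull (x :: x' :: (u :: y :: A) ++ n :: y' :: B) = hull S.
  apply: hull_eq => r; rewrite ?(inE, mem_cat).
    move=> /or4P[/eqP->//|/eqP->//|/eqP->//|/orP[/eqP->//|/or4P[/hA[]//|/eqP->//|/eqP->//|/hB[]//]]].
  move=> rS; have [r2|r2|r2] := ltrgtP r.2 0.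
  - by apply: hull_in; rewrite !(inE, mem_cat, mem_filter) r2 rS !orbT.
  - by apply: hull_in; rewrite !(inE, mem_cat, mem_filter) r2 rS !orbT.
  (* A vertex on the first axis lies between the extreme points [x'] and [x]. *)
  have rE : r = vscale (r.1 / cx) x by apply: pt_eq => /=; rewrite ?r2; field; rewrite gt_eqF.
  have rE' : r = vscale (- r.1 / cx') x' by apply: pt_eq => /=; rewrite ?r2 /k; field; rewrite !gt_eqF.
  rewrite rE; apply: (hull_ray k0); [in_list|in_list| |].
    rewrite leNgt; apply/negP => lt; apply: (x'max (- r.1 / cx')); last by rewrite -rE'; exact: hull_in.
    by move: lt; rewrite /k ltr_pdivrMr// ltr_pdivlMr// mulNr divfK ?gt_eqF//; clear; lra.
  rewrite leNgt; apply/negP => lt; apply: (xmax _ lt); rewrite -rE; exact: hull_in.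
by rewrite /vadd /= !addr0 => -[e1 e2]; exact: pt_eq.
Qed.

End Vanishing.

(** * The solution space *)

Section Dimension.
Variable R : realType.
Notation pt := (R * R)%type.
Implicit Types (z : set pt -> pt) (p q : pt) (s : seq pt).

Definition comb (a b : R) z1 z2 : set pt -> pt :=
  fun P => vadd (vscale a (z1 P)) (vscale b (z2 P)).

(** Regularity is not visibly stable under sums, because the good parameters of two valuations may
    differ. A bound along the whole segment is stable, also when added to a regular valuation. *)
Definition segment_bounded z := forall s p q, inn (p :: s) -> inn (q :: s) ->
  exists M : R, forall t, 0 <= t -> t <= 1 ->
    `|(z (hull (lin t p q :: s))).1| <= M /\ `|(z (hull (lin t p q :: s))).2| <= M.

Lemma segment_bounded_regular z : segment_bounded z -> regular z.
Proof.
move=> bz s p q ip iq; have [M hM] := bz s p q ip iq; exists M => h h0 h1.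
exists 0; rewrite add0r; split => //; [lra|apply: hM => //|apply: hM]; lra.
Qed.

Lemma norm_comb (a b u v M N : R) : `|u| <= M -> `|v| <= N ->
  `|a * u + b * v| <= `|a| * M + `|b| * N.
Proof.
move=> uM vN; apply: (le_trans (ler_normD _ _)); rewrite !normrM.
by apply: lerD; apply: ler_wpM2l.
Qed.

Lemma regular_comb a b z1 z2 : regular z1 -> segment_bounded z2 -> regular (comb a b z1 z2).
Proof.
move=> r1 b2 s p q ip iq; have [M hM] := r1 s p q ip iq; have [N hN] := b2 s p q ip iq.
exists (`|a| * M + `|b| * N) => h h0 h1; have [t [t0 t1 [m1 m2] [m3 m4]]] := hM h h0 h1.
have [|n1 n2] := hN t t0; first by lra.
have [||n3 n4] := hN (t + h); [lra|lra|].
by exists t; split => //; split; apply: norm_comb.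
Qed.

Lemma segment_bounded_comb a b z1 z2 :
  segment_bounded z1 -> segment_bounded z2 -> segment_bounded (comb a b z1 z2).
Proof.
move=> b1 b2 s p q ip iq; have [M hM] := b1 s p q ip iq; have [N hN] := b2 s p q ip iq.
exists (`|a| * M + `|b| * N) => t t0 t1; have [m1 m2] := hM t t0 t1.
by have [n1 n2] := hN t t0 t1; split; apply: norm_comb.
Qed.

Lemma valuation_comb a b z1 z2 : valuation_on_Po z1 -> valuation_on_Po z2 ->
  valuation_on_Po (comb a b z1 z2).
Proof.
move=> v1 v2 K L pK pL pU pI; have [e1 e1'] := v1 K L pK pL pU pI.
have [e2 e2'] := v2 K L pK pL pU pI.
have E (x x' y y' c d u v : R) : x + x' = y + y' -> c + d = u + v ->
    a * x + b * c + (a * x' + b * d) = a * y + b * u + (a * y' + b * v).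
  move=> h1 h2; transitivity (a * (x + x') + b * (c + d)); first by ring.
  by rewrite h1 h2; ring.
by apply: pt_eq; apply: E.
Qed.

Lemma covariant_comb a b z1 z2 : covariant z1 -> covariant z2 -> covariant (comb a b z1 z2).
Proof.
move=> c1 c2 x y u v P D pP; rewrite /comb c1// c2//.
by apply: pt_eq => /=; ring.
Qed.

(* The constant [f] of the introduction. *)
Definition shear_coef z := Vy1 z 1 1 1 1.

Lemma shear_coef_comb a b z1 z2 :
  shear_coef (comb a b z1 z2) = a * shear_coef z1 + b * shear_coef z2.
Proof. by rewrite /shear_coef /Vy1 /Vy /quadval /comb /=; ring. Qed.

Lemma moment_coef z : valuation_on_Po z -> covariant z -> regular z -> shear_coef z = 0 ->
  exists c : R, forall x (k : R) p q, 0 < k -> 0 < det2 x p -> det2 x q < 0 -> compat x k p q ->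
    z (hull [:: x; vscale (- k) x; p; q]) = vscale c (quad_moment x k p q).
Proof. exact: diag_quad. Qed.

Lemma moment_coef0 z : valuation_on_Po z ->
  (forall x (k : R) p q, 0 < k -> 0 < det2 x p -> det2 x q < 0 -> compat x k p q ->
    z (hull [:: x; vscale (- k) x; p; q]) = vscale 0 (quad_moment x k p q)) ->
  forall P, polygon_o P -> z P = (0, 0).
Proof.
move=> vz h P pP; apply: (polygon_zero vz) => // x k p q k0 xp xq c.
by rewrite h//; apply: pt_eq => /=; ring.
Qed.

Lemma solutions_2dim z m1 m2 : valuation_on_Po z -> covariant z -> regular z ->
  valuation_on_Po m1 -> covariant m1 -> segment_bounded m1 ->
  valuation_on_Po m2 -> covariant m2 -> segment_bounded m2 ->
  (forall a b : R, (forall P, polygon_o P -> comb a b m1 m2 P = (0, 0)) -> a = 0 /\ b = 0) ->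
  exists a b : R, forall P, polygon_o P -> z P = comb a b m1 m2 P.
Proof.
move=> vz cz rz v1 c1 b1 v2 c2 b2 indep.
(* A nontrivial combination of the two models on which the first linear condition, [shear_coef],
   vanishes. *)
have [a0 [b0 [ab0 k0]]] : exists a b, (a != 0 \/ b != 0) /\
    a * shear_coef m1 + b * shear_coef m2 = 0.
  have [->|n2] := eqVneq (shear_coef m2) 0.
    have [->|n1] := eqVneq (shear_coef m1) 0.
      by exists 1, 0; split; [left; exact: oner_neq0|ring].
    by exists 0, 1; split; [right; exact: oner_neq0|ring].
  by exists (shear_coef m2), (- shear_coef m1); split; [left|ring].
pose m := comb a0 b0 m1 m2.
have vm : valuation_on_Po m by exact: valuation_comb.
have cm : covariant m by exact: covariant_comb.
have bm : segment_bounded m by exact: segment_bounded_comb.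
have km : shear_coef m = 0 by rewrite shear_coef_comb.
have [cc hc] := moment_coef vm cm (segment_bounded_regular bm) km.
(* The second linear condition cannot vanish on [m], for otherwise [m] would be zero on
   quadrilaterals and hence everywhere. *)
have cc0 : cc != 0.
  apply/eqP => c0; rewrite c0 in hc; have [a00 b00] := indep _ _ (moment_coef0 vm hc).
  by case: ab0; rewrite ?a00 ?b00 eqxx.
(* A correction of z that kills its [shear_coef]. If both models had [shear_coef] zero, both would
   be proportional to [quad_moment] on quadrilaterals, hence dependent. *)
have [a1 [b1' k1]] : exists a b, shear_coef z + (a * shear_coef m1 + b * shear_coef m2) = 0.
  have [k2|n2] := eqVneq (shear_coef m2) 0; last first.
    by exists 0, (- shear_coef z / shear_coef m2); field.
  have [k1|n1] := eqVneq (shear_coef m1) 0; last first.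
    by exists (- shear_coef z / shear_coef m1), 0; field.
  have [d1 h1] := moment_coef v1 c1 (segment_bounded_regular b1) k1.
  have [d2 h2] := moment_coef v2 c2 (segment_bounded_regular b2) k2.
  have [|d20 d10] := indep d2 (- d1).
    apply: (moment_coef0 (valuation_comb d2 (- d1) v1 v2)) => x k p q kp xp xq c.
    by rewrite /comb h1// h2//; apply: pt_eq => /=; ring.
  have d10' : d1 = 0 by rewrite -[d1]opprK d10 oppr0.
  have [|] := indep 1 0.
    apply: (moment_coef0 (valuation_comb 1 0 v1 v2)) => x k p q kp xp xq c.
    by rewrite /comb h1// d10'; apply: pt_eq => /=; ring.
  by move/eqP; rewrite oner_eq0.
pose u := comb a1 b1' m1 m2; pose z' := comb 1 1 z u.
have vu : valuation_on_Po u by exact: valuation_comb.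
have cu : covariant u by exact: covariant_comb.
have bu : segment_bounded u by exact: segment_bounded_comb.
have vz' : valuation_on_Po z' by exact: valuation_comb.
have kz' : shear_coef z' = 0 by rewrite !shear_coef_comb !mul1r.
have [c' hc'] := moment_coef vz' (covariant_comb 1 1 cz cu) (regular_comb 1 1 rz bu) kz'.
have H := moment_coef0 (valuation_comb 1 (- c' / cc) vz' vm).
have {}H : forall P, polygon_o P -> comb 1 (- c' / cc) z' m P = (0, 0).
  apply: H => x k p q kp xp xq c.
  by rewrite /comb hc// hc'//; apply: pt_eq => /=; field.
exists (c' / cc * a0 - a1), (c' / cc * b0 - b1') => P pP.
have [e1 e2] := H P pP.
by apply: pt_eq; [move: e1|move: e2]; rewrite /z' /u /m /comb /= => e; lra.
Qed.

End Dimension.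

(** * Lebesgue measure in the plane *)

Section Lebesgue.
Import numFieldNormedType.Exports.
Variable R : realType.
Notation pt := (R * R)%type.
Notation mu := (@lebesgue_measure R).
Notation TR := (measurableTypeR R).
Notation leb2 := (@Defs.leb2 R).

Lemma measurable_translation (c : R) : measurable_fun setT ((fun x => c + x) : TR -> TR).
Proof. exact: measurable_funD. Qed.

Lemma lebesgue_translation (c : R) (A : set TR) : measurable A ->
  mu ((fun x : TR => c + x) @^-1` A) = mu A.
Proof.
move=> mA; pose f : TR -> TR := fun x => c + x.
have mf : measurable_fun setT f by exact: measurable_translation.
change (pushforward mu f A = mu A).
apply/esym/lebesgue_measure_unique => //= _ [[a b]] _ <-.
rewrite /pushforward /=.
have -> : f @^-1` [set` `]a, b]] = `]a - c, b - c]%classic.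
  have E (x : R) : (a < c + x <= b) = (a - c < x <= b - c) by rewrite ltrBlDl lerBrDl.
  by apply/funext => x /=; rewrite !in_itv /=; exact: (congr1 is_true (E x)).
rewrite !lebesgue_measure_itv /= !lte_fin ltrD2r.
case: ifP => // _; rewrite -!EFinB; congr (_%:E); ring.
Qed.

Definition preserves (f : pt -> pt) :=
  measurable_fun setT (f : TR * TR -> TR * TR) /\
  forall A : set (TR * TR), measurable A -> leb2 (f @^-1` A) = leb2 A.

Lemma preserves_comp f g : preserves f -> preserves g -> preserves (f \o g).
Proof.
move=> [mf hf] [mg hg]; split; first exact: measurableT_comp.
move=> A mA; rewrite comp_preimage hg ?hf//.
by rewrite -[X in measurable X]setTI; exact: mf.
Qed.

(** Integrating in the other order lets horizontal shears be treated slice by slice, like vertical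
    ones. *)
Lemma leb2_sym (A : set (TR * TR)) : measurable A -> leb2 A = (mu \x^ mu)%E A.
Proof.
move=> mA; apply: product_measure_unique => //= B C mB mC.
exact: product_measure2E.
Qed.

Lemma measurable_lmap a b c d : measurable_fun setT (lmap a b c d : TR * TR -> TR * TR).
Proof.
apply: measurable_fun_pair; apply: measurable_funD; apply: measurable_funM => //;
  by [exact: measurable_fst|exact: measurable_snd].
Qed.

Lemma preserves_vshear c : preserves (lmap 1 0 c 1).
Proof.
split; first exact: measurable_lmap.
move=> A mA; rewrite /Defs.leb2 /product_measure1 /=; apply: eq_integral => x _ /=.
have -> : xsection (lmap 1 0 c 1 @^-1` A) x = (fun y : TR => c * x + y) @^-1` (xsection A x).
  apply/seteqP; split => y; rewrite /xsection /= !inE /=;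
    by have -> : lmap 1 0 c 1 (x, y) = (x, c * x + y) by apply: pt_eq => /=; ring.
by apply: lebesgue_translation; exact: measurable_xsection.
Qed.

Lemma preserves_hshear c : preserves (lmap 1 c 0 1).
Proof.
split; first exact: measurable_lmap.
move=> A mA; have mA' : measurable (lmap 1 c 0 1 @^-1` A : set (TR * TR)).
  by rewrite -[X in measurable X]setTI; exact: measurable_lmap.
rewrite !leb2_sym// /product_measure2 /=; apply: eq_integral => y _ /=.
have -> : ysection (lmap 1 c 0 1 @^-1` A) y = (fun x : TR => c * y + x) @^-1` (ysection A y).
  apply/seteqP; split => x; rewrite /ysection /= !inE /=;
    by have -> : lmap 1 c 0 1 (x, y) = (c * y + x, y) by apply: pt_eq => /=; ring.
by apply: lebesgue_translation; exact: measurable_ysection.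
Qed.

Lemma lmap_comp (a b c d a' b' c' d' : R) x : lmap a b c d (lmap a' b' c' d' x) =
  lmap (a * a' + b * c') (a * b' + b * d') (c * a' + d * c') (c * b' + d * d') x.
Proof. by apply: pt_eq => /=; ring. Qed.

(** A matrix of determinant 1 with nonzero lower left entry is a product of three shears. If that
    entry is zero, adding the first row to the second makes it nonzero. *)
Lemma preserves_SL2 a b c d : a * d - b * c = 1 -> preserves (lmap a b c d).
Proof.
have H a' b' c' d' : c' != 0 -> a' * d' - b' * c' = 1 -> preserves (lmap a' b' c' d').
  move=> c0 D; have -> : lmap a' b' c' d' =
      (lmap 1 ((a' - 1) / c') 0 1 \o lmap 1 0 c' 1) \o lmap 1 ((d' - 1) / c') 0 1 :> (pt -> pt).
    apply/funext => x; rewrite /= !lmap_comp.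
    have -> : b' = (a' * d' - 1) / c' by rewrite -D; field.
    by congr lmap; field.
  by do 2 (apply: preserves_comp; last exact: preserves_hshear || exact: preserves_vshear);
    exact: preserves_hshear.
move=> D; have [c0|] := eqVneq c 0; last by move/H; exact.
have a0 : a != 0.
  by apply/eqP => a0; move/eqP: D; rewrite a0 c0 mul0r mulr0 subrr eq_sym oner_eq0.
have -> : lmap a b c d = @lmap R 1 0 (-1) 1 \o lmap a b (a + c) (b + d).
  by apply/funext => x; rewrite /= lmap_comp; congr lmap; ring.
apply: preserves_comp; first exact: preserves_vshear.
by apply: H; [rewrite c0 addr0|rewrite -D; ring].
Qed.

Lemma in_interior_setI (K L : set pt) (x : pt) : in_interior x K -> in_interior x L -> in_interior x (K `&` L).
Proof.
move=> [e [e0 he]] [f [f0 hf]]; exists (Num.min e f); split; first by rewrite lt_min e0.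
by move=> y; rewrite lt_min => /andP[/he ? /hf].
Qed.

Lemma hull_lin_supset (s : seq pt) (p q : pt) (t : R) : 0 <= t -> t <= 1 ->
  hull (p :: s) `&` hull (q :: s) `<=` hull (lin t p q :: s).
Proof.
move=> t0 t1 x [h1 h2]; have [s0|s0] := eqVneq s [::]; last exact: star_inter0.
rewrite s0 !hull1 in h1 h2 *.
by rewrite -h1 -h2; apply: pt_eq => /=; ring.
Qed.

Lemma inn_lin (s : seq pt) (p q : pt) (t : R) : 0 <= t -> t <= 1 ->
  inn (p :: s) -> inn (q :: s) -> inn (lin t p q :: s).
Proof.
move=> t0 t1 ip iq; apply: in_interior_sub (in_interior_setI ip iq).
exact: hull_lin_supset.
Qed.

(** The rational half-open boxes inside the set cover it, which places open sets in the product
    sigma-algebra. *)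
Lemma box_open_measurable (U : set (TR * TR)) :
  (forall x : pt, U x -> exists2 e : R, 0 < e &
     forall y : pt, `|y.1 - x.1| < e -> `|y.2 - x.2| < e -> U y) -> measurable U.
Proof.
move=> hU; pose box (r : (rat * rat) * (rat * rat)) : set (TR * TR) :=
  `]ratr r.1.1, ratr r.1.2[%classic `*` `]ratr r.2.1, ratr r.2.2[%classic.
have -> : U = \bigcup_r (if pselect (box r `<=` U) then box r else set0).
  apply/seteqP; split => [x Ux|x [r _]]; last by case: pselect => // h /h.
  have [e e0 he] := hU x Ux.
  have lt1 (u : R) : u - e < u by lra.
  have lt2 (u : R) : u < u + e by lra.
  have [a1 ha1] := rat_in_itvoo (lt1 x.1); have [b1 hb1] := rat_in_itvoo (lt2 x.1).
  have [a2 ha2] := rat_in_itvoo (lt1 x.2); have [b2 hb2] := rat_in_itvoo (lt2 x.2).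
  move: ha1 hb1 ha2 hb2; rewrite !inE /= => /andP[p1 p2] /andP[p3 p4] /andP[p5 p6] /andP[p7 p8].
  exists ((a1, b1), (a2, b2)) => //; case: pselect => [h|].
    by split; rewrite /= in_itv /=; apply/andP.
  case=> -[y1 y2] [/=]; rewrite !in_itv /= => /andP[q1 q2] /andP[q3 q4].
  have bnd (u v r s : R) : u - e < r -> s < u + e -> r < v -> v < s -> `|v - u| < e.
    by move=> *; rewrite ltr_norml; apply/andP; split; lra.
  by apply: he; [exact: (bnd _ _ _ _ p1 p4 q1 q2)|exact: (bnd _ _ _ _ p5 p8 q3 q4)].
apply: countable_bigcupT_measurable; first exact: countableP.
move=> r; case: pselect => [h|h] /=; last exact: measurable0.
by apply: measurableX; exact: measurable_itv.
Qed.

Lemma closed_measurable2 (C : set pt) : closed (C : set pt) -> measurable (C : set (TR * TR)).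
Proof.
move=> cC; rewrite -[C]setCK; apply: measurableC; apply: box_open_measurable => x Cx.
have : nbhs x (~` C) by apply: open_nbhs_nbhs; split => //; exact: closed_openC.
move=> /nbhs_ballP[e /= e0 he]; exists e => // y y1 y2; apply: he.
by split; rewrite /ball /= distrC.
Qed.

Lemma hull_measurable s : s != [::] -> measurable (hull s : set (TR * TR)).
Proof. by move=> s0; apply: closed_measurable2; exact: hull_closed. Qed.

Definition box (M N : R) : set (TR * TR) := `[- M, M]%classic `*` `[- N, N]%classic.

Lemma measurable_box M N : measurable (box M N).
Proof. by apply: measurableX; exact: measurable_itv. Qed.

Lemma leb2_box M N : 0 < M -> 0 < N -> leb2 (box M N) = (2 * M * (2 * N))%:E.
Proof.
move=> M0 N0; pose I (K : R) : set TR := `[- K, K]%classic.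
transitivity (mu (I M) * mu (I N))%E.
  by apply: product_measure1E; exact: measurable_itv.
have E (K : R) : 0 < K -> mu (I K) = (2 * K)%:E.
  move=> K0; rewrite lebesgue_measure_itv /= lte_fin.
  have -> : - K < K by lra.
  by rewrite -EFinB; congr (_%:E); ring.
by rewrite !E// -EFinM.
Qed.

End Lebesgue.

(** * Moment vectors of bounded measurable sets *)

Section Moment.
Import numFieldNormedType.Exports.
Variable R : realType.
Notation pt := (R * R)%type.
Notation TR := (measurableTypeR R).
Notation leb2 := (@Defs.leb2 R).
Implicit Types (P K L : set pt) (f : pt -> R).

Definition tame P := measurable (P : set (TR * TR)) /\ exists2 M : R, 0 < M & P `<=` box M M.

Lemma leb2_sub_box (P : set pt) (M N : R) : 0 < M -> 0 < N -> measurable (P : set (TR * TR)) ->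
  P `<=` box M N -> (leb2 P <= (2 * M * (2 * N))%:E)%E.
Proof.
move=> M0 N0 mP PM; rewrite -leb2_box//; apply: le_measure => //; rewrite inE//.
exact: measurable_box.
Qed.

Lemma bounded_integrable P f (M N C : R) : 0 < M -> 0 < N -> measurable (P : set (TR * TR)) ->
  P `<=` box M N -> measurable_fun setT (f : TR * TR -> R) -> (forall x, P x -> `|f x| <= C) ->
  leb2.-integrable P (EFin \o (f : TR * TR -> R)).
Proof.
move=> M0 N0 mP PM mf fC; apply: measurable_bounded_integrable => //.
- by apply: le_lt_trans (leb2_sub_box M0 N0 mP PM) _; rewrite ltry.
- exact: measurable_funTS.
- exists C; split; first exact: num_real.
  by move=> C' CC' x Px; apply: le_trans (fC x Px) (ltW CC').
Qed.

Lemma integrable_fst P : tame P -> leb2.-integrable P (EFin \o (fst : TR * TR -> R)).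
Proof.
move=> [mP [M M0 PM]]; apply: (@bounded_integrable P fst M M M) => //.
by move=> x /PM [/=]; rewrite in_itv /= => /andP[a b] _; rewrite ler_norml a.
Qed.

Lemma integrable_snd P : tame P -> leb2.-integrable P (EFin \o (snd : TR * TR -> R)).
Proof.
move=> [mP [M M0 PM]]; apply: (@bounded_integrable P snd M M M) => //.
by move=> x /PM [/= _]; rewrite in_itv /= => /andP[a b]; rewrite ler_norml a.
Qed.

Lemma tameU K L : tame K -> tame L -> tame (K `|` L).
Proof.
move=> [mK [M M0 KM]] [mL [N N0 LN]]; split; first exact: measurableU.
exists (M + N); first exact: addr_gt0.
by move=> x [/KM|/LN] [/=]; rewrite !in_itv /= => /andP[a b] /andP[c d];
  split => /=; rewrite in_itv /=; apply/andP; split; lra.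
Qed.

Lemma Rintegral_setU_setI K L f : tame K -> tame L ->
  (forall P, tame P -> leb2.-integrable P (EFin \o (f : TR * TR -> R))) ->
  Rintegral leb2 (K `|` L) f + Rintegral leb2 (K `&` L) f =
  Rintegral leb2 K f + Rintegral leb2 L f.
Proof.
move=> tK tL If; have [mK _] := tK; have [mL [N N0 LN]] := tL.
have mLK : measurable (L `\` K : set (TR * TR)) by exact: measurableD.
have mKL : measurable (K `&` L : set (TR * TR)) by exact: measurableI.
have e1 : Rintegral leb2 (K `|` L) f = Rintegral leb2 K f + Rintegral leb2 (L `\` K) f.
  have E : K `|` L = K `|` (L `\` K).
    apply/seteqP; split => x [Kx|Lx]; [by left| |by left|by right; case: Lx].
    by have [?|?] := pselect (K x); [left|right].
  rewrite E.
  rewrite Rintegral_setU//.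
    by apply: If; split; [exact: measurableU|]; have [_ [M M0 KM]] := tameU tK tL;
      exists M => // x [hx|[hx _]]; apply: KM; [left|right].
  by apply/disj_setPS => x [Kx [_]].
have e2 : Rintegral leb2 L f = Rintegral leb2 (K `&` L) f + Rintegral leb2 (L `\` K) f.
  rewrite -Rintegral_setU//.
  - congr Rintegral; apply/seteqP; split => [x Lx|x [[]|[]]//].
    by have [?|?] := pselect (K x); [left|right].
  - by apply: If; split; [exact: measurableU|exists N => // x [[_]|[]] *; apply: LN].
  - by apply/disj_setPS => x [[Kx _] [_]].
by rewrite e1 e2; ring.
Qed.

Lemma moment_setU_setI K L : tame K -> tame L ->
  vadd (moment (K `|` L)) (moment (K `&` L)) = vadd (moment K) (moment L).
Proof.
move=> tK tL; apply: pt_eq => /=.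
  exact: (Rintegral_setU_setI tK tL integrable_fst).
exact: (Rintegral_setU_setI tK tL integrable_snd).
Qed.

Lemma Rintegral_bound P f (M N C : R) : 0 < M -> 0 < N -> 0 <= C -> measurable (P : set (TR * TR)) ->
  P `<=` box M N -> measurable_fun setT (f : TR * TR -> R) -> (forall x, P x -> `|f x| <= C) ->
  `|Rintegral leb2 P f| <= C * (2 * M * (2 * N)).
Proof.
move=> M0 N0 C0 mP PM mf fC.
have If := bounded_integrable M0 N0 mP PM mf fC.
apply: (le_trans (le_normr_Rintegral mP If)).
have Ic : leb2.-integrable P (EFin \o (cst C : TR * TR -> R)).
  by apply: (bounded_integrable M0 N0 mP PM (C := `|C|)).
apply: (le_trans (le_Rintegral mP (integrable_norm If) Ic fC)).
rewrite Rintegral_cst//; apply: ler_wpM2l => //.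
have h := leb2_sub_box M0 N0 mP PM.
rewrite -lee_fin fineK// ge0_fin_numE//; apply: (le_lt_trans h); exact: ltry.
Qed.

Lemma moment_bound P (M N : R) : 0 < M -> 0 < N -> measurable (P : set (TR * TR)) ->
  P `<=` box M N -> `|(moment P).1| <= M * (2 * M * (2 * N)) /\ `|(moment P).2| <= N * (2 * M * (2 * N)).
Proof.
move=> M0 N0 mP PM; split.
  apply: (@Rintegral_bound P fst M N M) => //; first exact: ltW.
  by move=> x /PM [/=]; rewrite in_itv /= => /andP[a b] _; rewrite ler_norml a.
apply: (@Rintegral_bound P snd M N N) => //; first exact: ltW.
by move=> x /PM [/= _]; rewrite in_itv /= => /andP[a b]; rewrite ler_norml a.
Qed.

Lemma lmapK a b c d : a * d - b * c = 1 ->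
  cancel (@lmap R a b c d) (lmap d (- b) (- c) a).
Proof.
move=> D x; rewrite lmap_comp; have -> : d * a + - b * c = 1 by rewrite -D; ring.
have -> : - c * b + a * d = 1 by rewrite -D; ring.
by apply: pt_eq => /=; ring.
Qed.

Lemma lmap_image a b c d P : a * d - b * c = 1 ->
  lmap a b c d @` P = lmap d (- b) (- c) a @^-1` P.
Proof.
move=> D; apply/seteqP; split => [_ [x Px <-]|x Px]; first by rewrite /= lmapK.
exists (lmap d (- b) (- c) a x) => //.
have D' : d * a - - b * - c = 1 by rewrite -D; ring.
by have := lmapK D' x; rewrite !opprK.
Qed.

Lemma tame_lmap a b c d P : a * d - b * c = 1 -> tame P -> tame (lmap a b c d @` P).
Proof.
move=> D [mP [M M0 PM]]; split.
  rewrite lmap_image// -[X in measurable X]setTI; exact: measurable_lmap.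
exists ((`|a| + `|b| + `|c| + `|d|) * M + 1).
  by rewrite ltr_wpDl// mulr_ge0 ?addr_ge0// ltW.
move=> _ [x Px <-]; have [/= + +] := PM x Px; rewrite !in_itv /= -!ler_norml => x1 x2.
have n := normr_ge0.
have E (u v s t : R) : `|s| <= M -> `|t| <= M -> `|u * s + v * t| <= (`|u| + `|v|) * M.
  by move=> sM tM; apply: (le_trans (ler_normD _ _)); rewrite !normrM mulrDl; apply: lerD; apply: ler_wpM2l.
have cd0 : 0 <= (`|c| + `|d|) * M by rewrite mulr_ge0 ?addr_ge0// ltW.
have ab0 : 0 <= (`|a| + `|b|) * M by rewrite mulr_ge0 ?addr_ge0// ltW.
split => /=; rewrite in_itv /= -ler_norml.
  by apply: (le_trans (E _ _ _ _ x1 x2)); lra.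
by apply: (le_trans (E _ _ _ _ x1 x2)); lra.
Qed.

Lemma Rintegral_lmap a b c d P f : a * d - b * c = 1 -> tame P ->
  (forall P, tame P -> leb2.-integrable P (EFin \o (f : TR * TR -> R))) ->
  measurable_fun setT (f : TR * TR -> R) ->
  Rintegral leb2 (lmap a b c d @` P) f = Rintegral leb2 P (f \o lmap a b c d).
Proof.
move=> D tP If mf; have [mP _] := tP; congr fine.
have D' : d * a - - b * - c = 1 by rewrite -D; ring.
pose psi : TR * TR -> TR * TR := lmap d (- b) (- c) a.
pose phi : TR * TR -> TR * TR := lmap a b c d.
have phipsi x : phi (psi x) = x by have := lmapK D' x; rewrite !opprK.
have [mpsi ppsi] := preserves_SL2 D'.
have mphi : measurable_fun setT phi by exact: measurable_lmap.
have Ef : (EFin \o (f \o phi)) \o psi = EFin \o f by apply/funext => x /=; rewrite phipsi.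
have im : lmap a b c d @` P = psi @^-1` P by exact: lmap_image.
(* The integral over the image is a change of variables along the inverse map [psi], whose
   pushforward of the measure is the measure itself. *)
have E : (\int[pushforward leb2 psi]_(y in P) (EFin \o (f \o phi)) y = \int[leb2]_(x in psi @^-1` P) ((EFin \o (f \o phi)) \o psi) x)%E.
  apply: integral_pushforward => //.
    by apply/measurable_EFinP; exact: measurableT_comp.
  by rewrite Ef -im; apply: If; exact: tame_lmap.
rewrite im; move: E; rewrite Ef => <-.
by apply: eq_measure_integral => A mA _; exact: ppsi.
Qed.

Lemma integrable_scale P f (r : R) : tame P -> leb2.-integrable P (EFin \o (f : TR * TR -> R)) ->
  leb2.-integrable P (EFin \o ((fun x => r * f x) : TR * TR -> R)).
Proof.
move=> [mP _] If.
have -> : EFin \o ((fun x => r * f x) : TR * TR -> R) =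
    (fun x => r%:E * (EFin \o (f : TR * TR -> R)) x)%E by apply/funext => x; rewrite /= EFinM.
exact: integrableZl.
Qed.

Lemma Rintegral_linear P f g (r s : R) : tame P ->
  leb2.-integrable P (EFin \o (f : TR * TR -> R)) ->
  leb2.-integrable P (EFin \o (g : TR * TR -> R)) ->
  Rintegral leb2 P (fun x => r * f x + s * g x) = r * Rintegral leb2 P f + s * Rintegral leb2 P g.
Proof.
move=> tP If Ig; have [mP _] := tP.
have Irf := integrable_scale r tP If; have Isg := integrable_scale s tP Ig.
have E1 := RintegralD mP Irf Isg.
have E2 := RintegralZl r mP If.
have E3 := RintegralZl s mP Ig.
by rewrite -E2 -E3 -E1.
Qed.

Lemma moment_lmap a b c d P : a * d - b * c = 1 -> tame P ->
  moment (lmap a b c d @` P) = lmap a b c d (moment P).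
Proof.
move=> D tP.
have E1 := Rintegral_lmap D tP integrable_fst measurable_fst.
have E2 := Rintegral_lmap D tP integrable_snd measurable_snd.
by rewrite /moment E1 E2; apply: pt_eq; apply: Rintegral_linear => //;
  [exact: integrable_fst|exact: integrable_snd|exact: integrable_fst|exact: integrable_snd].
Qed.

End Moment.

(** * Moments of polygons and of their polars *)

Section Polar.
Import numFieldNormedType.Exports.
Variable R : realType.
Notation pt := (R * R)%type.
Notation TR := (measurableTypeR R).
Implicit Types (P K L : set pt) (x y : pt) (s : seq pt).

Lemma hull_box s : exists2 M : R, 0 < M & hull s `<=` box M M.
Proof.
have [M M0 hM] := hull_bounded s; exists M => // x /hM[].
by rewrite !ler_norml => h1 h2; split; rewrite /= in_itv.
Qed.

Lemma tame_polygon P : polygon_o P -> tame P.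
Proof.
move=> /polygonP[s -> i]; split; last exact: hull_box.
exact: hull_measurable (inn_neq0 i).
Qed.

Lemma polygon_closed_cvx P : polygon_o P -> closed (P : set pt) /\ cvx P.
Proof.
move=> /polygonP[s -> i]; split; last exact: hull_cvx.
exact: hull_closed (inn_neq0 i).
Qed.

Lemma polar_measurable P : measurable (polar P : set (TR * TR)).
Proof.
rewrite -[polar P]setCK; apply: measurableC; apply: box_open_measurable => y /= yP.
have [x Px xy] : exists2 x, P x & 1 < dot y x.
  apply: contrapT => h; apply: yP => x Px; rewrite leNgt; apply/negP => xy.
  by apply: h; exists x.
pose N := `|x.1| + `|x.2| + 1.
have n1 := normr_ge0 x.1; have n2 := normr_ge0 x.2.
have N0 : 0 < N by rewrite /N; lra.
exists ((dot y x - 1) / N); first by rewrite divr_gt0//; lra.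
move=> y' y1 y2 /(_ x Px); apply/negP; rewrite -ltNge.
have e0 : 0 < (dot y x - 1) / N by rewrite divr_gt0//; lra.
have E : (dot y x - 1) / N * N = dot y x - 1 by field; rewrite gt_eqF.
move: ((dot y x - 1) / N) y1 y2 e0 E => e y1 y2 e0 E.
have B (u v : R) : `|u| < e -> - (e * `|v|) <= u * v.
  move=> ue; rewrite lerNl; apply: (le_trans (ler_norm _)).
  by rewrite normrN normrM; apply: ler_wpM2r => //; exact: ltW.
have := B _ x.1 y1; have := B _ x.2 y2; move: E.
rewrite /N /dot; lra.
Qed.

Lemma polar_sub_box P (e : R) : 0 < e -> (forall y, Defs.edist (0, 0) y < e -> P y) ->
  polar P `<=` box (2 / e) (2 / e).
Proof.
move=> e0 he y yP.
have H (u v : R) : u ^+ 2 + v ^+ 2 = (e / 2) ^+ 2 -> dot y (u, v) <= 1.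
  move=> uv; apply: yP; apply: he; rewrite /Defs.edist /= !sub0r !sqrrN uv sqrtr_sqr ger0_norm; lra.
have h1 := H (e / 2) 0; have h2 := H (- (e / 2)) 0.
have h3 := H 0 (e / 2); have h4 := H 0 (- (e / 2)).
rewrite /dot /= in h1 h2 h3 h4.
split => /=; rewrite in_itv /= -ler_norml ler_pdivlMr// -[X in _ * X](gtr0_norm e0) -normrM ler_norml.
  by apply/andP; split; [have := h2|have := h1]; rewrite ?sqrrN ?expr0n /= addr0 => /(_ erefl); lra.
by apply/andP; split; [have := h4|have := h3]; rewrite ?sqrrN ?expr0n /= add0r => /(_ erefl); lra.
Qed.

Lemma tame_polar P : polygon_o P -> tame (polar P).
Proof.
move=> [_ [e [e0 he]]]; split; first exact: polar_measurable.
by exists (2 / e); [rewrite divr_gt0|exact: polar_sub_box].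
Qed.

Lemma polar_setU K L : polar (K `|` L) = polar K `&` polar L.
Proof.
apply/seteqP; split => [y h|y [h1 h2] x [/h1|/h2]//].
by split => x hx; apply: h; [left|right].
Qed.

(* A segment inside [K `|` L] joining a point of [K] to a point of [L] meets [K `&` L]. *)
Lemma polar_setI K L : polygon_o K -> polygon_o L -> polygon_o (K `|` L) ->
  polar (K `&` L) = polar K `|` polar L.
Proof.
move=> pK pL pU; apply/seteqP; split => [y h|y [h|h] x [Kx Lx]]; [|exact: h|exact: h].
apply: contrapT => /not_orP[nK nL].
have out P : ~ polar P y -> exists2 x, P x & 1 < dot y x.
  move=> nP; apply: contrapT => h'; apply: nP => x Px; rewrite leNgt; apply/negP => xy.
  by apply: h'; exists x.
have [k Kk yk] := out _ nK; have [l Ll yl] := out _ nL.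
have [cK vK] := polygon_closed_cvx pK; have [cL vL] := polygon_closed_cvx pL.
have [_ vU] := polygon_closed_cvx pU.
pose g (t : R) : pt := lin t k l.
have cg : continuous g.
  apply: (@continuous_pair_fun R R (fun t => (1 - t) * k.1 + t * l.1)
    (fun t => (1 - t) * k.2 + t * l.2)) => t;
  exact: (cvgD (cvgM (cvgB (cvg_cst _) cvg_id) (cvg_cst _)) (cvgM cvg_id (cvg_cst _))).
have yg t : 0 <= t -> t <= 1 -> 1 < dot y (g t).
  move=> t0 t1; have -> : dot y (g t) = (1 - t) * dot y k + t * dot y l by rewrite /dot /=; ring.
  by move: yk yl => yk' yl'; have [t2|t2] := lerP t (1 / 2); nra.
have disj t : 0 <= t -> t <= 1 -> K (g t) -> L (g t) -> False.
  by move=> t0 t1 Kt Lt; have := h (g t) (conj Kt Lt); rewrite leNgt yg.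
have cov t : 0 <= t -> t <= 1 -> K (g t) \/ L (g t).
  by move=> t0 t1; apply: vU => //; [left|right].
have g0 : g 0 = k by exact: lin0.
have g1 : g 1 = l by exact: lin1.
pose B := `[0, 1]%classic `&` g @^-1` K.
(* On [0, 1] the parameters with value in [K] form a closed set, and an open one since they are
   those with value outside the closed set [L]; connectedness leaves the whole interval. *)
have E : B = `[0, 1]%classic.
  apply: (@segment_connected R 0 1).
  - by exists 0; rewrite /B /=; split; rewrite ?g0// /= in_itv /= lexx ler01.
  - exists (g @^-1` ~` L).
      by apply: open_comp; [move=> ? _; exact: cg|exact: closed_openC].
    apply/seteqP; split => t [/= +] kt; rewrite in_itv /= => /andP[t0 t1].
      by split; rewrite /= ?in_itv /= ?t0//; move=> /(disj t t0 t1 kt).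
    by split; rewrite /= ?in_itv /= ?t0//; case: (cov t t0 t1) => // /kt.
  by exists (g @^-1` K) => //; apply: preimage_closed => // ? _; exact: cg.
have : B 1 by rewrite E /= in_itv /= lexx ler01.
by move=> [_ /=] k1; apply: (disj 1); rewrite ?ler01// g1.
Qed.

(** The matrix on the right is the inverse transpose of the one on the left. *)
Lemma polar_lmap a b c d P : a * d - b * c = 1 ->
  polar (lmap a b c d @` P) = lmap d (- c) (- b) a @` polar P.
Proof.
move=> D; rewrite [RHS]lmap_image; last by rewrite -D; ring.
rewrite !opprK; apply/seteqP; split => y h x.
  move=> Px; have := h _ (ex_intro2 _ _ x Px erefl).
  by rewrite /dot /=; lra.
move=> [x' Px' <-]; have := h x' Px'; rewrite /dot /=; lra.
Qed.

(* Rotated by [rho^-1] to turn contravariance into covariance. *)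
Definition polar_moment P : pt := ((moment (polar P)).2, - (moment (polar P)).1).

Lemma valuation_moment : valuation_on_Po (@moment R).
Proof. by move=> K L pK pL _ _; apply: moment_setU_setI; exact: tame_polygon. Qed.

Lemma valuation_polar_moment : valuation_on_Po polar_moment.
Proof.
move=> K L pK pL pU _; rewrite /polar_moment polar_setI// polar_setU.
have [e1 e2] := moment_setU_setI (tame_polar pK) (tame_polar pL).
by apply: pt_eq => /=; lra.
Qed.

Lemma covariant_moment : covariant (@moment R).
Proof. by move=> a b c d P D pP; apply: moment_lmap => //; exact: tame_polygon. Qed.

Lemma covariant_polar_moment : covariant polar_moment.
Proof.
move=> a b c d P D pP; rewrite /polar_moment polar_lmap// moment_lmap; last exact: tame_polar.
  by apply: pt_eq => /=; ring.
by rewrite -D; ring.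
Qed.

Lemma segment_bounded_moment : segment_bounded (@moment R).
Proof.
move=> s p q ip iq; have [M M0 hM] := hull_box (p :: q :: s).
exists (M * (2 * M * (2 * M))) => t t0 t1; apply: moment_bound => //.
  exact: hull_measurable.
apply: subset_trans hM; apply: hull_sub => r; rewrite inE => /predU1P[->|rs].
  by apply: hull_cvx => //; in_hull.
by in_hull.
Qed.

(** All polygons along the segment contain a common ball, the one inside both end polygons, so their
    polars lie in a common box. *)
Lemma segment_bounded_polar_moment : segment_bounded polar_moment.
Proof.
move=> s p q ip iq; have [e [e0 he]] := in_interior_setI ip iq.
have M0 : 0 < 2 / e by rewrite divr_gt0.
exists (2 / e * (2 * (2 / e) * (2 * (2 / e)))) => t t0 t1 /=; rewrite normrN.
have [|h1 h2] := moment_bound M0 M0 (polar_measurable (hull (lin t p q :: s))).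
  by apply: polar_sub_box => // y /he; exact: hull_lin_supset.
by split.
Qed.

End Polar.

(** * Independence of the two model valuations *)

Section Independence.
Import numFieldNormedType.Exports.
Variable R : realType.
Notation pt := (R * R)%type.
Notation TR := (measurableTypeR R).
Notation leb2 := (@Defs.leb2 R).
Implicit Types (P K L : set pt) (x y : pt) (s : seq pt).

Lemma polar_hull s y : polar (hull s) y <-> forall p, p \in s -> dot y p <= 1.
Proof.
split => [h p ps|h]; first by apply: h; exact: hull_in.
apply: (hull_min (C := [set x | dot y x <= 1])) => //.
move=> p q t /= hp hq t0 t1; have -> : dot y (lin t p q) = (1 - t) * dot y p + t * dot y q.
  by rewrite /dot /=; ring.
nra.
Qed.

Definition rectangle (a b c d : R) : set (TR * TR) := `[a, b]%classic `*` `[c, d]%classic.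

Lemma rectangleE a b c d x : rectangle a b c d x <-> (a <= x.1 <= b) && (c <= x.2 <= d).
Proof.
split; first by move=> [/=]; rewrite !in_itv /= => -> ->.
by move=> /andP[h1 h2]; split; rewrite /= in_itv.
Qed.

Lemma rectangle_hull a b c d : a < b -> c < d ->
  rectangle a b c d = hull [:: (a, c); (b, c); (a, d); (b, d)].
Proof.
move=> ab cd; apply/seteqP; split => [x /rectangleE/andP[/andP[x1 x2] /andP[x3 x4]]|].
  set S := hull _.
  pose t := (x.1 - a) / (b - a); pose u := (x.2 - c) / (d - c).
  have seg (w : R) : S (a, w) -> S (b, w) -> S (x.1, w).
    move=> h1 h2; have -> : (x.1, w) = lin t (a, w) (b, w).
      by apply: pt_eq => /=; rewrite /t; field; lra.
    by apply: hull_cvx => //; rewrite /t ?divr_ge0 ?ler_pdivrMr; lra.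
  have Sc : S (x.1, c) by apply: seg; in_hull.
  have Sd : S (x.1, d) by apply: seg; in_hull.
  have -> : x = lin u (x.1, c) (x.1, d).
    by apply: pt_eq => /=; rewrite /u; field; lra.
  by apply: hull_cvx => //; rewrite /u ?divr_ge0 ?ler_pdivrMr; lra.
apply: hull_min => [p q t /rectangleE/andP[/andP[x1 x2] /andP[x3 x4]]|p].
  move=> /rectangleE/andP[/andP[y1 y2] /andP[y3 y4]] t0 t1.
  by apply/rectangleE => /=; apply/andP; split; apply/andP; split; nra.
rewrite !inE => /or4P[] /eqP ->; apply/rectangleE => /=; rewrite !lexx ?andbT /=; lra.
Qed.

(** The rectangle sticks out far to the right, so its moment dominates those of the sets contained
    in the box [-1, 1] x [-1, 1], among them its own polar and the kite [K] with polar [Q]. *)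
Notation Q := (rectangle (-1) 4 (-1) 1).
Notation K := (hull [:: (-1, 0); (1 / 4, 0); (0, 1); (0, -1)] : set pt).

Lemma polygon_rectangle : polygon_o (Q : set pt).
Proof.
rewrite rectangle_hull; [|lra|lra]; apply: inn_polygon.
rewrite /inn -rectangle_hull; [|lra|lra]; exists 1; split; first exact: ltr01.
move=> y /edist0_lt[]; rewrite !ltr_norml => /andP[a b] /andP[c d].
by apply/rectangleE; apply/andP; split; apply/andP; split; lra.
Qed.

Lemma polygon_kite : polygon_o K.
Proof.
apply: inn_polygon; have D : @det2 R (1, 0) (0, 1) != 0 by rewrite /det2 /= mulr1 mul0r subr0 oner_eq0.
apply: (cvx_axes_in_interior (@hull_cvx R _) D (a := 1 / 4) (b := 1) (c := 1) (d := 1)); rewrite ?ltr01//; try lra;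
  apply: hull_in; rewrite /= !mulr0 !mulr1 !inE eqxx ?orbT//.
Qed.

Lemma polar_kite : polar K = Q.
Proof.
apply/seteqP; split => y.
  move=> /polar_hull h; apply/rectangleE.
  have := h (-1, 0); have := h (1 / 4, 0); have := h (0, 1); have := h (0, -1).
  rewrite !inE !eqxx !orbT /dot /= => /(_ isT) h1 /(_ isT) h2 /(_ isT) h3 /(_ isT) h4.
  by apply/andP; split; apply/andP; split; lra.
move=> /rectangleE/andP[/andP[x1 x2] /andP[x3 x4]]; apply/polar_hull => p.
by rewrite !inE => /or4P[] /eqP ->; rewrite /dot /=; lra.
Qed.

Lemma polar_rectangle_box : polar Q `<=` box 1 1.
Proof.
move=> y h.
have H (p : pt) : (-1 <= p.1 <= 4) && (-1 <= p.2 <= 1) -> dot y p <= 1.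
  by move=> /rectangleE/h.
have := H (-1, 0); have := H (1, 0); have := H (0, 1); have := H (0, -1); rewrite /dot /=.
have -> : (-1 <= (0 : R) <= 4) && (-1 <= (-1 : R) <= 1) by apply/andP; split; apply/andP; split; lra.
have -> : (-1 <= (0 : R) <= 4) && (-1 <= (1 : R) <= 1) by apply/andP; split; apply/andP; split; lra.
have -> : (-1 <= (1 : R) <= 4) && (-1 <= (0 : R) <= 1) by apply/andP; split; apply/andP; split; lra.
have -> : (-1 <= (-1 : R) <= 4) && (-1 <= (0 : R) <= 1) by apply/andP; split; apply/andP; split; lra.
move=> /(_ isT) h1 /(_ isT) h2 /(_ isT) h3 /(_ isT) h4.
by apply/rectangleE; apply/andP; split; apply/andP; split; lra.
Qed.

Lemma kite_box : K `<=` box 1 1.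
Proof.
have -> : box 1 1 = rectangle (-1) 1 (-1) 1 by [].
rewrite rectangle_hull; [|lra|lra]; apply: hull_sub => p.
rewrite -rectangle_hull; [|lra|lra].
by rewrite !inE => /or4P[] /eqP ->; apply/rectangleE => /=; apply/andP; split; apply/andP; split; lra.
Qed.

Lemma moment_box M : 0 < M -> moment (box M M) = ((0, 0) : pt).
Proof.
move=> M0; have t : tame (box M M).
  by split; [exact: measurable_box|exists M].
have D : (-1 : R) * -1 - 0 * 0 = 1 by ring.
have := moment_lmap D t; have -> : lmap (-1) 0 0 (-1) @` box M M = box M M.
  rewrite lmap_image//; apply/seteqP; split => x; rewrite /mkset /box => /rectangleE h;
    by apply/rectangleE; move: h; rewrite /= => /andP[/andP[x1 x2] /andP[x3 x4]];
       apply/andP; split; apply/andP; split; lra.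
by move=> [e1 e2]; apply: pt_eq => /=; lra.
Qed.

(** The square [-1, 1] x [-1, 1] has moment zero by symmetry; the rest has area 6 and first
    coordinate at least 1. *)
Lemma moment_rectangle_ge : 6 <= (moment (Q : set pt)).1.
Proof.
pose I : set TR := `]1, 4]%classic; pose J : set TR := `[-1, 1]%classic.
pose B : set (TR * TR) := `]1, 4]%classic `*` `[-1, 1]%classic.
have mB : measurable B by apply: measurableX; exact: measurable_itv.
have E : Q = box 1 1 `|` B.
  apply/seteqP; split => x.
    move=> /rectangleE/andP[/andP[x1 x2] /andP[x3 x4]].
    have [h|h] := lerP x.1 1; [left|right]; split; rewrite /= in_itv /=; apply/andP; split => //.
  case; [move=> /rectangleE/andP[/andP[x1 x2] /andP[x3 x4]]|move=> [/=]; rewrite !in_itv /= => /andP[x1 x2] /andP[x3 x4]];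
    by apply/rectangleE; apply/andP; split; apply/andP; split; lra.
have tQ := tame_polygon polygon_rectangle.
have BQ : B `<=` Q by rewrite E => x; right.
have tB : tame B by split => //; have [_ [M M0 h]] := tQ; exists M => // x /BQ/h.
have IQ := integrable_fst tQ; have IB := integrable_fst tB.
have e1 : (moment (Q : set pt)).1 = (moment (box 1 1 : set pt)).1 + (moment (B : set pt)).1.
  rewrite /moment /= {1}E; apply: Rintegral_setU => //.
  - exact: measurable_box.
  - by rewrite -E.
  - by apply/disj_setPS => x [[/= + _] [/= + _]]; rewrite !in_itv /=; lra.
rewrite e1 moment_box ?ltr01// add0r.
have Ic : leb2.-integrable B (EFin \o (cst 1 : TR * TR -> R)).
  have [_ [M M0 h]] := tB.
  by apply: (bounded_integrable M0 M0 mB h (C := 1)) => // x _; rewrite normr1.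
have le := @le_Rintegral _ _ R leb2 B (cst 1) fst mB Ic IB.
rewrite /moment /=; apply: le_trans (le _); last first.
  by move=> x [/=]; rewrite in_itv /= => /andP[/ltW].
rewrite Rintegral_cst// mul1r.
have mE : leb2 B = (lebesgue_measure I * lebesgue_measure J)%E.
  by apply: product_measure1E; exact: measurable_itv.
suff : 6 <= fine (leb2 B) by [].
rewrite mE !lebesgue_measure_itv /= !lte_fin.
have -> : (1 : R) < 4 by lra.
have -> : (-1 : R) < 1 by lra.
by rewrite -!EFinB -EFinM /=; lra.
Qed.

Lemma moments_independent (a b : R) :
  (forall P, polygon_o P -> comb a b (@moment R) (@polar_moment R) P = (0, 0)) -> a = 0 /\ b = 0.
Proof.
move=> h; have m6 := moment_rectangle_ge.
have h1 : a * (moment Q).1 + b * (moment (polar Q)).2 = 0.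
  by have /(congr1 fst) := h _ polygon_rectangle.
have h2 : a * (moment K).2 + b * - (moment Q).1 = 0.
  by have /(congr1 snd) := h _ polygon_kite; rewrite /comb /polar_moment polar_kite.
move: h1 h2.
have [_ b1] := moment_bound ltr01 ltr01 (polar_measurable _) polar_rectangle_box.
have [|_ b2] := moment_bound ltr01 ltr01 _ kite_box; first exact: hull_measurable.
move: (moment Q).1 (moment (polar Q)).2 (moment K).2 m6 b1 b2 => m u v m6.
rewrite !ler_norml => /andP[u1 u2] /andP[v1 v2] h1 h2.
(* Elimination of b from the two equations. The coefficient is positive because m is at least 6,
   while u and v are at most 4 in absolute value. *)
have E : a * (m ^+ 2 + u * v) = 0.
  transitivity ((a * m + b * u) * m + (a * v + b * - m) * u); first by ring.
  by rewrite h1 h2; ring.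
have m0 : m ^+ 2 + u * v != 0 by rewrite gt_eqF//; nra.
have a0 : a = 0 by move/eqP: E; rewrite mulf_eq0 (negPf m0) orbF => /eqP.
split => //; move/eqP: h2; rewrite a0 mul0r add0r mulf_eq0 oppr_eq0 => /orP[/eqP//|/eqP]; lra.
Qed.

End Independence.

(** * Measurability *)

Section Regularity.
Import numFieldNormedType.Exports.
Variable R : realType.
Notation pt := (R * R)%type.
Notation TR := (measurableTypeR R).
Implicit Types (P K L : set pt) (p q x y : pt) (s : seq pt) (t h e : R).

Lemma edist_le x y : Defs.edist x y <= `|x.1 - y.1| + `|x.2 - y.2|.
Proof.
rewrite /Defs.edist; have n1 := normr_ge0 (x.1 - y.1); have n2 := normr_ge0 (x.2 - y.2).
rewrite -[leRHS]ger0_norm ?addr_ge0// -sqrtr_sqr ler_wsqrtr//.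
rewrite -[(x.1 - y.1) ^+ 2]real_normK ?num_real// -[(x.2 - y.2) ^+ 2]real_normK ?num_real//.
rewrite -subr_ge0; have -> : forall u v : R, (u + v) ^+ 2 - (u ^+ 2 + v ^+ 2) = 2 * (u * v) by move=> u v; ring.
by rewrite mulr_ge0// mulr_ge0.
Qed.

Lemma hull_lin_close s p q t t' x : hull (lin t p q :: s) x ->
  exists2 y, hull (lin t' p q :: s) y &
    Defs.edist x y <= `|t - t'| * (`|p.1 - q.1| + `|p.2 - q.2|).
Proof.
set c1 := `|t - t'| * `|p.1 - q.1|; set c2 := `|t - t'| * `|p.2 - q.2|.
have c10 : 0 <= c1 by rewrite mulr_ge0.
have c20 : 0 <= c2 by rewrite mulr_ge0.
pose C : set pt := [set x | exists2 y, hull (lin t' p q :: s) y &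
  `|x.1 - y.1| <= c1 /\ `|x.2 - y.2| <= c2].
have cvx_norm (a b c r : R) : 0 <= r -> r <= 1 -> `|a| <= c -> `|b| <= c -> `|(1 - r) * a + r * b| <= c.
  by rewrite !ler_norml => r0 r1 /andP[a1 a2] /andP[b1 b2]; apply/andP; split; nra.
(* The points close to a convex set form a convex set, so it suffices to compare the generators. *)
have sub : hull (lin t p q :: s) `<=` C.
  apply: hull_min => [u v r [u' hu [u1 u2]] [v' hv [v1 v2]] r0 r1|u].
    exists (lin r u' v'); first exact: hull_cvx.
    have E (a b c d : R) : (1 - r) * a + r * b - ((1 - r) * c + r * d) = (1 - r) * (a - c) + r * (b - d) by ring.
    by split; rewrite /= E; apply: cvx_norm.
  rewrite inE => /predU1P[->|us].
    exists (lin t' p q); first by apply: hull_in; rewrite mem_head.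
    have E (a b : R) : (1 - t) * a + t * b - ((1 - t') * a + t' * b) = (t' - t) * (a - b) by ring.
    by split; rewrite /= E normrM distrC.
  exists u; first by in_hull.
  by rewrite !subrr normr0.
move=> /sub[y hy [y1 y2]]; exists y => //.
by apply: (le_trans (edist_le x y)); rewrite mulrDr; exact: lerD.
Qed.

Lemma dist_pt_set_le x y L : L y -> dist_pt_set x L <= Defs.edist x y.
Proof.
move=> Ly; apply: ge_inf; last by exists y.
by exists 0 => _ [w _ <-]; exact: sqrtr_ge0.
Qed.

Lemma hausdorff_hull_lin s p q t t' : hausdorff (hull (lin t p q :: s)) (hull (lin t' p q :: s)) <=
  `|t - t'| * (`|p.1 - q.1| + `|p.2 - q.2|).
Proof.
have ne r : hull (lin r p q :: s) !=set0 by exists (lin r p q); apply: hull_in; rewrite mem_head.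
rewrite /hausdorff ge_max; apply/andP; split; apply: ge_sup.
- by have [x hx] := ne t; exists (dist_pt_set x (hull (lin t' p q :: s))); exists x.
- move=> _ [x hx <-]; have [y hy xy] := hull_lin_close t' hx.
  exact: le_trans (dist_pt_set_le x hy) xy.
- by have [x hx] := ne t'; exists (dist_pt_set x (hull (lin t p q :: s))); exists x.
move=> _ [x hx <-]; have [y hy xy] := hull_lin_close t hx.
by rewrite distrC; exact: le_trans (dist_pt_set_le x hy) xy.
Qed.

Notation I := (`[0, 1]%classic : set TR).

(** The path is Lipschitz for the Hausdorff distance by [hausdorff_hull_lin], so preimages of open
    families are relatively open in [0, 1]; the others follow by minimality of the generated
    sigma-algebra. *)
Lemma measurable_hull_lin s p q (A : set (set pt)) : inn (p :: s) -> inn (q :: s) -> borel_Po A ->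
  measurable (I `&` (fun t => hull (lin t p q :: s)) @^-1` A : set TR).
Proof.
move=> ip iq; set g := fun t => _; have mI : measurable I by exact: measurable_itv.
have gP t : I t -> polygon_o (g t).
  rewrite /= in_itv /= => /andP[t0 t1]; exact/inn_polygon/inn_lin.
apply: (smallest_sub (X := [set A | measurable (I `&` g @^-1` A : set TR)])).
  split.
  - by rewrite /mkset preimage_set0 setI0; exact: measurable0.
  - move=> B mB; rewrite /mkset.
    have -> : I `&` g @^-1` (polygon_o (R := R) `\` B) = I `\` (I `&` g @^-1` B).
      apply/seteqP; split => t [It h]; split => //; first by move=> [_ /(h.2)].
      by split; [exact: gP|move=> Bt; apply: h].
    exact: measurableD.
  - move=> F mF; rewrite /mkset preimage_bigcup setI_bigcupr.
    exact: bigcupT_measurable.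
move=> B [_ oB]; rewrite /mkset.
(* The union of the open intervals whose trace on [0, 1] is mapped into [B]: an open set of the
   whole line with the same trace as the preimage. *)
pose U : set R := [set t | exists t0 d, `|t - t0| < d /\ forall t', I t' -> `|t' - t0| < d -> B (g t')].
have -> : I `&` g @^-1` B = I `&` U.
  apply/seteqP; split => t [It]; last by move=> [t0 [d [td h]]]; split => //; exact: h.
  move=> Bt; split => //; have [e [e0 he]] := oB _ Bt.
  pose D := `|p.1 - q.1| + `|p.2 - q.2| + 1.
  have D0 : 0 < D by rewrite ltr_wpDl// addr_ge0.
  exists t, (e / D); split; first by rewrite subrr normr0 divr_gt0.
  move=> t' It'; rewrite ltr_pdivlMr// => tt'; apply: he; first exact: gP.
  apply: (le_lt_trans (hausdorff_hull_lin s p q t t')).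
  apply: le_lt_trans tt'; rewrite distrC; apply: ler_wpM2l => //.
  by rewrite /D lerDl.
apply: measurableI => //; apply: open_measurable.
rewrite openE => t [t0 [d [td h]]]; apply/nbhs_ballP; exists (d - `|t - t0|); first by rewrite /= subr_gt0.
move=> t' tt'; exists t0, d; split => //.
have := ler_distD t t' t0; move: tt'; rewrite /ball /= [`|t - t'|]distrC; lra.
Qed.

Lemma eopen_box M : eopen [set x : pt | `|x.1| < M /\ `|x.2| < M].
Proof.
move=> x [x1 x2]; exists (Num.min (M - `|x.1|) (M - `|x.2|)); split.
  by rewrite lt_min !subr_gt0 x1.
move=> y; rewrite lt_min => /andP[h1 h2].
have d1 : `|x.1 - y.1| <= Defs.edist x y.
  by rewrite -sqrtr_sqr ler_wsqrtr// lerDl sqr_ge0.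
have d2 : `|x.2 - y.2| <= Defs.edist x y.
  by rewrite -sqrtr_sqr ler_wsqrtr// lerDr sqr_ge0.
have n1 := ler_normB x.1 (x.1 - y.1); have n2 := ler_normB x.2 (x.2 - y.2).
have E (a b : R) : a - (a - b) = b by ring.
by rewrite !E in n1 n2; split; lra.
Qed.

(* Steinhaus' argument: otherwise the set and its translate are disjoint, of total measure
   more than 4/3, in an interval of length less than 4/3. *)
Lemma large_set_meets_translate (E : set TR) h : measurable E -> E `<=` I ->
  ((2 / 3)%:E < lebesgue_measure E)%E -> 0 < h -> h < 1 / 3 ->
  exists t, E t /\ E (t + h).
Proof.
move=> mE EI lE h0 h1; apply: contrapT => H.
pose E' : set TR := (fun t => h + t) @^-1` E.
have mE' : measurable E' by rewrite -[E']setTI; exact: measurable_translation.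
have dis : E `&` E' = set0.
  by apply/seteqP; split => // t [Et]; rewrite /E' /= addrC => Et'; apply: H; exists t.
pose J : set TR := `[- h, 1]%classic.
have sub : E `|` E' `<=` J.
  by move=> t [/EI|/EI]; rewrite /J /= !in_itv /= => /andP[a b]; apply/andP; split; lra.
have le : (lebesgue_measure (E `|` E') <= lebesgue_measure J)%E.
  apply: le_measure => //; rewrite inE; [exact: measurableU|exact: measurable_itv].
rewrite measureU// [X in (_ + X)%E]lebesgue_translation// in le.
move: le; rewrite /J lebesgue_measure_itv /= lte_fin.
have -> : - h < 1 by lra.
rewrite -EFinB => le.
have : ((2 / 3)%:E + (2 / 3)%:E < (1 - - h)%:E)%E by apply: lt_le_trans le; apply: lteD.
by rewrite -EFinD lte_fin; lra.
Qed.

Lemma measurable_regular (mu : set pt -> pt) : measurable_on_Po mu ->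
  forall s p q, inn (p :: s) -> inn (q :: s) ->
  exists M : R, forall h, 0 < h -> h < 1 / 3 -> exists t, [/\ 0 <= t, t + h <= 1,
    `|(mu (hull (lin t p q :: s))).1| <= M /\ `|(mu (hull (lin t p q :: s))).2| <= M &
    `|(mu (hull (lin (t + h) p q :: s))).1| <= M /\ `|(mu (hull (lin (t + h) p q :: s))).2| <= M].
Proof.
move=> mmu s p q ip iq; set g := fun t => hull (lin t p q :: s).
pose U M : set pt := [set x : pt | `|x.1| < M /\ `|x.2| < M].
pose E (n : nat) : set TR := I `&` g @^-1` (polygon_o (R := R) `&` mu @^-1` U n%:R).
have mE n : measurable (E n).
  apply: measurable_hull_lin => //; apply: mmu; apply: sub_sigma_algebra; exact: eopen_box.
have gP t : I t -> polygon_o (g t).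
  rewrite /= in_itv /= => /andP[t0 t1]; exact/inn_polygon/inn_lin.
have UE : \bigcup_n E n = I.
  apply/seteqP; split => [t [n _ []]//|t It].
  pose N := (Num.bound (`|(mu (g t)).1| + `|(mu (g t)).2|)).
  exists N => //; split => //; split; first exact: gP.
  have := archi_boundP (addr_ge0 (normr_ge0 (mu (g t)).1) (normr_ge0 (mu (g t)).2)).
  have := normr_ge0 (mu (g t)).1; have := normr_ge0 (mu (g t)).2.
  by rewrite /U /= -/N => a b c; split; lra.
(* The sets [E n] increase to [0, 1], so by continuity from below their measures tend to 1. *)
have [n En] : exists n, ((2 / 3)%:E < lebesgue_measure (E n))%E.
  apply: contrapT => H.
  have le n : (lebesgue_measure (E n) <= (2 / 3)%:E)%E.
    by rewrite leNgt; apply/negP => h; apply: H; exists n.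
  have ndE : nondecreasing_seq E.
    move=> m n mn; apply/subsetPset => t [It [pt [h1 h2]]]; split => //; split => //.
    by split; [apply: lt_le_trans h1 _|apply: lt_le_trans h2 _]; rewrite ler_nat.
  have mU : measurable (\bigcup_n E n) by exact: bigcupT_measurable.
  have cv := nondecreasing_cvg_mu (mu := @lebesgue_measure R) mE mU ndE.
  have : (lebesgue_measure (\bigcup_n E n) <= (2 / 3)%:E)%E.
    rewrite -(cvg_lim _ cv)//; apply: lime_le; first by apply: cvgP cv.
    by apply: nearW => n; exact: le.
  by rewrite UE lebesgue_measure_itv /= lte_fin ltr01 oppr0 adde0 lee_fin; lra.
exists n%:R => h h0 h1.
have [|t [Et Eth]] := large_set_meets_translate (mE n) _ En h0 h1; first by move=> t [].
move: Et Eth => [It [_ [a b]]] [Ith [_ [c d]]]; exists t.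
move: It Ith; rewrite /= !in_itv /= => /andP[t0 _] /andP[_ th].
by split => //; split; exact: ltW.
Qed.

End Regularity.

(** * The classification *)

Section Contravariant.
Variable R : realType.
Notation pt := (R * R)%type.
Implicit Types (mu : set pt -> pt) (P : set pt).

Definition unrotate mu P : pt := ((mu P).2, - (mu P).1).

Definition mx22 (a b c d : R) : 'M[R]_2 :=
  \matrix_(i, j) if i == 0 then (if j == 0 then a else b) else (if j == 0 then c else d).

Lemma mx_app22 a b c d : mx_app (mx22 a b c d) = lmap a b c d.
Proof. by apply/funext => x; rewrite /mx_app !mxE. Qed.

Lemma invmx22 a b c d : a * d - b * c = 1 -> invmx (mx22 a b c d) = mx22 d (- b) (- c) a.
Proof.
move=> D; have E : mx22 a b c d *m mx22 d (- b) (- c) a = 1%:M.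
  apply/matrixP => i j; rewrite !mxE !big_ord_recl big_ord0 !mxE /=.
  case: i => -[|[|//]] hi; case: j => -[|[|//]] hj; rewrite /= ?mulr1n ?mulr0n.
  - by rewrite -D; ring.
  - by ring.
  - by ring.
  - by rewrite -D; ring.
have [u _] := mulmx1_unit E.
by rewrite -[LHS]mulmx1 -E mulmxA mulVmx// mul1mx.
Qed.

(** Conjugation by the quarter turn takes the inverse transpose of a matrix of determinant 1 back to
    the matrix. *)
Lemma covariant_unrotate mu : SL2_contravariant mu -> covariant (unrotate mu).
Proof.
move=> cmu a b c d P D pP; rewrite /unrotate.
have := cmu (mx22 a b c d) P; rewrite mx_app22 invmx22// => -> //.
  by rewrite /mx_app !mxE /=; apply: pt_eq => /=; ring.
by rewrite (expand_det_row _ 0) !big_ord_recl big_ord0 /cofactor !det_mx11 !mxE /=; rewrite /bump /=; lra.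
Qed.

Lemma valuation_unrotate mu : valuation_on_Po mu -> valuation_on_Po (unrotate mu).
Proof.
move=> vmu K L pK pL pU pI; have [e1 e2] := vmu K L pK pL pU pI.
by apply: pt_eq => /=; lra.
Qed.

Lemma regular_unrotate mu : measurable_on_Po mu -> regular (unrotate mu).
Proof.
move=> mmu s p q ip iq; have [M hM] := measurable_regular mmu ip iq.
exists M => h h0 h1; have [t [t0 th [m1 m2] [m3 m4]]] := hM h h0 h1.
by exists t; split => //; rewrite /unrotate /= normrN.
Qed.

End Contravariant.

Theorem theorem3p11 (R : realType) (mu : set (R * R) -> R * R) :
  measurable_on_Po mu -> valuation_on_Po mu -> SL2_contravariant mu ->
  exists k1 k2 : R, forall P : set (R * R), polygon_o P ->
    mu P = vadd (vscale k1 (moment (polar P))) (vscale k2 (rot90 (moment P))).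
Proof.
move=> mmu vmu cmu.
have [||||||||||a [b h]] := @solutions_2dim R (unrotate mu) (@moment R) (@polar_moment R).
- exact: valuation_unrotate.
- exact: covariant_unrotate.
- exact: regular_unrotate.
- exact: valuation_moment.
- exact: covariant_moment.
- exact: segment_bounded_moment.
- exact: valuation_polar_moment.
- exact: covariant_polar_moment.
- exact: segment_bounded_polar_moment.
- exact: moments_independent.
(* Rotating back turns [polar_moment] into the moment vector of the polar, so its coefficient b
   comes first, and the moment vector into its rotation. *)
exists b, a => P pP; have [e1 e2] := h P pP.
by apply: pt_eq => /=; rewrite ?e1; lra.
Qed.
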